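(* Let $M=M^n$ be a Wintgen ideal submanifold of dimension $n\ge 4$ and codimension $m\ge 1$ in a real space form $\mathbb{R}^{n+m}(\widetilde{k})$. If $\widetilde{k}>0$, then the tensors $R\cdot C$ and $Q(\mathrm{Ricc},R)$ are linearly dependent if and only if $M$ is totally umbilical in $\mathbb{R}^{n+m}(\widetilde{k})$ (and hence $M$ is conformally flat).
   Context: Manifolds are connected, Riemannian and of class $C^\infty$. $\mathbb{R}^{n+m}(\widetilde{k})$ is a real space form: a Riemannian manifold of dimension $n+m$ and constant curvature $\widetilde{k}$, with metric $\widetilde{g}$. The submanifold $M$ carries the induced metric $g$ with Levi-Civita connection $\nabla$; $h$ is its second fundamental form and the shape operator $A_\xi$ for a normal field $\xi$ is given by $g(A_\xi X,Y)=\widetilde{g}(\xi,h(X,Y))$. $\{E_i\}_{i=1}^n$ is any local orthonormal tangent frame and $\{\xi_\alpha\}_{\alpha=1}^m$ any local orthonormal normal frame; $A_\alpha=A_{\xi_\alpha}$. The mean curvature vector is $\vec{H}=\frac1n\sum_i h(E_i,E_i)$ and $H=\|\vec{H}\|$. $M$ is totally umbilical if $h(X,Y)=g(X,Y)\vec{H}$. For a symmetric $(0,2)$-tensor $A$: $(X\wedge_A Y)Z=A(Y,Z)X-A(X,Z)Y$. $\mathcal{R}(X,Y)Z=\nabla_X\nabla_YZ-\nabla_Y\nabla_XZ-\nabla_{[X,Y]}Z$, $R(X,Y,Z,W)=g(\mathcal{R}(X,Y)Z,W)$, $\mathrm{Ricc}(X,Y)=\mathrm{tr}\{Z\mapsto\mathcal{R}(Z,X)Y\}$,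 $g(\mathcal{S}X,Y)=\mathrm{Ricc}(X,Y)$, $\kappa=\mathrm{tr}\,\mathcal{S}$, and the Weyl tensor is $C(X,Y,Z,W)=g(\mathcal{C}(X,Y)Z,W)$ with $\mathcal{C}(X,Y)=\mathcal{R}(X,Y)-\frac1{n-2}\left(X\wedge_g\mathcal{S}Y+\mathcal{S}X\wedge_gY-\frac{\kappa}{n-1}X\wedge_gY\right)$. For a skew family of endomorphisms $\mathcal{B}(X,Y)$ and a $(0,k)$-tensor $T$ put $(\mathcal{B}(X,Y)\cdot T)(X_1,\dots,X_k)=-\sum_{j=1}^k T(X_1,\dots,\mathcal{B}(X,Y)X_j,\dots,X_k)$. The $(0,k+2)$-tensors $R\cdot T$, $C\cdot T$, $Q(A,T)$ are defined by $(X_1,\dots,X_k;X,Y)\mapsto(\mathcal{B}(X,Y)\cdot T)(X_1,\dots,X_k)$ with $\mathcal{B}(X,Y)=\mathcal{R}(X,Y)$, $\mathcal{C}(X,Y)$, $X\wedge_AY$ respectively. Two tensors $T_1,T_2$ are called linearly dependent (on $M$) if they are linearly dependent at every point of $M$; on the set where $T_2\neq0$ this means $T_1=L\,T_2$ for some function $L$. Normalized scalar curvature: $\rho=\frac{2}{n(n-1)}\sum_{i<j}R(E_i,E_j,E_j,E_i)$. Normal curvature: $R^\perp(X,Y;\xi,\eta)=g([A_\xi,A_\eta]X,Y)$, and $\rho^\perp=\frac{2}{n(n-1)}\sqrt{\sum_{i<j}\sum_{\alpha<\beta}R^\perp(E_i,E_j;\xi_\alpha,\xi_\beta)^2}$.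 $M$ is a Wintgen ideal submanifold if $\rho=H^2-\rho^\perp+\widetilde{k}$ everywhere on $M$ (equality in the Wintgen inequality $\rho\le H^2-\rho^\perp+\widetilde{k}$). *)

(* Defs.v *)
From mathcomp Require Import all_boot all_order all_algebra.
From mathcomp Require Import all_classical all_reals all_analysis.
Import Order.TTheory GRing.Theory Num.Theory numFieldNormedType.Exports.

Set Implicit Arguments.
Unset Strict Implicit.
Unset Printing Implicit Defensive.

Local Open Scope classical_set_scope.
Local Open Scope ring_scope.

Section Smooth.
Context {R : realType} {n : nat} {W : normedModType R}.

(* Only meant for open U: all (directional) derivatives up to order k exist
   (differentiability in the Frechet sense below order k) and are continuous. *)
Fixpoint Ck_on (k : nat) (U : set 'rV[R]_n) (F : 'rV[R]_n -> W) : Prop :=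
  match k with
  | 0 => forall x, U x -> {for x, continuous F}
  | k'.+1 => (forall x, U x -> differentiable F x) /\
             forall v, Ck_on k' U (fun x => 'D_v F x)
  end.

Definition smooth_on (U : set 'rV[R]_n) (F : 'rV[R]_n -> W) : Prop :=
  forall k, Ck_on k U F.

End Smooth.

Section PointwiseAlgebra.
Context {R : realType} {n : nat}.
Local Notation V := 'rV[R]_n.
Implicit Types (G : 'M[R]_n) (X Y Z : V).

Definition form G X Y : R := (X *m G *m Y^T) 0 0.

(* For G symmetric and invertible, the vector u with form G u w = l w for
   every w (l linear). *)
Definition sharp G (l : V -> R) : V :=
  (\row_j l (delta_mx 0 j)) *m invmx G.

Definition trace (L : V -> V) : R := \tr (lin1_mx L).

Definition orthonormal k G (E : 'I_k -> V) : Prop :=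
  forall i j, form G (E i) (E j) = (i == j)%:R.

Definition wedge (A : V -> V -> R) X Y Z : V := A Y Z *: X - A X Z *: Y.

(* In what follows RR is the curvature operator (X, Y, Z) |-> R(X,Y)Z at a
   point and G the metric there. *)

Definition ricc (RR : V -> V -> V -> V) X Y : R := trace (fun Z => RR Z X Y).

Definition ricci_op G (RR : V -> V -> V -> V) X : V := sharp G (ricc RR X).

Definition kappa G (RR : V -> V -> V -> V) : R := trace (ricci_op G RR).

Definition weyl_op G (RR : V -> V -> V -> V) X Y Z : V :=
  let S := ricci_op G RR in
  let w := wedge (form G) in
  RR X Y Z - (n%:R - 2)^-1 *:
    (w X (S Y) Z + w (S X) Y Z - (kappa G RR / (n%:R - 1)) *: w X Y Z).

Definition lower G (B : V -> V -> V -> V) X1 X2 X3 X4 : R :=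
  form G (B X1 X2 X3) X4.

(* The (0,6)-tensor (X1,X2,X3,X4;X,Y) |-> (B(X,Y) . T)(X1,X2,X3,X4). *)
Definition act (B : V -> V -> V -> V) (T : V -> V -> V -> V -> R)
    X1 X2 X3 X4 X Y : R :=
  - (T (B X Y X1) X2 X3 X4 + T X1 (B X Y X2) X3 X4
     + T X1 X2 (B X Y X3) X4 + T X1 X2 X3 (B X Y X4)).

Definition lin_dependent6 (T1 T2 : V -> V -> V -> V -> V -> V -> R) : Prop :=
  exists a b : R, (a != 0) || (b != 0) /\
    forall X1 X2 X3 X4 X Y,
      a * T1 X1 X2 X3 X4 X Y + b * T2 X1 X2 X3 X4 X Y = 0.

Definition tensor_RC G (RR : V -> V -> V -> V) :=
  act RR (lower G (weyl_op G RR)).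

Definition tensor_QRicR G (RR : V -> V -> V -> V) :=
  act (wedge (ricc RR)) (lower G RR).

Definition norm_scal_curv G (RR : V -> V -> V -> V) (E : 'I_n -> V) : R :=
  2 / (n%:R * (n%:R - 1)) *
  \sum_(i < n) \sum_(j < n | (i < j)%N) lower G RR (E i) (E j) (E j) (E i).

End PointwiseAlgebra.

Section LocalRiemannianGeometry.
Context {R : realType} {n : nat}.
Local Notation V := 'rV[R]_n.
(* The Gram matrix of the metric, as a function of the coordinates; vector
   fields are likewise given by their components in the coordinate frame. *)
Variable g : V -> 'M[R]_n.

(* Christoffel symbols, as a bilinear map:
   2 g(Gamma(u,v),w) = D_u g(v,w) + D_v g(u,w) - D_w g(u,v). *)
Definition christoffel (x u v : V) : V :=
  sharp (g x) (fun w => 2^-1 * (form ('D_u g x) v w + form ('D_v g x) u w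
                                - form ('D_w g x) u v)).

Definition covd (X Y : V -> V) (x : V) : V :=
  'D_(X x) Y x + christoffel x (X x) (Y x).

Definition lie_bracket (X Y : V -> V) (x : V) : V :=
  'D_(X x) Y x - 'D_(Y x) X x.

Definition curvature (X Y Z : V -> V) (x : V) : V :=
  covd X (covd Y Z) x - covd Y (covd X Z) x - covd (lie_bracket X Y) Z x.

(* By tensoriality the tangent vectors u, v, w may be extended by fields with
   constant components. *)
Definition curv_at (x u v w : V) : V :=
  curvature (fun=> u) (fun=> v) (fun=> w) x.

End LocalRiemannianGeometry.

(* A connected smooth Riemannian manifold of dimension n, given by an atlas.
   The metric is recorded chartwise by its Gram matrices; chart_inv and metric
   are junk outside the image of the chart. *)
Record riemannian_manifold (R : realType) (n : nat) := RiemannianManifold {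
  carrier :> topologicalType;
  chart_index : Type;
  dom : chart_index -> set carrier;
  chart : chart_index -> carrier -> 'rV[R]_n;
  chart_inv : chart_index -> 'rV[R]_n -> carrier;
  metric : chart_index -> 'rV[R]_n -> 'M[R]_n;
  _ : hausdorff_space carrier;
  _ : @second_countable carrier;
  _ : connected [set: carrier];
  _ : forall p, exists i, dom i p;
  _ : forall i, open (dom i);
  _ : forall i, open (chart i @` dom i);
  _ : forall i, {within dom i, continuous (chart i)};
  _ : forall i, {within chart i @` dom i, continuous (chart_inv i)};
  _ : forall i p, dom i p -> chart_inv i (chart i p) = p;
  _ : forall i j, smooth_on (chart i @` (dom i `&` dom j))
                            (chart j \o chart_inv i);
  _ : forall i, smooth_on (chart i @` dom i) (metric i);
  _ : forall i x, (chart i @` dom i) x -> (metric i x)^T = metric i x;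
  _ : forall i x, (chart i @` dom i) x ->
        forall u, u != 0 -> 0 < form (metric i x) u u;
  _ : forall i j x, (chart i @` (dom i `&` dom j)) x ->
        let tau := chart j \o chart_inv i in
        forall u v, form (metric i x) u v =
                    form (metric j (tau x)) ('D_u tau x) ('D_v tau x)
}.

Section RiemannianManifold.
Context {R : realType} {n : nat}.
Variable M : riemannian_manifold R n.

Definition metric_at (i : chart_index M) (p : M) : 'M[R]_n :=
  metric i (chart i p).

Definition curv_op (i : chart_index M) (p : M) :
    'rV[R]_n -> 'rV[R]_n -> 'rV[R]_n -> 'rV[R]_n :=
  curv_at (metric i) (chart i p).

(* Constant sectional curvature k. *)
Definition constant_curvature (k : R) : Prop :=
  forall i p, dom i p -> forall u v,
    let G := metric_at i p in
    lower G (curv_op i p) u v v u =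
    k * (form G u u * form G v v - form G u v ^+ 2).

Definition RC_QRicR_dependent : Prop :=
  forall i p, dom i p ->
    lin_dependent6 (tensor_RC (metric_at i p) (curv_op i p))
                   (tensor_QRicR (metric_at i p) (curv_op i p)).

(* Conformal flatness in the sense of the vanishing of the Weyl conformal
   curvature tensor; only meant for n >= 4. *)
Definition conformally_flat : Prop :=
  forall i p, dom i p -> forall X Y Z W,
    lower (metric_at i p) (weyl_op (metric_at i p) (curv_op i p)) X Y Z W = 0.

End RiemannianManifold.

Section Submanifold.
Context {R : realType} {n m : nat}.
Variables (M : riemannian_manifold R n) (N : riemannian_manifold R (n + m)).
Variable f : M -> N.

Definition local_rep (i : chart_index M) (a : chart_index N) :
    'rV[R]_n -> 'rV[R]_(n + m) :=
  chart a \o f \o chart_inv i.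

(* f is an immersion because the metric of M is positive definite. *)
Definition isometric_immersion : Prop :=
  continuous f /\
  forall i a,
    let U := chart i @` (dom i `&` f @^-1` dom a) in
    let F := local_rep i a in
    smooth_on U F /\
    forall x, U x -> forall u v,
      form (metric i x) u v = form (metric a (F x)) ('D_u F x) ('D_v F x).

Section AtPoint.
Variables (i : chart_index M) (a : chart_index N) (p : M).
Local Notation x := (chart i p).
Local Notation F := (local_rep i a).
Local Notation G := (metric_at i p).
Local Notation Gt := (metric_at a (f p)).

(* Gauss formula: h(X,Y) is the difference between the ambient derivative
   along f of df(Y) and df(nabla_X Y), with X, Y extended by the fields with
   constant components u, v. *)
Definition second_form (u v : 'rV[R]_n) : 'rV[R]_(n + m) :=
  'D_u (fun y => 'D_v F y) x + christoffel (metric a) (F x) ('D_u F x) ('D_v F x)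
  - 'D_(covd (metric i) (fun=> u) (fun=> v) x) F x.

Definition shape_op (xi : 'rV[R]_(n + m)) (u : 'rV[R]_n) : 'rV[R]_n :=
  sharp G (fun v => form Gt xi (second_form u v)).

Definition tangent_frame (E : 'I_n -> 'rV[R]_n) : Prop := orthonormal G E.

Definition normal_frame (xi : 'I_m -> 'rV[R]_(n + m)) : Prop :=
  orthonormal Gt xi /\ forall al u, form Gt (xi al) ('D_u F x) = 0.

Definition mean_curv_vec (E : 'I_n -> 'rV[R]_n) : 'rV[R]_(n + m) :=
  n%:R^-1 *: \sum_(j < n) second_form (E j) (E j).

Definition mean_curv (E : 'I_n -> 'rV[R]_n) : R :=
  Num.sqrt (form Gt (mean_curv_vec E) (mean_curv_vec E)).

Definition normal_curv (X Y : 'rV[R]_n) (xi eta : 'rV[R]_(n + m)) : R :=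
  form G (shape_op xi (shape_op eta X) - shape_op eta (shape_op xi X)) Y.

Definition norm_normal_curv (E : 'I_n -> 'rV[R]_n)
    (xi : 'I_m -> 'rV[R]_(n + m)) : R :=
  2 / (n%:R * (n%:R - 1)) *
  Num.sqrt (\sum_(j < n) \sum_(l < n | (j < l)%N)
            \sum_(al < m) \sum_(be < m | (al < be)%N)
              normal_curv (E j) (E l) (xi al) (xi be) ^+ 2).

End AtPoint.

Definition wintgen_ideal (k : R) : Prop :=
  forall i a p, dom i p -> dom a (f p) ->
  forall E xi, tangent_frame i p E -> normal_frame i a p xi ->
    norm_scal_curv (metric_at i p) (curv_op i p) E =
    mean_curv i a p E ^+ 2 - norm_normal_curv i a p E xi + k.

Definition totally_umbilical : Prop :=
  forall i a p, dom i p -> dom a (f p) ->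
  forall E, tangent_frame i p E ->
  forall u v,
    second_form i a p u v = form (metric_at i p) u v *: mean_curv_vec i a p E.

End Submanifold.

(* Main.v *)
(* By the Gauss equation the curvature of M is a constant curvature tensor plus
   the sum of the squares (in the Kulkarni-Nomizu sense) of its shape operators.
   Equality in the Wintgen inequality means that the traceless parts B_al of the
   shape operators satisfy sum ||[B_al, B_be]||^2 = (sum ||B_al||^2)^2, the
   equality case of the DDVV inequality. Rotating the normal frame, the nonzero
   B_al are orthogonal, with normalisations U_al. Diagonalising U_al one gets
   sum_(be <> al) (||[U_al, U_be]||^2 - 1)^+ <= 1, since the pairs of eigenvalues
   with (eta_i - eta_j)^2 > 1 form a star; diagonal dominance then yields the
   DDVV inequality, and in the equality case the star has p leaves with
   p + 1 = #{B_al <> 0}. As tr U_be^3 = 0 for all be while tr U_al^3 is a nonzero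
   multiple of p^2 - 1, p = 1: B_al = s_al D + t_al S with D = e1^2 - e2^2 and
   S = 2 e1 e2 for orthonormal e1, e2.
   The curvature is now described by c = k + |H|^2 > 0, a traceless form on the
   plane of e1, e2 and x = 2 |s|^2, and a few components of the relation between
   R.C and Q(Ricc,R) force x = 0, that is, all B_al = 0. *)
From Pilot Require Import Defs.
From HB Require Import structures.
From mathcomp Require Import all_boot all_order all_algebra.
From mathcomp Require Import all_classical all_reals all_analysis.
From mathcomp Require Import complex ring lra.
Import Order.TTheory GRing.Theory Num.Theory numFieldNormedType.Exports.
Import Pilot.Defs.
Set Implicit Arguments.
Unset Strict Implicit.
Unset Printing Implicit Defensive.
Local Open Scope ring_scope.

(** * Real symmetric matrices *)

(** Once the Gauss equation is available everything is linear algebra at one point, and frames are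
    needed only there. A manifold is given by Gram matrices in charts and constant curvature only by
    sectional curvatures. So the Gauss equation comes from differentiating the isometry relation in
    coordinates, and the ambient curvature tensor is recovered by polarisation, which rests on the
    symmetries of the Riemann tensor and hence on the symmetry of second derivatives. In the DDVV
    step Bessel's inequality supplies the weights: in an eigenbasis of one matrix, an off-diagonal
    position carries total weight at most 1/2 in an orthonormal family of symmetric matrices. The
    cubic traces decide because every nonzero matrix plays two roles: it is the diagonalised one,
    with nonzero eigenvalues [x] and, [p] times, [- x / p]; and it is supported on the edges of the
    star of another matrix, so its cube has trace zero. Positivity of the ambient curvature enters
    through [c > 0] alone, which allows [c] to be cancelled and keeps [(n - 4) x + c] positive. *)

Lemma real_eigenvalue (R : rcfType) n (A : 'M[R]_n.+1) :
  A^T = A -> exists a, eigenvalue A a.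
Proof.
move=> Asym; pose Ac := map_mx (real_complex R) A.
have Aherm : Ac \is hermsymmx.
  apply: realsym_hermsym.
    by apply/is_hermitianmxP; rewrite expr0 scale1r map_mx_id // /Ac map_trmx Asym.
  by apply/mxOverP => i j; rewrite mxE; apply/complex_realP; exists (A i j).
have /hermitian_normalmx /orthomx_spectralP := Aherm.
set P := spectralmx _; set d := spectral_diag _ => AE.
have Pu : P \in unitmx by exact: spectral_unit.
have /mxOverP /(_ ord0 ord0) /complex_realP [a da] := hermitian_spectral_diag_real Aherm.
(* Eigenvalues are the roots of the characteristic polynomial, and whether the real number [a] is a
   root may be tested after the embedding into the complex numbers. *)
exists a; rewrite eigenvalue_root_char -(fmorph_root (real_complex R)) map_char_poly.
rewrite -eigenvalue_root_char -/Ac; apply/eigenvalueP; exists (row ord0 P).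
  rewrite AE -row_mul mulmxA mulKVmx //. 
  rewrite row_mul row_diag_mx -scalemxAl -rowE; congr (_ *: _).
  exact: da.
apply/eqP => P0; have : row ord0 P *m invmx P = 0 by rewrite P0 mul0mx.
rewrite -row_mul mulmxV // => /rowP /(_ ord0).
by rewrite !mxE /= => /eqP; rewrite oner_eq0.
Qed.

Lemma scalar11 (R : pzRingType) (A : 'M[R]_1) (a : R) : A 0 0 = a -> A = a%:M.
Proof. by move=> <-; exact: mx11_scalar. Qed.

Lemma mul_rowV_tr (R : pzRingType) n (u v : 'rV[R]_n) :
  (u *m v^T) 0 0 = \sum_i u 0 i * v 0 i.
Proof. by rewrite mxE; apply: eq_bigr => i _; rewrite mxE. Qed.

Lemma sq_rowV_eq0 (R : realDomainType) n (u : 'rV[R]_n) :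
  ((u *m u^T) 0 0 == 0) = (u == 0).
Proof.
rewrite mul_rowV_tr psumr_eq0; last by move=> i _; rewrite -expr2 sqr_ge0.
apply/allP/eqP => [u0|-> i _]; last by rewrite mxE mul0r eqxx.
apply/rowP => i; have := u0 i; rewrite mem_index_enum mulf_eq0 orbb mxE.
by move=> /(_ isT)/eqP.
Qed.

Lemma sq_rowV_ge0 (R : realDomainType) n (u : 'rV[R]_n) : 0 <= (u *m u^T) 0 0.
Proof. by rewrite mul_rowV_tr; apply: sumr_ge0 => i _; rewrite -expr2 sqr_ge0. Qed.

Lemma sq_rowV_gt0 (R : realDomainType) n (u : 'rV[R]_n) :
  (0 < (u *m u^T) 0 0) = (u != 0).
Proof. by rewrite lt0r sq_rowV_eq0 sq_rowV_ge0 andbT. Qed.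

(* The reflection of Householder exchanging [v] and the first basis vector. *)
Lemma orthogonal_first_row (R : realFieldType) n (v : 'rV[R]_n.+1) :
  (v *m v^T) 0 0 = 1 ->
  exists2 H : 'M[R]_n.+1, H *m H^T = 1%:M & row 0 H = v.
Proof.
move=> v1; pose e : 'rV[R]_n.+1 := delta_mx 0 0.
have ee : e *m e^T = 1%:M.
  by apply: scalar11; rewrite trmx_delta mul_delta_mx mxE !eqxx.
have vv : v *m v^T = 1%:M by apply: scalar11.
pose w := v - e; case: (eqVneq w 0) => [/subr0_eq ve|w0].
  exists 1%:M; first by rewrite trmx1 mulmx1.
  by rewrite rowE mulmx1 ve.
have ev : e *m v^T = v *m e^T.
  by rewrite -[LHS]trmxK trmx_mul trmxK; apply/matrixP => i j; rewrite !ord1 mxE.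
pose c := (v *m e^T) 0 0.
have veE : v *m e^T = c%:M by apply: scalar11.
have wwE : w *m w^T = (2 - 2 * c)%:M.
  rewrite /w linearB /= mulmxBl !mulmxBr vv ee ev veE.
  by apply/matrixP => i j; rewrite !ord1 !mxE !eqxx !mulr1n; ring.
have d0 : 2 - 2 * c != 0.
  have := w0; rewrite -sq_rowV_eq0 wwE mxE eqxx mulr1n.
  by apply.
pose H := 1%:M - (2 / (2 - 2 * c)) *: (w^T *m w).
have HT : H^T = H.
  by rewrite /H linearB /= linearZ /= trmx1 trmx_mul trmxK.
exists H.
  have PP : w^T *m w *m (w^T *m w) = (2 - 2 * c) *: (w^T *m w).
    by rewrite mulmxA -(mulmxA _ w) wwE mul_mx_scalar -scalemxAl.
  rewrite HT /H mulmxBl mul1mx (mulmxBr (_ *: _)) mulmx1 -scalemxAl -scalemxAr PP !scalerA.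
  rewrite -[RHS]addr0 -addrA; congr (_ + _).
  by rewrite -opprD -scalerBl -scalerDl; apply/eqP;
    rewrite oppr_eq0 scaler_eq0; apply/orP; left; apply/eqP; field.
rewrite rowE /H mulmxBr mulmx1 -scalemxAr mulmxA -/e.
have -> : e *m w^T = (c - 1)%:M.
  rewrite /w linearB /= mulmxBr ee ev veE.
  by apply/matrixP => i j; rewrite !ord1 !mxE !eqxx !mulr1n.
rewrite mul_scalar_mx scalerA.
have -> : 2 / (2 - 2 * c) * (c - 1) = -1 by field.
by rewrite scaleN1r opprK /w addrC subrK.
Qed.

(** Deflation by induction on the size: a Householder matrix [H] whose first row is a unit
    eigenvector splits off the eigenvalue [a], and the induction hypothesis diagonalises the
    remaining block [B']. *)
Lemma real_spectral (R : rcfType) n (A : 'M[R]_n) : A^T = A ->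
  exists (Q : 'M[R]_n) d, Q *m Q^T = 1%:M /\ Q *m A *m Q^T = diag_mx d.
Proof.
elim: n A => [A _|n IH A Asym].
  by exists 1%:M, 0; split; apply/matrixP => -[].
have [a /eigenvalueP [u uA u0]] := real_eigenvalue Asym.
pose s := Num.sqrt ((u *m u^T) 0 0).
have s0 : s != 0 by rewrite sqrtr_eq0 -ltNge sq_rowV_gt0.
pose v := s^-1 *: u.
have vA : v *m A = a *: v by rewrite -scalemxAl uA !scalerA mulrC.
have [] := @orthogonal_first_row _ _ v.
  rewrite /v linearZ /= -scalemxAl -scalemxAr scalerA mxE.
  rewrite -(sqr_sqrtr (sq_rowV_ge0 u)) -/s; by field.
move=> H HH H0; have [B defB] : exists B, B = H *m A *m H^T by eexists.
have BT : B^T = B by rewrite defB !trmx_mul trmxK Asym mulmxA.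
have B0 : row 0 B = a *: delta_mx 0 0.
  rewrite defB !row_mul H0 vA -scalemxAl -H0 -row_mul HH.
  by rewrite rowE mulmx1.
pose B' := drsubmx (B : 'M[R]_(1 + n)).
have BE : B = block_mx a%:M 0 0 B' :> 'M[R]_(1 + n).
  have ur j : B 0 (rshift 1 j) = 0.
    by have /rowP /(_ (rshift 1 j)) := B0; rewrite !mxE /= mulr0.
  rewrite -[LHS](@submxK _ 1 n 1 n); congr block_mx.
  - by apply: scalar11; rewrite !mxE; have /rowP /(_ 0) := B0; rewrite !mxE !eqxx mulr1 => <-;
       congr (B _ _); apply/val_inj.
  - by apply/matrixP => i j; rewrite !mxE !ord1 -[RHS](ur j); congr (B _ _); apply/val_inj.
  - apply/matrixP => i j; rewrite !mxE !ord1 -[RHS](ur i) -[in LHS]BT mxE.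
    by congr (B _ _); apply/val_inj.
have [|Q [d [QQ QB]]] := IH B'.
  by rewrite /B' trmx_drsub BT.
pose K : 'M[R]_(1 + n) := block_mx 1%:M 0 0 Q.
have KK : K *m K^T = 1%:M.
  rewrite /K tr_block_mx mulmx_block !trmx0 !mul0mx !mulmx0 !addr0 !add0r.
  by rewrite trmx1 mulmx1 QQ -scalar_mx_block.
have KBK : K *m block_mx a%:M 0 0 B' *m K^T = diag_mx (row_mx a%:M d).
  rewrite /K tr_block_mx !mulmx_block !trmx0 !mul0mx !mulmx0 !addr0 !add0r.
  rewrite trmx1 mulmx1 mul1mx ?mul0mx ?mulmx0 ?addr0 ?add0r QB diag_mx_row.
  by congr block_mx; apply/matrixP => i j; rewrite !ord1 !mxE.
exists ((K : 'M[R]_n.+1) *m H), (row_mx a%:M d : 'rV_(1 + n)); split.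
  by rewrite trmx_mul mulmxA -(mulmxA _ H) HH mulmx1; exact: KK.
rewrite trmx_mul -!mulmxA (mulmxA A) (mulmxA H) [H *m _]mulmxA -defB BE mulmxA.
exact: KBK.
Qed.

(** [W] is an orthogonal diagonaliser of [S] with its rows divided by the square roots of the
    eigenvalues. The rows of [W] form an orthonormal basis for [S]; tangent frames are obtained in
    this way. *)
Lemma spd_factor (R : rcfType) n (S : 'M[R]_n) : S^T = S ->
  (forall u : 'rV_n, u != 0 -> 0 < (u *m S *m u^T) 0 0) ->
  exists W : 'M[R]_n, W *m S *m W^T = 1%:M.
Proof.
move=> Ssym Spos; have [Q [d [QQ QS]]] := real_spectral Ssym.
have d0 i : 0 < d 0 i.
  have -> : d 0 i = (row i Q *m S *m (row i Q)^T) 0 0.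
    have /matrixP /(_ i i) := QS; rewrite [RHS]mxE eqxx mulr1n => <-.
    by rewrite -row_mul tr_row !mxE; apply: eq_bigr => j _; rewrite !mxE.
  apply: Spos; apply/eqP => Qi.
  have /matrixP /(_ i i) := QQ; rewrite [RHS]mxE eqxx => /eqP.
  have -> : (Q *m Q^T) i i = (row i Q *m Q^T) 0 i by rewrite -row_mul [RHS]mxE.
  by rewrite Qi mul0mx mxE eq_sym oner_eq0.
pose D := diag_mx (\row_i (Num.sqrt (d 0 i))^-1).
exists (D *m Q); rewrite trmx_mul -!mulmxA (mulmxA S) (mulmxA Q) (mulmxA Q) QS.
rewrite mulmxA tr_diag_mx !mulmx_diag -diag_const_mx; congr diag_mx.
apply/rowP => i; rewrite !mxE -[X in _ * X * _](sqr_sqrtr (ltW (d0 i))).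
have : Num.sqrt (d 0 i) != 0 by rewrite sqrtr_eq0 -ltNge.
by move=> ?; field.
Qed.

(** A basis [N] of the kernel of [K^T] has [m] rows by rank count, and its Gram matrix is positive
    definite, so [spd_factor] orthonormalises it at once. *)
Lemma orthonormal_completion (R : rcfType) n m (K : 'M[R]_(n, n + m)) :
  K *m K^T = 1%:M ->
  exists L : 'M[R]_(m, n + m), L *m L^T = 1%:M /\ L *m K^T = 0.
Proof.
move=> KK.
have rK : \rank K = n.
  by apply/eqP; rewrite -[_ == _]/(row_free K); apply/row_freeP; exists K^T.
have rk : \rank (kermx K^T) = m by rewrite mxrank_ker mxrank_tr rK addKn.
have NK : row_base (kermx K^T) *m K^T = 0.
  by apply/sub_kermxP; rewrite eq_row_base.
have Nf := row_base_free (kermx K^T).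
move: (row_base _) NK Nf; rewrite rk => N NK /row_freeP [N' NN'].
have [||W WN] := @spd_factor _ _ (N *m N^T).
- by rewrite trmx_mul trmxK.
- move=> u u0; rewrite mulmxA -mulmxA -trmx_mul sq_rowV_gt0.
  by apply: contra u0 => /eqP uN; rewrite -[u]mulmx1 -NN' mulmxA uN mul0mx.
exists (W *m N); split; last by rewrite -mulmxA NK mulmx0.
by rewrite trmx_mul mulmxA -(mulmxA W).
Qed.

(** * The equality case of the DDVV inequality *)

Section StarInequality.
Variables (R : realFieldType) (n : nat) (eta : 'I_n -> R).
Hypothesis eta1 : \sum_i eta i ^+ 2 = 1.

Local Notation gap i j := ((eta i - eta j) ^+ 2).

Lemma sum_sqr_sub_ge0 (P : pred 'I_n) : 0 <= \sum_(i | P i) eta i ^+ 2.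
Proof. by apply: sumr_ge0 => i _; exact: sqr_ge0. Qed.

Lemma sum2_sqr_le1 i j : i != j -> eta i ^+ 2 + eta j ^+ 2 <= 1.
Proof.
move=> ij; rewrite -eta1 (bigD1 i) //= (bigD1 j) 1?eq_sym //= addrA lerDl.
exact: sum_sqr_sub_ge0.
Qed.

Lemma wide_neq i j : 1 < gap i j -> i != j.
Proof. by apply: contraTneq => ->; rewrite subrr expr0n /= ltr10. Qed.

Lemma wideC i j : gap i j = gap j i.
Proof. by rewrite -opprB sqrrN. Qed.

Lemma wide_opp i j : 1 < gap i j -> eta i * eta j < 0.
Proof. move=> e; have := sum2_sqr_le1 (wide_neq e); nra. Qed.

(** A gap is at most twice the sum of the two squares, so a wide pair uses more than half of the
    total [eta1]; two disjoint wide pairs would exceed it. *)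
Lemma wide_meet i j k l : 1 < gap i j -> 1 < gap k l ->
  [|| i == k, i == l, j == k | j == l].
Proof.
move=> eij ekl; apply: contraT; rewrite !negb_or => /and4P[ik il jk jl].
have ij := wide_neq eij; have kl := wide_neq ekl.
have : eta i ^+ 2 + eta j ^+ 2 + (eta k ^+ 2 + eta l ^+ 2) <= 1.
  rewrite -eta1 (bigD1 i) //= (bigD1 j) 1?eq_sym //= (bigD1 k) /=; last first.
    by rewrite eq_sym ik eq_sym.
  rewrite (bigD1 l) /=; last by rewrite eq_sym il eq_sym jl eq_sym.
  by rewrite !addrA lerDl; exact: sum_sqr_sub_ge0.
by have := sqr_ge0 (eta i + eta j); have := sqr_ge0 (eta k + eta l); nra.
Qed.

(* A graph without triangles whose edges pairwise meet is a star; [wide_opp]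
   excludes triangles because three reals cannot have pairwise opposite signs. *)
Lemma wide_star i j : 1 < gap i j ->
  exists c, forall k l, 1 < gap k l -> k = c \/ l = c.
Proof.
move=> eij.
have [/existsP [k /existsP [l /and3P[ekl ki li]]]|] :=
    boolP [exists k, exists l, [&& 1 < gap k l, k != i & l != i]]; last first.
  rewrite negb_exists => /forallP Hi; exists i => k l ekl.
  have := Hi k; rewrite negb_exists => /forallP /(_ l).
  rewrite ekl /= negb_and !negbK => /orP[/eqP|/eqP]; tauto.
have {ekl ki li k l} [k ejk ki] : exists2 k, 1 < gap j k & k != i.
  have := wide_meet eij ekl; rewrite [i == k]eq_sym (negPf ki) [i == l]eq_sym (negPf li) /=.
  by case/orP=> /eqP jE; [exists l => //; rewrite jE|exists k => //; rewrite jE wideC].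
(* A second edge [j k] avoiding [i] makes [j] the centre: an edge missing [j] has to meet both [i j]
   and [j k], so it is [i k] and closes a triangle. *)
exists j => a b eab.
have := wide_meet eij eab; have := wide_meet ejk eab.
have [->|aj] := eqVneq a j; first by left.
have [->|bj] := eqVneq b j; first by right.
rewrite /= !orbF.
have tri : ~~ (1 < gap i k).
  apply/negP => eik; have := wide_opp eij; have := wide_opp ejk; have := wide_opp eik.
  by have := sqr_ge0 (eta i * eta j * eta k); nra.
move=> /orP[]/eqP kE /orP[]/eqP iE; subst.
- by rewrite eqxx in ki.
- by rewrite wideC eab in tri.
- by rewrite eab in tri.
- by rewrite eqxx in ki.
Qed.

Variable r : 'I_n -> 'I_n -> R.
Hypothesis r_ge0 : forall i j, 0 <= r i j.
Hypothesis r_le : forall i j, i != j -> 2 * r i j <= 1.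

(** The largest value of [(gap i j - 1) * r i j] compatible with the bounds on [r]: weight 1/2 on a
    wide pair, weight 0 elsewhere. *)
Let b i j : R := if 1 < gap i j then (gap i j - 1) / 2 else 0.

Lemma gap_weight_le i j : (gap i j - 1) * r i j <= b i j.
Proof.
rewrite /b; case: ifPn => [e|]; last first.
  by rewrite -leNgt => e; have := r_ge0 i j; nra.
by have := r_le (wide_neq e); nra.
Qed.

Section Star.
Variables (c : 'I_n) (J : {set 'I_n}).
Hypothesis Jdef : forall j, (j \in J) = (1 < gap c j).
Hypothesis star : forall k l, 1 < gap k l -> k = c \/ l = c.

Lemma center_notin : c \notin J.
Proof. by rewrite Jdef; apply/negP => /wide_neq; rewrite eqxx. Qed.

Lemma sum_wide : \sum_i \sum_j b i j = \sum_(j in J) (gap c j - 1).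
Proof.
have bC i j : b i j = b j i by rewrite /b wideC.
have bcc : b c c = 0 by rewrite /b; case: ifPn => // /wide_neq; rewrite eqxx.
have b0 i : i != c -> \sum_j b i j = b i c.
  move=> ic; rewrite (bigD1 c) //= big1 ?addr0 // => j jc; rewrite /b.
  by case: ifPn => // /star [] E; rewrite E eqxx in ic jc.
rewrite (bigD1 c) //= (eq_bigr _ b0).
have -> : \sum_(i | i != c) b i c = \sum_i b c i.
  by rewrite [RHS](bigD1 c) //= bcc add0r; apply: eq_bigr => i _.
rewrite -big_split /= [RHS]big_mkcond /=; apply: eq_bigr => j _.
by rewrite /b Jdef; case: ifP => _; field.
Qed.

Let p : R := #|J|%:R.
Let s := \sum_(j in J) eta j.
Let rho := \sum_(j | (j \notin J) && (j != c)) eta j ^+ 2.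

(** A certificate by squares. Its three nonnegative terms give the bound, and their vanishing gives
    the equality case: the sum over the leaves is [- eta c], [eta] is constant on the leaves, and it
    is zero off the star. *)
Lemma star_defect : 1 - \sum_(j in J) (gap c j - 1) =
  (eta c + s) ^+ 2 + 2^-1 * (\sum_(j in J) \sum_(k in J) gap j k) + (p + 1) * rho.
Proof.
pose sg := \sum_(j in J) eta j ^+ 2.
have Cs a : \sum_(j in J) a = p * a by rewrite sumr_const -mulr_natl.
have E1 : 1 = eta c ^+ 2 + sg + rho.
  rewrite -eta1 (bigID (fun i => i \in J)) /=.
  rewrite (bigD1 (P := fun i => i \notin J) c) ?center_notin //=.
  by rewrite addrA [_ + eta c ^+ 2]addrC.
have E2 : \sum_(j in J) (gap c j - 1) = p * eta c ^+ 2 - 2 * eta c * s + sg - p.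
  rewrite (eq_bigr (fun j => (eta c ^+ 2 - 1) + (- 2 * eta c) * eta j + eta j ^+ 2)); last first.
    by move=> j _; ring.
  rewrite !big_split /= !Cs -mulr_sumr -/s -/sg; ring.
have E3 : \sum_(j in J) \sum_(k in J) gap j k = 2 * (p * sg - s ^+ 2).
  have E j : \sum_(k in J) gap j k = p * eta j ^+ 2 - 2 * s * eta j + sg.
    rewrite (eq_bigr (fun k => eta j ^+ 2 + (- 2 * eta j) * eta k + eta k ^+ 2)); last first.
      by move=> k _; ring.
    rewrite !big_split /= !Cs -mulr_sumr -/s -/sg; ring.
  rewrite (eq_bigr _ (fun j _ => E j)) !big_split /= -mulr_sumr sumrN -mulr_sumr.
  by rewrite Cs -/sg -/s; ring.
rewrite E3 E2; have -> : rho = 1 - eta c ^+ 2 - sg by rewrite {1}E1; ring.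
by field.
Qed.


Lemma star_sum_le1 : \sum_(j in J) (gap c j - 1) <= 1.
Proof.
rewrite -subr_ge0 star_defect addr_ge0 ?addr_ge0 ?sqr_ge0 //.
  rewrite mulr_ge0 ?invr_ge0 ?ler0n //.
  by apply: sumr_ge0 => j _; apply: sumr_ge0 => k _; exact: sqr_ge0.
by rewrite mulr_ge0 ?sum_sqr_sub_ge0 // addr_ge0 ?ler0n ?ler01.
Qed.

Lemma star_sum_eq1 : \sum_(j in J) (gap c j - 1) = 1 ->
  [/\ (0 < #|J|)%N, forall j, j \in J -> p * eta j = - eta c,
      forall j, j \notin J -> j != c -> eta j = 0 & (p + 1) * eta c ^+ 2 = p].
Proof.
move=> S1.
have g0 : 0 <= \sum_(j in J) \sum_(k in J) gap j k.
  by apply: sumr_ge0 => j _; apply: sumr_ge0 => k _; exact: sqr_ge0.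
have p0 : 0 <= p by rewrite ler0n.
have rho0 : 0 <= rho by exact: sum_sqr_sub_ge0.
have J0 : (0 < #|J|)%N.
  rewrite lt0n; apply/negP => /eqP/cards0_eq J0.
  by move: S1; rewrite J0 big_set0 => /eqP; rewrite eq_sym oner_eq0.
have := star_defect; rewrite S1 subrr => D.
have /eqP : (eta c + s) ^+ 2 = 0 by have := sqr_ge0 (eta c + s); nra.
rewrite sqrf_eq0 addr_eq0 => /eqP cs.
have G0 : \sum_(j in J) \sum_(k in J) gap j k = 0 by have := sqr_ge0 (eta c + s); nra.
have R0 : rho = 0 by have := sqr_ge0 (eta c + s); nra.
have eJ j k : j \in J -> k \in J -> eta j = eta k.
  move=> jJ kJ; apply/eqP; rewrite -subr_eq0 -sqrf_eq0; apply/eqP.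
  apply: (psumr_eq0P (P := fun k => k \in J) (F := fun k => gap j k)) => //.
    by move=> ? _; exact: sqr_ge0.
  apply: (psumr_eq0P (P := fun j => j \in J)
           (F := fun j => \sum_(k in J) gap j k)) => //.
  by move=> ? _; apply: sumr_ge0 => ? _; exact: sqr_ge0.
have pe j : j \in J -> p * eta j = - eta c.
  move=> jJ; rewrite cs opprK /s (eq_bigr (fun=> eta j)) => [|k kJ].
    by rewrite sumr_const -mulr_natl.
  exact: eJ.
have e0 j : j \notin J -> j != c -> eta j = 0.
  move=> jJ jc; apply/eqP; rewrite -sqrf_eq0; apply/eqP.
  apply: (psumr_eq0P (P := fun j => (j \notin J) && (j != c)) _ R0).
    by move=> ? _; exact: sqr_ge0.
  by rewrite jJ jc.
split=> //; have [j0 j0J] := card_gt0P J0.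
have E1 : p * eta c ^+ 2 + eta c ^+ 2 = p.
  rewrite -[RHS]mulr1 -eta1 (bigID (fun i => i \in J)) /=.
  rewrite (bigD1 (P := fun i => i \notin J) c) ?center_notin //= -/rho R0 addr0 mulrDr addrC.
  congr (_ + _); rewrite (eq_bigr (fun=> eta j0 ^+ 2)) => [|k kJ]; last by rewrite (eJ _ _ kJ j0J).
  by rewrite sumr_const -mulr_natl -/p mulrA -expr2 -exprMn pe // sqrrN.
by rewrite mulrDl mul1r.
Qed.

End Star.

Lemma gap_weighted_sum_le1 : \sum_i \sum_j (gap i j - 1) * r i j <= 1.
Proof.
apply: (@le_trans _ _ (\sum_i \sum_j b i j)).
  by apply: ler_sum => i _; apply: ler_sum => j _; exact: gap_weight_le.
have [/existsP [i /existsP [j eij]]|] := boolP [exists i, exists j, 1 < gap i j].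
  have [c star] := wide_star eij.
  rewrite (@sum_wide c [set j | 1 < gap c j]) //; last by move=> ?; rewrite inE.
  by apply: star_sum_le1 => // ?; rewrite inE.
rewrite negb_exists => /forallP H; rewrite big1 ?ler01 // => i _; rewrite big1 // => j _.
by have := H i; rewrite negb_exists => /forallP /(_ j) /negPf; rewrite /b => ->.
Qed.

(** Every intermediate estimate is tight. The star sum equals 1, which determines [eta] by
    [star_sum_eq1], and each term reaches its bound [b i j], which determines [r]. *)
Lemma gap_weighted_sum_eq1 : \sum_i \sum_j (gap i j - 1) * r i j = 1 ->
  exists (c : 'I_n) (J : {set 'I_n}),
  [/\ c \notin J /\ (0 < #|J|)%N,
      forall j, j \in J -> #|J|%:R * eta j = - eta c,
      forall j, j \notin J -> j != c -> eta j = 0,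
      (#|J|%:R + 1) * eta c ^+ 2 = #|J|%:R &
      forall i j, r i j =
        if (i == c) && (j \in J) || (j == c) && (i \in J) then 2^-1 else 0].
Proof.
move=> S1; have S1b : 1 <= \sum_i \sum_j b i j.
  by rewrite -S1; apply: ler_sum => i _; apply: ler_sum => j _; exact: gap_weight_le.
have [/existsP [i /existsP [j eij]]|] := boolP [exists i, exists j, 1 < gap i j]; last first.
  rewrite negb_exists => /forallP H; move: S1b.
  rewrite big1 ?ler10 // => i _; rewrite big1 // => j _.
  by have := H i; rewrite negb_exists => /forallP /(_ j) /negPf; rewrite /b => ->.
have [c star] := wide_star eij; pose J := [set j | 1 < gap c j].
have Jdef k : (k \in J) = (1 < gap c k) by rewrite inE.
have SJ := sum_wide Jdef star.
have SJ1 : \sum_(j in J) (gap c j - 1) = 1.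
  by apply/eqP; rewrite eq_le star_sum_le1 // -SJ.
have cJ := center_notin Jdef.
have [J0 eJ e0 ec] := star_sum_eq1 Jdef SJ1.
exists c, J; split=> // {i j eij}i j.
have p1 : 1 <= (#|J|%:R : R) by rewrite ler1n.
have edgeE : ((i == c) && (j \in J) || (j == c) && (i \in J)) = (1 < gap i j).
  apply/idP/idP => [/orP[/andP[/eqP-> jJ]|/andP[/eqP-> iJ]]|e].
  - by rewrite -Jdef.
  - by rewrite wideC -Jdef.
  by have [E|E] := star _ _ e; rewrite E !Jdef in e *; rewrite ?eqxx ?e ?(wideC i) ?e ?orbT //;
     rewrite wideC e orbT.
have bE : (gap i j - 1) * r i j = b i j.
  apply/eqP; rewrite eq_sym -subr_eq0; apply/eqP.
  apply: (psumr_eq0P (P := xpredT) (F := fun j => b i j - (gap i j - 1) * r i j)) => //.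
    by move=> ? _; rewrite subr_ge0 gap_weight_le.
  apply: (psumr_eq0P (P := xpredT)
     (F := fun i => \sum_j (b i j - (gap i j - 1) * r i j))) => //.
    by move=> ? _; apply: sumr_ge0 => ? _; rewrite subr_ge0 gap_weight_le.
  under eq_bigr do rewrite sumrB.
  by rewrite sumrB S1 SJ SJ1 subrr.
rewrite edgeE; move: bE; rewrite /b; case: ifPn => [e bE|ne /eqP].
  have : gap i j - 1 != 0 by rewrite subr_eq0 gt_eqF.
  by move=> g0; apply: (mulfI g0); rewrite bE.
rewrite mulf_eq0 => /orP[|/eqP//]; rewrite subr_eq0 => /eqP g1; exfalso.
(* It remains to exclude a gap exactly equal to 1 outside the edges, where tightness says nothing
   about [r]. The values of [eta] leave only the gaps 0, [p / (p + 1)] and [1 / (p (p + 1))] there,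
   all less than 1. *)
have val k : k != c -> eta k = 0 \/ #|J|%:R * eta k = - eta c.
  by move=> kc; have [kJ|kJ] := boolP (k \in J); [right; apply: eJ|left; apply: e0].
move: p1 ec; set p := #|J|%:R => p1 ec.
have [iE|ic] := eqVneq i c.
  have [jE|jc] := eqVneq j c.
    by move: g1; rewrite iE jE subrr expr0n /= => /eqP; rewrite eq_sym oner_eq0.
  have jJ : j \notin J.
    by move: edgeE; rewrite (negPf ne) iE eqxx /= => /negbT; rewrite negb_or => /andP[].
  by move: g1; rewrite iE (e0 j) // subr0 => g1; move: ec; rewrite g1 mulr1; lra.
have [jE|jc] := eqVneq j c.
  have iJ : i \notin J.
    by move: edgeE; rewrite (negPf ne) jE eqxx /= => /negbT; rewrite negb_or => /andP[].
  by move: g1; rewrite jE (e0 i) // sub0r sqrrN => g1; move: ec; rewrite g1 mulr1; lra.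
move: g1 ec; have [->|] := val _ ic; have [->|] := val _ jc; rewrite -/p.
- by rewrite subrr expr0n /= => /eqP; rewrite eq_sym oner_eq0.
- by move=> pe; rewrite sub0r sqrrN => g1; rewrite -(opprK (eta c)) -pe sqrrN exprMn g1 => ?; nra.
- by move=> pe; rewrite subr0 => g1; rewrite -(opprK (eta c)) -pe sqrrN exprMn g1 => ?; nra.
move=> pj pi; have : p * (eta i - eta j) = 0 by rewrite mulrBr pj pi subrr.
move/eqP; rewrite mulf_eq0 => /orP[/eqP p0|/eqP ->]; first by rewrite p0 ler10 in p1.
by rewrite expr0n /= => /eqP; rewrite eq_sym oner_eq0.
Qed.

End StarInequality.

(** * Frobenius product, commutators and Bessel's inequality *)

Section Frobenius.
Variables (R : realFieldType) (n : nat).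
Implicit Types A B Q : 'M[R]_n.

Definition frob A B : R := \tr (A *m B^T).
Definition comm A B : 'M[R]_n := A *m B - B *m A.

Lemma frobE A B : frob A B = \sum_i \sum_j A i j * B i j.
Proof.
by apply: eq_bigr => i _; rewrite mxE; apply: eq_bigr => j _; rewrite mxE.
Qed.

Lemma frobC A B : frob A B = frob B A.
Proof. by rewrite /frob -mxtrace_tr trmx_mul trmxK. Qed.

Lemma frob_ge0 A : 0 <= frob A A.
Proof. by rewrite frobE; do 2!apply: sumr_ge0 => ? _; rewrite -expr2 sqr_ge0. Qed.

Lemma frob_eq0 A : frob A A = 0 -> A = 0.
Proof.
rewrite frobE => /eqP; rewrite psumr_eq0 => [/allP A0|i _]; last first.
  by apply: sumr_ge0 => ? _; rewrite -expr2 sqr_ge0.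
apply/matrixP => i j; have := A0 i; rewrite mem_index_enum => /(_ isT).
rewrite psumr_eq0 => [/allP /(_ j)|k _]; last by rewrite -expr2 sqr_ge0.
by rewrite mem_index_enum => /(_ isT); rewrite mulf_eq0 orbb mxE => /eqP.
Qed.

Lemma frobDl A B C : frob (A + B) C = frob A C + frob B C.
Proof. by rewrite /frob mulmxDl linearD. Qed.

Lemma frobZl a A B : frob (a *: A) B = a * frob A B.
Proof. by rewrite /frob -scalemxAl linearZ. Qed.

Lemma frobZr a A B : frob A (a *: B) = a * frob A B.
Proof. by rewrite frobC frobZl frobC. Qed.

Lemma frob_suml I (r : seq I) (P : pred I) (F : I -> 'M[R]_n) B :
  frob (\sum_(i <- r | P i) F i) B = \sum_(i <- r | P i) frob (F i) B.
Proof. by rewrite /frob mulmx_suml raddf_sum. Qed.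

Lemma frob_sumr I (r : seq I) (P : pred I) (F : I -> 'M[R]_n) B :
  frob B (\sum_(i <- r | P i) F i) = \sum_(i <- r | P i) frob B (F i).
Proof. by rewrite frobC frob_suml; under eq_bigr do rewrite frobC. Qed.

Lemma commZ a b A B : comm (a *: A) (b *: B) = (a * b) *: comm A B.
Proof.
by rewrite /comm scalerBr -!scalemxAl -!scalemxAr !scalerA [b * a]mulrC.
Qed.

Lemma comm_suml I (r : seq I) (P : pred I) (F : I -> 'M[R]_n) B :
  comm (\sum_(i <- r | P i) F i) B = \sum_(i <- r | P i) comm (F i) B.
Proof. by rewrite /comm mulmx_suml mulmx_sumr -sumrB. Qed.

Lemma comm_sumr I (r : seq I) (P : pred I) (F : I -> 'M[R]_n) B :
  comm B (\sum_(i <- r | P i) F i) = \sum_(i <- r | P i) comm B (F i).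
Proof. by rewrite /comm mulmx_suml mulmx_sumr -sumrB. Qed.

Section Conj.
Variable Q : 'M[R]_n.
Hypothesis QQ : Q *m Q^T = 1%:M.
Let QtQ : Q^T *m Q = 1%:M. Proof. exact: mulmx1C. Qed.
Local Notation conjQ A := (Q *m A *m Q^T).

Lemma conjQ_mul A B : conjQ A *m conjQ B = conjQ (A *m B).
Proof. by rewrite !mulmxA -(mulmxA _ Q^T) QtQ mulmx1. Qed.

Lemma conjQ_tr A : (conjQ A)^T = conjQ A^T.
Proof. by rewrite !trmx_mul trmxK mulmxA. Qed.

Lemma conjQ_trace A : \tr (conjQ A) = \tr A.
Proof. by rewrite mxtrace_mulC mulmxA QtQ mul1mx. Qed.

Lemma conjQ_frob A B : frob (conjQ A) (conjQ B) = frob A B.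
Proof. by rewrite /frob conjQ_tr conjQ_mul conjQ_trace. Qed.

Lemma conjQ_comm A B : comm (conjQ A) (conjQ B) = conjQ (comm A B).
Proof. by rewrite /comm !conjQ_mul mulmxBr mulmxBl. Qed.

Lemma conjQK A : Q^T *m conjQ A *m Q = A.
Proof. by rewrite !mulmxA QtQ mul1mx -mulmxA QtQ mulmx1. Qed.

End Conj.

Lemma comm_diag (d : 'rV[R]_n) B :
  frob (comm (diag_mx d) B) (comm (diag_mx d) B) =
  \sum_i \sum_j (d 0 i - d 0 j) ^+ 2 * B i j ^+ 2.
Proof.
rewrite frobE; apply: eq_bigr => i _; apply: eq_bigr => j _.
by rewrite -expr2 -exprMn /comm mul_diag_mx mul_mx_diag !mxE; congr (_ ^+ 2); ring.
Qed.

Variables (I : finType) (S : {set I}) (B : I -> 'M[R]_n).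
Hypothesis Bsym : forall k, k \in S -> (B k)^T = B k.
Hypothesis Bon : forall k l, k \in S -> l \in S -> frob (B k) (B l) = (k == l)%:R.

Lemma bessel A : \sum_(k in S) frob (B k) A ^+ 2 <= frob A A.
Proof.
pose P := \sum_(k in S) frob (B k) A *: B k.
have PA : frob P A = \sum_(k in S) frob (B k) A ^+ 2.
  by rewrite frob_suml; apply: eq_bigr => k _; rewrite frobZl.
have PP : frob P P = \sum_(k in S) frob (B k) A ^+ 2.
  rewrite frob_suml; apply: eq_bigr => k kS; rewrite frobZl frob_sumr (bigD1 k) //=.
  rewrite big1 ?addr0 => [|l /andP[lS lk]]; first by rewrite frobZr Bon // eqxx mulr1.
  by rewrite frobZr Bon // eq_sym (negPf lk) mulr0.
have := frob_ge0 (A + (-1) *: P).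
by rewrite frobDl frobZl !(frobC _ (_ + _)) !frobDl !frobZl PP PA (frobC A P) PA; lra.
Qed.

(** Bessel's inequality for [delta_mx i j + delta_mx j i], which has squared norm 2 and whose
    product with a symmetric [B k] is twice the entry [B k i j]. *)
Lemma orthonormal_entry_le i j : i != j -> 2 * (\sum_(k in S) B k i j ^+ 2) <= 1.
Proof.
move=> ij; have D k : frob (B k) (delta_mx i j + delta_mx j i) = B k i j + B k j i.
  rewrite frobC frobDl !frobE.
  have E a b : \sum_i0 \sum_j0 (delta_mx a b : 'M[R]_n) i0 j0 * B k i0 j0 = B k a b.
    rewrite (bigD1 a) //= [X in _ + X]big1 ?addr0 => [|i0 i0a].
      rewrite (bigD1 b) //= [X in _ + X]big1 ?addr0 => [|j0 j0b].
        by rewrite mxE !eqxx mul1r.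
      by rewrite mxE (negPf j0b) andbF mul0r.
    by apply: big1 => j0 _; rewrite mxE (negPf i0a) mul0r.
  by rewrite !E.
have := bessel (delta_mx i j + delta_mx j i).
rewrite (eq_bigr (fun k => 4 * B k i j ^+ 2)) => [|k kS]; last first.
  by have := congr1 (fun M : 'M[R]_n => M i j) (Bsym kS); rewrite D mxE => ->; ring.
rewrite -mulr_sumr.
suff -> : frob (delta_mx i j + delta_mx j i) (delta_mx i j + delta_mx j i) = 2 :> R by lra.
rewrite /frob linearD /= !trmx_delta mulmxDl !mulmxDr !mul_delta_mx_cond !eqxx (eq_sym j i).
rewrite (negPf ij) !mulr0n !mulr1n addr0 add0r linearD /=.
have T k : \tr (delta_mx k k : 'M[R]_n) = 1.
  rewrite /mxtrace (bigD1 k) //= mxE !eqxx big1 ?addr0 // => l lk.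
  by rewrite mxE (negPf lk).
by rewrite !T; lra.
Qed.

End Frobenius.

(** * Commutators of a unit symmetric matrix with an orthonormal family *)

Section CommutatorFamily.
Variables (R : rcfType) (n : nat) (I : finType) (S : {set I}).
Variables (A : 'M[R]_n) (B : I -> 'M[R]_n).
Hypothesis Asym : A^T = A.
Hypothesis A1 : frob A A = 1.
Hypothesis Bsym : forall k, k \in S -> (B k)^T = B k.
Hypothesis Bon : forall k l, k \in S -> l \in S -> frob (B k) (B l) = (k == l)%:R.

Local Notation excess k := (frob (comm A (B k)) (comm A (B k)) - 1).

(** In an eigenbasis of [A] the squared norm of the commutator with [B k] weights each squared entry
    of [B k] by an eigenvalue gap. Since [B k] has unit norm, the [- 1] of its excess can be
    distributed over the same entries, so that the excesses add up to the sum studied for stars. *)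
Lemma comm_family_diag :
  exists (Q : 'M[R]_n) (d : 'rV[R]_n) (r : 'I_n -> 'I_n -> R),
  [/\ Q *m Q^T = 1%:M, Q *m A *m Q^T = diag_mx d, \sum_i d 0 i ^+ 2 = 1,
      forall i j, r i j = \sum_(k in S) (Q *m B k *m Q^T) i j ^+ 2 &
      [/\ forall i j, 0 <= r i j, forall i j, i != j -> 2 * r i j <= 1,
       \sum_i \sum_j r i j = #|S|%:R &
       \sum_(k in S) excess k = \sum_i \sum_j ((d 0 i - d 0 j) ^+ 2 - 1) * r i j]].
Proof.
have [Q [d [QQ QA]]] := real_spectral Asym.
pose C k := Q *m B k *m Q^T.
have Csym k : k \in S -> (C k)^T = C k by move=> kS; rewrite /C conjQ_tr Bsym.
have Con k l : k \in S -> l \in S -> frob (C k) (C l) = (k == l)%:R.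
  by move=> kS lS; rewrite conjQ_frob // Bon.
exists Q, d, (fun i j => \sum_(k in S) C k i j ^+ 2).
have rS : \sum_i \sum_j \sum_(k in S) C k i j ^+ 2 = #|S|%:R.
  under eq_bigr do rewrite exchange_big /=.
  rewrite exchange_big /= -sum1_card natr_sum; apply: eq_bigr => k kS.
  have := Con k k kS kS; rewrite eqxx mulr1n => <-; rewrite frobE.
  by do 2!(apply: eq_bigr => ? _); rewrite expr2.
split=> //.
  rewrite -A1 -(conjQ_frob QQ) QA frobE; apply: eq_bigr => i _.
  rewrite (bigD1 i) //= big1 ?addr0 => [|j ji]; first by rewrite !mxE eqxx mulr1n expr2.
  by rewrite !mxE [i == j]eq_sym (negPf ji) mulr0n mul0r.
split=> //.
- by move=> i j; apply: sumr_ge0 => k _; exact: sqr_ge0.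
- by move=> i j ij; apply: orthonormal_entry_le.
rewrite sumrB sumr_const -rS.
transitivity (\sum_i \sum_j (d 0 i - d 0 j) ^+ 2 * (\sum_(k in S) C k i j ^+ 2) -
    \sum_i \sum_j \sum_(k in S) C k i j ^+ 2).
  congr (_ - _); transitivity (\sum_(k in S) \sum_i \sum_j (d 0 i - d 0 j) ^+ 2 * C k i j ^+ 2).
    by apply: eq_bigr => k kS; rewrite -comm_diag -QA /C conjQ_comm // conjQ_frob.
  rewrite exchange_big /=; apply: eq_bigr => i _.
  by rewrite exchange_big /=; apply: eq_bigr => j _; rewrite mulr_sumr.
rewrite -sumrB; apply: eq_bigr => i _; rewrite -sumrB; apply: eq_bigr => j _.
by rewrite mulrBl mul1r.
Qed.

Lemma comm_excess_le1 : \sum_(k in S) excess k <= 1.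
Proof.
have [Q [d [r [QQ QA d1 rE [r0 r1 rS ->]]]]] := comm_family_diag.
exact: gap_weighted_sum_le1.
Qed.

(** In the eigenbasis, [A] has the eigenvalue [x] at the centre of the star, [- x / p] at each of
    its [p] leaves and 0 elsewhere, while the [B k] live on its edges. For [p = 1] only one edge is
    left, and the rows of [Q] at its two ends are [u] and [v]. *)
Lemma comm_excess_eq1 : \sum_(k in S) excess k = 1 ->
  exists x : R, let p := #|S|%:R in
  [/\ (0 < #|S|)%N, (p + 1) * x ^+ 2 = p,
      p ^+ 2 * \tr (A *m A *m A) = x ^+ 3 * (p ^+ 2 - 1),
      forall k, k \in S -> \tr (B k *m B k *m B k) = 0 &
      #|S| = 1%N -> exists u v : 'rV[R]_n,
       [/\ u *m u^T = 1%:M, v *m v^T = 1%:M, u *m v^T = 0,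
           A = x *: (u^T *m u - v^T *m v) &
           forall k, k \in S -> exists2 b, b ^+ 2 = 2^-1 &
              B k = b *: (u^T *m v + v^T *m u)]].
Proof.
have [Q [d [r [QQ QA d1 rE [r0 r1 rS ->]]]]] := comm_family_diag.
move=> /(gap_weighted_sum_eq1 d1 r0 r1) [c [J [[cJ J0] dJ d0 dc rJ]]].
(* The total weight is [#|S|] because the [B k] are unit matrices, and it is [#|J|] because each of
   the [2 * #|J|] ordered edges has weight 1/2. *)
have SJ : #|S| = #|J|.
  apply/eqP; rewrite -(eqr_nat R) -rS (bigD1 c) //=.
  have row i : i != c -> \sum_j r i j = if i \in J then 2^-1 else 0.
    move=> ic; rewrite (bigD1 c) //= big1 ?addr0 => [|j jc]; last first.
      by rewrite rJ (negPf ic) (negPf jc).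
    by rewrite rJ (negPf ic) eqxx.
  have rowc : \sum_j r c j = \sum_(j in J) 2^-1.
    rewrite [RHS]big_mkcond /=; apply: eq_bigr => j _; rewrite rJ eqxx (negPf cJ) andbF orbF //.
  have rows : \sum_(i | i != c) \sum_j r i j = \sum_(j in J) 2^-1.
    rewrite (eq_bigr _ row) -big_mkcondr /=; apply: eq_bigl => j.
    by have [->|] := eqVneq j c; rewrite ?(negPf cJ).
  by rewrite rowc rows sumr_const -[_ *+ #|J|]mulr_natl; apply/eqP; field.
exists (d 0 c); rewrite SJ; split=> //.
- have -> : \tr (A *m A *m A) = \sum_i d 0 i ^+ 3.
    rewrite -(conjQ_trace QQ) -!conjQ_mul // QA !mulmx_diag /mxtrace.
    by apply: eq_bigr => i _; rewrite !mxE eqxx mulr1n !exprS expr0 mulr1 mulrA.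
  have p0 : (#|J|%:R : R) != 0 by rewrite pnatr_eq0 -lt0n.
  rewrite (bigID (fun i => i \in J)) /= (bigD1 (P := fun i => i \notin J) c) //=.
  rewrite [X in _ + (_ + X)]big1 ?addr0 => [|i /andP[iJ ic]]; last by rewrite d0 // expr0n.
  rewrite (eq_bigr (fun=> (- d 0 c / #|J|%:R) ^+ 3)) => [|i iJ]; last first.
    by rewrite -(dJ i iJ) mulrAC divff // mul1r.
  rewrite sumr_const -[_ *+ #|J|]mulr_natl; field.
  exact: p0.
- move=> k kS; rewrite -(conjQ_trace QQ) -!conjQ_mul //.
  set C := Q *m B k *m Q^T.
  (* [C] only links the centre with the other indices. A closed walk of length three must have a
     step staying on one side, so every term of the trace of the cube vanishes. *)
  have C0 i j : ((i == c) == (j == c)) -> C i j = 0.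
    move=> ij; apply/eqP; rewrite -sqrf_eq0; apply/eqP.
    have r00 : \sum_(k in S) (Q *m B k *m Q^T) i j ^+ 2 = 0.
      rewrite -rE rJ; move: ij; case: (eqVneq i c) => [->|ic]; case: (eqVneq j c) => [->|jc] //=.
      by rewrite (negPf cJ).
    apply: (psumr_eq0P (P := fun k => k \in S) (F := fun k => (Q *m B k *m Q^T) i j ^+ 2)) => //.
    by move=> ? _; exact: sqr_ge0.
  apply: big1 => i _; rewrite mxE; apply: big1 => j _.
  have [e|ne] := boolP ((i == c) == (j == c)).
    rewrite (C0 j i) ?mulr0 // eq_sym //.
  rewrite mxE big1 ?mul0r // => l _.
  have [e|ne'] := boolP ((i == c) == (l == c)); first by rewrite C0 ?mul0r.
  by rewrite (C0 l j) ?mulr0 //; move: ne ne'; case: (i == c); case: (j == c); case: (l == c).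
move=> J1; have /eqP/cards1P [j0 JE] := J1.
have j0c : j0 != c by apply: contraNneq cJ => <-; rewrite JE inE.
have dj0 : d 0 j0 = - d 0 c by have := dJ j0; rewrite J1 mul1r JE inE eqxx; apply.
have row_dot i j : row i Q *m (row j Q)^T = (i == j)%:R%:M.
  apply: scalar11; have /matrixP /(_ i j) := QQ; rewrite [RHS]mxE => <-.
  by rewrite tr_row -row_mul !mxE; apply: eq_bigr => l _; rewrite !mxE.
exists (row c Q), (row j0 Q); split.
- by rewrite row_dot eqxx.
- by rewrite row_dot eqxx.
- by rewrite row_dot eq_sym (negPf j0c); apply/matrixP => i j; rewrite !mxE mul0rn.
- rewrite -(conjQK QQ A) QA; apply/matrixP => i j.
  rewrite mul_mx_diag !mxE (bigD1 c) //= (bigD1 j0) //= big1 ?addr0.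
    by rewrite !mxE !big_ord1 !mxE dj0; ring.
  move=> k /andP[kc kj0]; rewrite !mxE d0 ?mulr0 ?mul0r //.
  by rewrite JE inE.
move=> k kS; exists ((Q *m B k *m Q^T) c j0).
  have := rE c j0; rewrite rJ eqxx JE inE eqxx /= => ->.
  rewrite (bigD1 k) //= big1 ?addr0 // => l /andP[lS lk].
  have : (#|S| <= 1)%N by rewrite SJ J1.
  by move=> /card_le1_eqP /(_ l k lS kS) lkE; rewrite lkE eqxx in lk.
have [C defC] : exists C, C = Q *m B k *m Q^T by eexists.
rewrite -{1}(conjQK QQ (B k)) -defC.
have Csym : C^T = C by rewrite defC conjQ_tr Bsym.
have C0 i j : ~~ ((i == c) && (j == j0) || (j == c) && (i == j0)) -> C i j = 0.
  move=> ij; rewrite defC; apply/eqP; rewrite -sqrf_eq0; apply/eqP.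
  have r00 : \sum_(k in S) (Q *m B k *m Q^T) i j ^+ 2 = 0.
    by rewrite -rE rJ JE !inE (negPf ij).
  apply: (psumr_eq0P (P := fun k => k \in S) (F := fun k => (Q *m B k *m Q^T) i j ^+ 2)) => //.
  by move=> ? _; exact: sqr_ge0.
have CE : C = C c j0 *: (delta_mx c j0 + delta_mx j0 c).
  apply/matrixP => i j; rewrite !mxE.
  have [/orP[/andP[/eqP-> /eqP->]|/andP[/eqP-> /eqP->]]|ij] :=
      boolP ((i == c) && (j == j0) || (j == c) && (i == j0)).
  - by rewrite !eqxx [c == j0]eq_sym (negPf j0c) /= addr0 mulr1.
  - by rewrite !eqxx [c == j0]eq_sym (negPf j0c) /= add0r mulr1 -[in LHS]Csym mxE.
  - rewrite C0 //; move: ij; rewrite negb_or [(j == c) && _]andbC => /andP[/negPf -> /negPf ->].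
    by rewrite addr0 mulr0.
rewrite [in LHS]CE -scalemxAr -scalemxAl; congr (_ *: _).
have E i j : Q^T *m delta_mx i j *m Q = (row i Q)^T *m row j Q.
  by rewrite -(mul_delta_mx (0 : 'I_1)) mulmxA -mulmxA -rowE -colE tr_row.
by rewrite mulmxDr mulmxDl !E.
Qed.

End CommutatorFamily.

Lemma orthogonal_mix_frob (R : realFieldType) n m (Q : 'M[R]_m)
    (B : 'I_m -> 'M[R]_n) : Q *m Q^T = 1%:M ->
  \sum_a frob (\sum_i Q a i *: B i) (\sum_i Q a i *: B i) = \sum_i frob (B i) (B i).
Proof.
move=> QQ; have QtQ : Q^T *m Q = 1%:M by exact: mulmx1C.
have E a : frob (\sum_i Q a i *: B i) (\sum_i Q a i *: B i) =
    \sum_i \sum_j Q^T i a * Q a j * frob (B i) (B j).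
  rewrite frob_suml; apply: eq_bigr => i _; rewrite frobZl frob_sumr mulr_sumr.
  by apply: eq_bigr => j _; rewrite frobZr mxE; ring.
rewrite (eq_bigr _ (fun a _ => E a)) exchange_big /=; apply: eq_bigr => i _.
rewrite exchange_big /= (bigD1 i) //= [X in _ + X]big1 ?addr0 => [|j ji].
  rewrite -mulr_suml; have /matrixP /(_ i i) := QtQ.
  by rewrite !mxE eqxx => ->; rewrite mul1r.
rewrite -mulr_suml; have /matrixP /(_ i j) := QtQ.
by rewrite !mxE [i == j]eq_sym (negPf ji) => ->; rewrite mul0r.
Qed.

(** Diagonalising the Gram matrix gives orthogonal mixtures [C a] with squared norms [d 0 a]; let
    [c a b] be the squared norm of the commutator of their normalisations. The hypothesis says that
    the sum of [d_a d_b (c_ab - 1)] over [a <> b] equals the sum of the [d_a ^ 2]. It cannot be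
    larger: on the terms with [c_ab > 1] the product [d_a d_b] is at most [(d_a ^ 2 + d_b ^ 2) / 2],
    and each row of the positive parts of [c_ab - 1] sums to at most 1. *)
Lemma ddvv_equality (R : rcfType) n m (B : 'I_m -> 'M[R]_n) : (2 <= n)%N ->
  (forall a, (B a)^T = B a) ->
  \sum_a \sum_b frob (comm (B a) (B b)) (comm (B a) (B b)) =
    (\sum_a frob (B a) (B a)) ^+ 2 ->
  exists (u v : 'rV[R]_n) (s t : 'I_m -> R),
  [/\ u *m u^T = 1%:M, v *m v^T = 1%:M, u *m v^T = 0,
      forall a, B a = s a *: (u^T *m u - v^T *m v) + t a *: (u^T *m v + v^T *m u) &
      \sum_a s a ^+ 2 = \sum_a t a ^+ 2 /\ \sum_a s a * t a = 0].
Proof.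
move=> n2 Bsym BE.
pose Gr := \matrix_(a, b) frob (B a) (B b).
have GrT : Gr^T = Gr by apply/matrixP => a b; rewrite !mxE frobC.
have [Q [d [QQ QG]]] := real_spectral GrT.
have QtQ : Q^T *m Q = 1%:M by exact: mulmx1C.
pose C a := \sum_i Q a i *: B i.
have Csym a : (C a)^T = C a.
  by rewrite /C linear_sum /=; apply: eq_bigr => i _; rewrite linearZ /= Bsym.
have CC a b : frob (C a) (C b) = d 0 a *+ (a == b).
  have /matrixP /(_ a b) := QG; rewrite [RHS]mxE => <-.
  rewrite frob_suml mxE [RHS](eq_bigr (fun j => \sum_i Q a i * frob (B i) (B j) * Q b j)).
    rewrite [RHS]exchange_big /=; apply: eq_bigr => i _; rewrite frobZl frob_sumr mulr_sumr.
    by apply: eq_bigr => j _; rewrite frobZr; ring.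
  by move=> j _; rewrite !mxE mulr_suml; apply: eq_bigr => i _; rewrite !mxE.
have BC a : B a = \sum_b Q b a *: C b.
  rewrite /C (eq_bigr (fun b => \sum_i (Q^T a b * Q b i) *: B i)); last first.
    by move=> b _; rewrite scaler_sumr; apply: eq_bigr => i _; rewrite scalerA mxE.
  rewrite exchange_big /= (bigD1 a) //= [X in _ + X]big1 ?addr0 => [|i ia].
    rewrite -scaler_suml; have /matrixP /(_ a a) := QtQ.
    by rewrite !mxE eqxx => ->; rewrite scale1r.
  rewrite -scaler_suml; have /matrixP /(_ a i) := QtQ.
  by rewrite !mxE [a == i]eq_sym (negPf ia) => ->; rewrite scale0r.
have d0 a : 0 <= d 0 a by have := frob_ge0 (C a); rewrite CC eqxx.
have Cd0 a : d 0 a = 0 -> C a = 0.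
  by move=> da; apply: frob_eq0; rewrite CC eqxx da.
have CE : \sum_a \sum_b frob (comm (C a) (C b)) (comm (C a) (C b)) = (\sum_a d 0 a) ^+ 2.
  have -> : \sum_a d 0 a = \sum_a frob (B a) (B a).
    rewrite -(orthogonal_mix_frob B QQ); apply: eq_bigr => a _.
    by rewrite -/(C a) CC eqxx.
  rewrite -BE; transitivity (\sum_a \sum_b frob (comm (C a) (B b)) (comm (C a) (B b))).
    apply: eq_bigr => a _; rewrite -[RHS](orthogonal_mix_frob _ QQ).
    apply: eq_bigr => b _; rewrite [C b]/C comm_sumr.
    by under eq_bigr => i _ do rewrite -[C a]scale1r commZ mul1r.
  rewrite exchange_big [RHS]exchange_big /=; apply: eq_bigr => b _.
  rewrite -[RHS](orthogonal_mix_frob _ QQ); apply: eq_bigr => a _; rewrite /C comm_suml.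
  by under eq_bigr => i _ do rewrite -[B b]scale1r commZ mulr1.
pose r a := Num.sqrt (d 0 a).
have r2 a : r a ^+ 2 = d 0 a by rewrite sqr_sqrtr.
(* For [d 0 a = 0] the convention [0^-1 = 0] makes [U a] zero, so that [C a = r a *: U a] holds for
   every [a]. *)
have [U defU] : exists U : 'I_m -> 'M[R]_n, forall a, U a = (r a)^-1 *: C a by eexists.
pose T := [set a | 0 < d 0 a].
have r0 a : a \in T -> r a != 0 by rewrite inE sqrtr_eq0 -ltNge.
have UC a : C a = r a *: U a.
  have [da|da] := eqVneq (d 0 a) 0.
    by rewrite Cd0 // /r da sqrtr0 scale0r.
  by rewrite defU scalerA divff ?scale1r // r0 // inE lt0r da d0.
have Usym a : (U a)^T = U a by rewrite defU linearZ /= Csym.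
have Uon a b : a \in T -> b \in T -> frob (U a) (U b) = (a == b)%:R.
  move=> aT bT; rewrite !defU frobZl frobZr CC; case: eqVneq => [<-|_]; last by rewrite !mulr0.
  by rewrite mulr1n -r2 /=; have := r0 a aT => ?; field.
pose c a b := frob (comm (U a) (U b)) (comm (U a) (U b)).
have cC a b : c a b = c b a.
  have E : comm (U a) (U b) = (-1) *: comm (U b) (U a) by rewrite /comm scaleN1r opprB.
  by rewrite /c E frobZl frobZr; ring.
have caa a : c a a = 0.
  by rewrite /c /comm subrr frobE; do 2!(apply: big1 => ? _); rewrite mxE mul0r.
have cE : \sum_a \sum_b d 0 a * d 0 b * c a b = (\sum_a d 0 a) ^+ 2.
  rewrite -CE; apply: eq_bigr => a _; apply: eq_bigr => b _.
  by rewrite /c (UC a) (UC b) commZ frobZl frobZr -!r2; ring.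
pose E a b := if (b \in T) && (1 < c a b) then c a b - 1 else 0.
have E1 a : a \in T -> \sum_b E a b <= 1.
  move=> aT; rewrite -big_mkcond /=.
  rewrite (eq_bigl (fun b => b \in [set b in T | 1 < c a b])) => [|b]; last by rewrite !inE.
  apply: comm_excess_le1 => //; first by rewrite Uon ?eqxx.
  by move=> k l; rewrite !inE => /andP[kT _] /andP[lT _]; rewrite Uon ?inE.
(* [F] and the defects [1 - \sum_b E a b] are nonnegative and, by the assumed
   equality, sum to zero once weighted as in [SFG]; so all of them vanish. *)
pose F a b := (d 0 a ^+ 2 + d 0 b ^+ 2) / 2 * (if 1 < c a b then c a b - 1 else 0)
   - d 0 a * d 0 b * (c a b - 1) - (a == b)%:R * d 0 a ^+ 2.
pose F' a b := if (a \in T) && (b \in T) then F a b else 0.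
have F0 a b : 0 <= F a b.
  rewrite /F; have [<-|ab] := eqVneq a b.
    by rewrite caa ltr10 mulr0 sub0r mul1r sub0r mulrN1 opprK -expr2 subrr.
  rewrite mul0r subr0; case: ltP => [c1|c1].
    have := sqr_ge0 (d 0 a - d 0 b); nra.
  by rewrite mulr0 sub0r -mulrN mulr_ge0 ?mulr_ge0 // opprB subr_ge0.
have dT a : a \notin T -> d 0 a = 0.
  by rewrite inE -leNgt => da; apply/eqP; rewrite eq_le da d0.
have SFG : \sum_a (\sum_b F' a b + d 0 a ^+ 2 * (1 - \sum_b E a b)) = 0.
  pose P a b := d 0 a ^+ 2 / 2 * E a b.
  have F'E a b : F' a b = P a b + P b a - (d 0 a * d 0 b * c a b)
      + d 0 a * d 0 b - (a == b)%:R * d 0 a ^+ 2.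
    rewrite /F' /F /P /E (cC b a); have [aT|aT] := boolP (a \in T);
      have [bT|bT] := boolP (b \in T) => /=.
    - by field.
    - rewrite (dT b) //; have -> : (a == b) = false by apply: contraNF bT => /eqP <-.
      by rewrite /=; ring.
    - rewrite (dT a) //; have -> : (a == b) = false by apply: contraNF aT => /eqP ->.
      by rewrite /=; ring.
    - by rewrite (dT a) // (dT b) //; ring.
  have S1 : \sum_a \sum_b F' a b =
      (\sum_a \sum_b P a b) + (\sum_a \sum_b P b a) - \sum_a d 0 a ^+ 2.
    have -> : \sum_a \sum_b F' a b = \sum_a (\sum_b P a b + \sum_b P b a
        - \sum_b d 0 a * d 0 b * c a b + \sum_b d 0 a * d 0 b - \sum_b (a == b)%:R * d 0 a ^+ 2).
      apply: eq_bigr => a _; rewrite (eq_bigr _ (fun b _ => F'E a b)).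
      by rewrite !(big_split, sumrN) /=.
    rewrite !(big_split, sumrN) /= cE.
    have -> : \sum_a \sum_b d 0 a * d 0 b = (\sum_a d 0 a) ^+ 2.
      by rewrite expr2 mulr_suml; apply: eq_bigr => a _; rewrite mulr_sumr.
    have -> : \sum_a \sum_b (a == b)%:R * d 0 a ^+ 2 = \sum_a d 0 a ^+ 2.
      apply: eq_bigr => a _; rewrite (bigD1 a) //= eqxx mul1r big1 ?addr0 // => b ba.
      by rewrite eq_sym (negPf ba) mul0r.
    by ring.
  rewrite big_split /= S1 [\sum_a \sum_b P b a]exchange_big /=.
  have -> : \sum_a d 0 a ^+ 2 * (1 - \sum_b E a b) = \sum_a d 0 a ^+ 2 - 2 * \sum_a \sum_b P a b.
    rewrite mulr_sumr -sumrB; apply: eq_bigr => a _; rewrite mulrBr mulr1 !mulr_sumr.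
    by congr (_ - _); apply: eq_bigr => b _; rewrite /P; field.
  by ring.
have F'0 a b : 0 <= F' a b by rewrite /F'; case: ifP.
have G0 a : 0 <= d 0 a ^+ 2 * (1 - \sum_b E a b).
  have [aT|aT] := boolP (a \in T); last by rewrite (dT a) // expr0n mul0r.
  by rewrite mulr_ge0 ?sqr_ge0 // subr_ge0 E1.
have FG0 a : \sum_b F' a b + d 0 a ^+ 2 * (1 - \sum_b E a b) = 0.
  apply: (psumr_eq0P (P := xpredT) _ SFG) => // b _; rewrite addr_ge0 //.
  exact: sumr_ge0.
have Frow a b : F' a b = 0.
  apply: (psumr_eq0P (P := xpredT) (F := F' a)) => //.
  by have := FG0 a; have := G0 a; have : 0 <= \sum_b F' a b by [exact: sumr_ge0]; lra.
have Erow a : a \in T -> \sum_b E a b = 1.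
  move=> aT; have := FG0 a; rewrite big1 ?add0r => [/eqP|b _]; last exact: Frow.
  rewrite mulf_eq0 sqrf_eq0 gt_eqF; last by move: aT; rewrite inE.
  by rewrite subr_eq0 => /eqP.
(* Off the diagonal [F a b] is half of [(c a b - 1) * (d 0 a - d 0 b) ^+ 2] when [c a b > 1], and
   [d 0 a * d 0 b * (1 - c a b)] otherwise. Hence no [c a b] lies below 1, and the positive parts in
   [E] may be dropped. *)
have cd a b : a \in T -> b \in T -> a != b ->
    1 <= c a b /\ (1 < c a b -> d 0 a = d 0 b).
  move=> aT bT ab; have := Frow a b; rewrite /F' aT bT /F (negPf ab) mul0r subr0 /=.
  have da : 0 < d 0 a by move: aT; rewrite inE.
  have db : 0 < d 0 b by move: bT; rewrite inE.
  case: ltP => [c1 H|c1 H]; split => //; first exact: ltW.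
  - move=> _; apply/eqP; rewrite -subr_eq0 -sqrf_eq0; apply/eqP.
    have : (c a b - 1) * (d 0 a - d 0 b) ^+ 2 = 0.
      transitivity (2 * ((d 0 a ^+ 2 + d 0 b ^+ 2) / 2 * (c a b - 1)
          - d 0 a * d 0 b * (c a b - 1))).
        by field.
      by rewrite H mulr0.
    by move/eqP; rewrite mulf_eq0 subr_eq0 gt_eqF //= => /eqP.
  - move: H => /eqP; rewrite mulr0 sub0r oppr_eq0 mulf_eq0 gt_eqF ?mulr_gt0 //= subr_eq0.
    by move=> /eqP ->.
have excess1 a : a \in T -> \sum_(b in T :\ a) (c a b - 1) = 1.
  move=> aT; rewrite -[RHS](Erow a aT) big_mkcond /=; apply: eq_bigr => b _.
  rewrite /E in_setD1; have [->|ba] := eqVneq b a; first by rewrite caa ltr10 andbF.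
  have [bT|bT] //= := boolP (b \in T).
  have [|c1 _] := cd a b aT bT; first by rewrite eq_sym.
  by case: ltP => // c1'; apply/eqP; rewrite subr_eq0 eq_le c1 c1'.
have key a : a \in T -> _ := fun aT => @comm_excess_eq1 R n _ (T :\ a) (U a) U (Usym a)
  (etrans (Uon a a aT aT) (congr1 (fun b : bool => b%:R) (eqxx a))) (fun k _ => Usym k)
  (fun k l kT lT => Uon k l (fintype.subsetP (subsetDl T [set a]) k kT)
     (fintype.subsetP (subsetDl T [set a]) l lT))
  (excess1 a aT).
case: (set_0Vmem T) => [T0|[a aT]].
  have C0 b : C b = 0 by apply: Cd0; apply: dT; rewrite T0 inE.
  pose i0 : 'I_n := Ordinal (ltnW n2); pose i1 : 'I_n := Ordinal n2.
  exists (delta_mx 0 i0), (delta_mx 0 i1), (fun=> 0), (fun=> 0).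
  rewrite !trmx_delta !mul_delta_mx_cond /=; split.
  - by apply/matrixP => i j; rewrite !ord1 !mxE.
  - by apply/matrixP => i j; rewrite !ord1 !mxE.
  - by rewrite mulr0n.
  - by move=> b; rewrite !scale0r addr0 BC big1 // => b' _; rewrite C0 scaler0.
  - by split=> //; apply: big1 => b _; rewrite mulr0.
have [x [p0 px pA _ p1]] := key a aT.
have /card_gt0P [b] := p0; rewrite in_setD1 => /andP[ba bT].
(* Exchange of roles: [a] belongs to the family around [b], so the cube of [U a] has trace zero.
   Compared with the value [pA] of this trace, where [x] is nonzero, this forces [p = 1]. *)
have [_ [_ _ _ trb _]] := key b bT.
have tra := trb a; rewrite in_setD1 eq_sym ba aT in tra.
have S1 : #|T :\ a| = 1%N.
  apply/eqP; rewrite -(eqr_nat R); move: pA px; rewrite tra // mulr0.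
  have : 1 <= (#|T :\ a|%:R : R) by rewrite ler1n.
  move: (#|T :\ a|%:R : R) => p p1' /esym/eqP; rewrite mulf_eq0 expf_eq0 /= => /orP[/eqP->|].
    by rewrite expr0n mulr0 => p00; rewrite -p00 ler10 in p1'.
  by move=> /eqP H _; apply/eqP; nra.
have /eqP/cards1P [b' TE] := S1.
have bb' : b = b' by apply/set1P; rewrite -TE in_setD1 ba.
subst b'.
have [u [v [uu vv uv UA UB]]] := p1 S1.
have [y y2 UBb] : exists2 y, y ^+ 2 = 2^-1 & U b = y *: (u^T *m v + v^T *m u).
  by apply: UB; rewrite TE inE.
(* The only excess of [a] is 1, so [c a b = 2 > 1] and [cd] equates the two norms. The coefficient
   vectors [s] and [t] then have the same length. *)
have dab : d 0 a = d 0 b.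
  have [|_] := cd a b aT bT _; first by rewrite eq_sym.
  apply; have := excess1 a aT; rewrite TE big_set1; lra.
have x2 : x ^+ 2 = 2^-1.
  by move: px; rewrite S1 => px; move: px; rewrite /= mulr1n; lra.
have Qrow k l : \sum_g Q k g * Q l g = (k == l)%:R.
  have /matrixP /(_ k l) := QQ; rewrite !mxE => <-.
  by apply: eq_bigr => g _; rewrite mxE.
exists u, v, (fun g => Q a g * r a * x), (fun g => Q b g * r a * y); split=> //.
- move=> g; rewrite BC (bigD1 a) //= (bigD1 b) //= big1 ?addr0; last first.
    move=> k /andP[ka kb]; rewrite Cd0 ?scaler0 //; apply: dT; apply/negP => kT.
    have : k \in T :\ a by rewrite in_setD1 ka.
    by rewrite TE inE (negPf kb).
  by rewrite (UC a) (UC b) UA UBb !scalerA /r dab.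
- split.
    rewrite (eq_bigr (fun g => (Q a g * Q a g) * (r a ^+ 2 * x ^+ 2))); last by move=> g _; ring.
    rewrite [RHS](eq_bigr (fun g => (Q b g * Q b g) * (r a ^+ 2 * y ^+ 2))); last first.
      by move=> g _; ring.
    by rewrite -!mulr_suml !Qrow !eqxx x2 y2.
  rewrite (eq_bigr (fun g => (Q a g * Q b g) * (r a ^+ 2 * x * y))); last by move=> g _; ring.
  by rewrite -!mulr_suml Qrow eq_sym (negPf ba) mul0r.
Qed.

(** * Curvature-like tensors at a point *)

Section Form.
Context {R : realType} {n : nat}.
Variable G : 'M[R]_n.
Local Notation V := 'rV[R]_n.
Implicit Types X Y Z u v w : V.

Lemma formDl X Y Z : form G (X + Y) Z = form G X Z + form G Y Z.
Proof. by rewrite /form !mulmxDl mxE. Qed.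
Lemma formZl a X Y : form G (a *: X) Y = a * form G X Y.
Proof. by rewrite /form -!scalemxAl mxE. Qed.
Lemma formNl X Y : form G (- X) Y = - form G X Y.
Proof. by rewrite -scaleN1r formZl mulN1r. Qed.
Lemma form0l X : form G 0 X = 0.
Proof. by rewrite /form !mul0mx mxE. Qed.
Lemma formBl X Y Z : form G (X - Y) Z = form G X Z - form G Y Z.
Proof. by rewrite formDl formNl. Qed.
Lemma formDr X Y Z : form G Z (X + Y) = form G Z X + form G Z Y.
Proof. by rewrite /form linearD mulmxDr mxE. Qed.
Lemma formZr a X Y : form G Y (a *: X) = a * form G Y X.
Proof. by rewrite /form linearZ -scalemxAr mxE. Qed.
Lemma formNr X Y : form G Y (- X) = - form G Y X.
Proof. by rewrite -scaleN1r formZr mulN1r. Qed.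
Lemma form0r X : form G X 0 = 0.
Proof. by rewrite /form trmx0 mulmx0 mxE. Qed.
Lemma formBr X Y Z : form G Z (X - Y) = form G Z X - form G Z Y.
Proof. by rewrite formDr formNr. Qed.
Lemma form_suml I (r : seq I) (P : pred I) (F : I -> V) Y :
  form G (\sum_(i <- r | P i) F i) Y = \sum_(i <- r | P i) form G (F i) Y.
Proof. by apply: (big_morph (fun X => form G X Y)) => [X Z|]; rewrite ?formDl ?form0l. Qed.
Lemma form_sumr I (r : seq I) (P : pred I) (F : I -> V) Y :
  form G Y (\sum_(i <- r | P i) F i) = \sum_(i <- r | P i) form G Y (F i).
Proof. by apply: (big_morph (fun X => form G Y X)) => [X Z|]; rewrite ?formDr ?form0r. Qed.

Definition form_lin := (formDl, formBl, formZl, formNl, formDr, formBr, formZr, formNr).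

Lemma mulmx_tr_form k l (A : 'M[R]_(k, n)) (B : 'M[R]_(l, n)) i j :
  (A *m G *m B^T) i j = form G (row i A) (row j B).
Proof. by rewrite /form -row_mul tr_row !mxE; apply: eq_bigr => a _; rewrite !mxE. Qed.

Hypothesis Gsym : G^T = G.
Lemma formC X Y : form G X Y = form G Y X.
Proof.
transitivity ((Y *m G *m X^T)^T 0 0); last by rewrite mxE.
by rewrite !trmx_mul trmxK Gsym mulmxA.
Qed.

Hypothesis Gpos : forall u, u != 0 -> 0 < form G u u.

Lemma form_inj X Y : (forall Z, form G X Z = form G Y Z) -> X = Y.
Proof.
move=> XY; apply/eqP; rewrite -subr_eq0; apply: contraT => /Gpos.
by rewrite formBl XY subrr ltxx.
Qed.

Lemma form_unitmx : G \in unitmx.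
Proof.
rewrite -row_free_unit -kermx_eq0; apply/rowV0P => v /sub_kermxP vG.
by apply: form_inj => Z; rewrite /form vG !mul0mx.
Qed.

Lemma form_sharp (l : V -> R) X :
  (forall a u v, l (a *: u + v) = a * l u + l v) -> form G (sharp G l) X = l X.
Proof.
move=> llin; rewrite /form /sharp mulmxKV ?form_unitmx // mxE.
have l0 : l 0 = 0 by have := llin (-1) 0 0; rewrite scaler0 addr0; lra.
rewrite [in RHS](row_sum_delta X).
rewrite (big_morph l (id1 := 0) (op1 := +%R)) //; last first.
  by move=> u v; have := llin 1 u v; rewrite scale1r mul1r.
apply: eq_bigr => i _; rewrite !mxE.
by have := llin (X 0 i) (delta_mx 0 i) 0; rewrite !addr0 l0 addr0 => ->; rewrite mulrC.
Qed.

End Form.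

Section Trace.
Context {R : realType} {n : nat}.
Local Notation V := 'rV[R]_n.

Lemma traceD (f g : V -> V) : trace (fun Z => f Z + g Z) = trace f + trace g.
Proof. by rewrite /trace -linearD; congr (\tr _); apply/matrixP => i j; rewrite !mxE. Qed.
Lemma traceZ a (f : V -> V) : trace (fun Z => a *: f Z) = a * trace f.
Proof. by rewrite /trace -linearZ; congr (\tr _); apply/matrixP => i j; rewrite !mxE. Qed.
Lemma traceN (f : V -> V) : trace (fun Z => - f Z) = - trace f.
Proof. by rewrite /trace -linearN; congr (\tr _); apply/matrixP => i j; rewrite !mxE. Qed.
Lemma trace_id : trace (fun Z : V => Z) = n%:R.
Proof.
rewrite /trace -[RHS](mxtrace1 R); congr (\tr _); apply/matrixP => i j.
by rewrite !mxE eqxx [j == i]eq_sym.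
Qed.
Lemma trace_form_scale (G : 'M[R]_n) (u v : V) :
  trace (fun Z => form G Z u *: v) = form G v u.
Proof.
rewrite /trace /mxtrace [in RHS](row_sum_delta v) form_suml.
by apply: eq_bigr => i _; rewrite !mxE formZl mulrC.
Qed.

End Trace.

(** * Ricci and Weyl tensors of a curvature tensor adapted to a plane *)

Section PlaneCurvature.
Context {R : realType} {n : nat}.
Local Notation V := 'rV[R]_n.
Variables (G : 'M[R]_n) (RR : V -> V -> V -> V) (e1 e2 : V) (c nu tau x : R).
Hypotheses (Gsym : G^T = G) (Gpos : forall u, u != 0 -> 0 < form G u u).
Hypotheses (e11 : form G e1 e1 = 1) (e22 : form G e2 e2 = 1) (e12 : form G e1 e2 = 0).
Hypothesis n4 : (4 <= n)%N.

Local Notation g := (form G).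

Definition plane_op (X : V) : V :=
  nu *: (g X e1 *: e1 - g X e2 *: e2) + tau *: (g X e1 *: e2 + g X e2 *: e1).
Definition plane_form (X Y : V) : R :=
  nu * (g X e1 * g Y e1 - g X e2 * g Y e2) + tau * (g X e1 * g Y e2 + g X e2 * g Y e1).
Definition plane_area (X Y : V) : R := g X e1 * g Y e2 - g X e2 * g Y e1.
Definition plane_proj (X Y : V) : R := g X e1 * g Y e1 + g X e2 * g Y e2.

Local Notation M := plane_form.
Local Notation Mo := plane_op.
Local Notation om := plane_area.
Local Notation pr := plane_proj.

(** The Gauss curvature of shape operators [H + s D + t S]: [c] collects the ambient curvature and
    the [H ^ 2], while [nu] and [tau] collect the products [H s] and [H t]. As [D] and [S] both have
    determinant -1 on the plane, their squares contribute a negative multiple of the curvature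
    tensor [om X Y * om W Z] of the plane. *)
Definition plane_curv (X Y Z W : V) : R :=
  c * (g Y Z * g X W - g X Z * g Y W) +
  (M Y Z * g X W - M X Z * g Y W + g Y Z * M X W - g X Z * M Y W) -
  x * om X Y * om W Z.

Hypothesis RRE : forall X Y Z W, lower G RR X Y Z W = plane_curv X Y Z W.

Lemma curv_opE X Y Z : RR X Y Z =
  c *: (g Y Z *: X - g X Z *: Y) +
  (M Y Z *: X - M X Z *: Y + g Y Z *: Mo X - g X Z *: Mo Y) -
  (x * om X Y) *: (g Z e2 *: e1 - g Z e1 *: e2).
Proof.
apply: (form_inj Gpos) => W; rewrite -/(lower G RR X Y Z W) RRE /plane_curv.
rewrite ?form_lin /plane_op ?form_lin /plane_form /plane_area.
by rewrite (formC Gsym e1) (formC Gsym e2); ring.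
Qed.

Lemma ricc_planeE X Y : ricc RR X Y =
  c * (n%:R - 1) * g X Y + (n%:R - 2) * M X Y - x * pr X Y.
Proof.
(* The dependence on [Z] is split into the identity and maps of the form [g Z u *: v], whose traces
   are [n] and [g v u]. *)
have -> : ricc RR X Y = trace (fun Z : V => (c * g X Y + M X Y) *: Z
   + ((g X Y * nu - x * (g Y e2 * g X e2)) *: (g Z e1 *: e1)
   + ((- (g X Y * nu) - x * (g Y e1 * g X e1)) *: (g Z e2 *: e2)
   + ((g X Y * tau + x * g Y e1 * g X e2) *: (g Z e1 *: e2)
   + ((g X Y * tau + x * g Y e2 * g X e1) *: (g Z e2 *: e1)
   + (- c *: (g Z Y *: X) + (- 1 *: (g Z Y *: Mo X)
   + ((-1 * (nu * g Y e1 + tau * g Y e2)) *: (g Z e1 *: X)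
   + (-1 * (- nu * g Y e2 + tau * g Y e1)) *: (g Z e2 *: X))))))))).
  rewrite /ricc; congr trace; apply/funext => Z; rewrite curv_opE.
  apply: (form_inj Gpos) => W.
  by rewrite /plane_op /plane_form /plane_area ?form_lin /plane_op ?form_lin; ring.
rewrite !traceD !traceZ trace_id !trace_form_scale e11 e22 (formC Gsym e2 e1) e12.
rewrite /plane_op /plane_form /plane_proj ?form_lin (formC Gsym e1 Y) (formC Gsym e2 Y).
by ring.
Qed.

Lemma ricci_op_planeE X : ricci_op G RR X =
  (c * (n%:R - 1)) *: X + (n%:R - 2) *: Mo X - x *: (g X e1 *: e1 + g X e2 *: e2).
Proof.
apply: (form_inj Gpos) => W; rewrite (form_sharp Gpos); last first.
  by move=> a u v; rewrite !ricc_planeE /plane_form /plane_proj ?form_lin; ring.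
rewrite ricc_planeE /plane_op /plane_form /plane_proj ?form_lin.
by rewrite (formC Gsym e1) (formC Gsym e2); ring.
Qed.

Lemma kappa_planeE : kappa G RR = c * n%:R * (n%:R - 1) - 2 * x.
Proof.
have -> : kappa G RR = trace (fun Z : V => (c * (n%:R - 1)) *: Z
   + (((n%:R - 2) * nu - x) *: (g Z e1 *: e1)
   + ((- (n%:R - 2) * nu - x) *: (g Z e2 *: e2)
   + (((n%:R - 2) * tau) *: (g Z e1 *: e2)
   + ((n%:R - 2) * tau) *: (g Z e2 *: e1))))).
  rewrite /kappa; congr trace; apply/funext => Z; rewrite ricci_op_planeE.
  apply: (form_inj Gpos) => W; rewrite /plane_op ?form_lin.
  by ring.
rewrite !traceD !traceZ trace_id !trace_form_scale e11 e22 (formC Gsym e2 e1) e12.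
by ring.
Qed.

Lemma nR_ge4 : 4 <= n%:R :> R.
Proof. by rewrite (ler_nat R 4 n). Qed.

(** The terms in [c], [nu] and [tau] are Kulkarni-Nomizu products with the metric, which the Weyl
    tensor annihilates; what is left is linear in [x]. *)
Lemma weyl_planeE X Y Z W : lower G (weyl_op G RR) X Y Z W =
  x / (n%:R - 2) * (pr Y Z * g X W - g X Z * pr Y W + g Y Z * pr X W - pr X Z * g Y W)
  - 2 * x / ((n%:R - 1) * (n%:R - 2)) * (g Y Z * g X W - g X Z * g Y W)
  - x * om X Y * om W Z.
Proof.
rewrite /lower /weyl_op formBl -/(lower G RR X Y Z W) RRE /plane_curv kappa_planeE !ricci_op_planeE.
rewrite /wedge /plane_op ?form_lin /plane_form /plane_area /plane_proj.
rewrite !(formC Gsym e1) !(formC Gsym e2).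
have N4 := nR_ge4; field.
by apply/andP; split; apply/eqP; lra.
Qed.

End PlaneCurvature.

(** * Consequences of linear dependence for the plane-adapted tensor *)

Section PlaneDependent.
Context {R : realType} {n : nat}.
Local Notation V := 'rV[R]_n.
Variables (G : 'M[R]_n) (RR : V -> V -> V -> V) (e1 e2 e3 e4 : V) (c nu tau x : R).
Hypotheses (Gsym : G^T = G) (Gpos : forall u, u != 0 -> 0 < form G u u).
Hypotheses (e11 : form G e1 e1 = 1) (e22 : form G e2 e2 = 1) (e12 : form G e1 e2 = 0)
 (e33 : form G e3 e3 = 1) (e44 : form G e4 e4 = 1) (e34 : form G e3 e4 = 0)
 (e13 : form G e1 e3 = 0) (e14 : form G e1 e4 = 0)
 (e23 : form G e2 e3 = 0) (e24 : form G e2 e4 = 0).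
Hypothesis n4 : (4 <= n)%N.
Local Notation g := (form G).
Hypothesis RRE : forall X Y Z W,
  lower G RR X Y Z W = plane_curv G e1 e2 c nu tau x X Y Z W.
Hypotheses (c0 : 0 < c) (x0 : 0 <= x).

(** Two kinds of components ask for different ratios of the coefficients. If [nu = tau = 0] and
    [c x] is nonzero, those involving [e4] give [al = - N be], whereas those with two directions in
    the plane give [(N - 1) al = - N ^ 2 be]; both coefficients would vanish. *)
Lemma plane_dependent_flat :
  lin_dependent6 (tensor_RC G RR) (tensor_QRicR G RR) -> x = 0.
Proof.
move=> [al [be [ab dep]]].
have sy : (g e2 e1 = 0) * (g e3 e1 = 0) * (g e3 e2 = 0) *
    (g e4 e1 = 0) * (g e4 e2 = 0) * (g e4 e3 = 0).
  by do !split; rewrite formC.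
pose simp := (e11, e22, e12, e33, e44, e34, e13, e14, e23, e24, sy).
have N4 : 4 <= n%:R :> R by rewrite (ler_nat R 4 n).
pose N := n%:R - 2 : R.
pose C := lower G (weyl_op G RR).
pose T := lower G RR.
have CE X Y Z W : C X Y Z W = _ := weyl_planeE Gsym Gpos e11 e22 e12 n4 RRE X Y Z W.
have RE X Y Z : RR X Y Z = _ := curv_opE Gsym Gpos RRE X Y Z.
have ricE X Y : ricc RR X Y = _ := ricc_planeE Gsym Gpos e11 e22 e12 RRE X Y.
pose wr X Y Z := wedge (ricc RR) X Y Z.
pose K := n%:R - 1 : R.
pose s1 := c * K + N * nu - x; pose s2 := c * K - N * nu - x.
pose s12 := N * tau; pose s3 := c * K.
have vec X Y : (forall W, g X W = g Y W) -> X = Y by apply: form_inj.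
have R131 : RR e1 e3 e1 = - (c + nu) *: e3.
  rewrite RE /plane_op /plane_form /plane_area !simp; apply: vec => W.
  by rewrite !form_lin; ring.
have R132 : RR e1 e3 e2 = - tau *: e3.
  rewrite RE /plane_op /plane_form /plane_area !simp; apply: vec => W.
  by rewrite !form_lin; ring.
have R133 : RR e1 e3 e3 = (c + nu) *: e1 + tau *: e2.
  rewrite RE /plane_op /plane_form /plane_area !simp; apply: vec => W.
  by rewrite !form_lin; ring.
have R134 : RR e1 e3 e4 = 0.
  rewrite RE /plane_op /plane_form /plane_area !simp; apply: vec => W.
  by rewrite !form_lin form0l; ring.
have R231 : RR e2 e3 e1 = - tau *: e3.
  rewrite RE /plane_op /plane_form /plane_area !simp; apply: vec => W.
  by rewrite !form_lin; ring.
have R232 : RR e2 e3 e2 = - (c - nu) *: e3.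
  rewrite RE /plane_op /plane_form /plane_area !simp; apply: vec => W.
  by rewrite !form_lin; ring.
have R233 : RR e2 e3 e3 = (c - nu) *: e2 + tau *: e1.
  rewrite RE /plane_op /plane_form /plane_area !simp; apply: vec => W.
  by rewrite !form_lin; ring.
have R234 : RR e2 e3 e4 = 0.
  rewrite RE /plane_op /plane_form /plane_area !simp; apply: vec => W.
  by rewrite !form_lin form0l; ring.
have W131 : wr e1 e3 e1 = - s1 *: e3.
  rewrite /wr /wedge !ricE /plane_form /plane_proj !simp; apply: vec => W.
  by rewrite !form_lin /s1 /N /K; ring.
have W132 : wr e1 e3 e2 = - s12 *: e3.
  rewrite /wr /wedge !ricE /plane_form /plane_proj !simp; apply: vec => W.
  by rewrite !form_lin /s12 /N /K; ring.
have W133 : wr e1 e3 e3 = s3 *: e1.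
  rewrite /wr /wedge !ricE /plane_form /plane_proj !simp; apply: vec => W.
  by rewrite !form_lin /s3 /N /K; ring.
have W134 : wr e1 e3 e4 = 0.
  rewrite /wr /wedge !ricE /plane_form /plane_proj !simp; apply: vec => W.
  by rewrite !form_lin form0l; ring.
have W231 : wr e2 e3 e1 = - s12 *: e3.
  rewrite /wr /wedge !ricE /plane_form /plane_proj !simp; apply: vec => W.
  by rewrite !form_lin /s12 /N /K; ring.
have W232 : wr e2 e3 e2 = - s2 *: e3.
  rewrite /wr /wedge !ricE /plane_form /plane_proj !simp; apply: vec => W.
  by rewrite !form_lin /s2 /N /K; ring.
have W233 : wr e2 e3 e3 = s3 *: e2.
  rewrite /wr /wedge !ricE /plane_form /plane_proj !simp; apply: vec => W.
  by rewrite !form_lin /s3 /N /K; ring.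
have W234 : wr e2 e3 e4 = 0.
  rewrite /wr /wedge !ricE /plane_form /plane_proj !simp; apply: vec => W.
  by rewrite !form_lin form0l; ring.
have {}dep X1 X2 X3 X4 X Y : al * (
    C (RR X Y X1) X2 X3 X4 + C X1 (RR X Y X2) X3 X4 +
    C X1 X2 (RR X Y X3) X4 + C X1 X2 X3 (RR X Y X4)) + be * (
    T (wr X Y X1) X2 X3 X4 + T X1 (wr X Y X2) X3 X4 +
    T X1 X2 (wr X Y X3) X4 + T X1 X2 X3 (wr X Y X4)) = 0.
  have := dep X1 X2 X3 X4 X Y; rewrite /tensor_RC /tensor_QRicR /act -/C -/T -/wr.
  by rewrite !mulrN -opprD => /eqP; rewrite oppr_eq0 => /eqP.
have N2 : n%:R - 2 != 0 :> R by apply/eqP; lra.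
have N1 : n%:R - 1 != 0 :> R by apply/eqP; lra.
have comb (k a b : R) : b = 0 -> a = k * b -> a = 0 by move=> -> ->; rewrite mulr0.
(* The components (X1,X2,X3,X4;X,Y) = (1,4,4,3;1,3) and (2,4,4,3;2,3) give
   al = - (n - 2) be; then (1,2,2,3;1,3), (2,1,1,3;2,3) and (1,2,2,3;2,3) give
   nu = tau = 0 and c x = 0. *)
have F1 : al * (c + nu) * x + N * be * c * (x + nu) = 0.
  have E := dep e1 e4 e4 e3 e1 e3.
  rewrite R131 R133 R134 W131 W133 W134 /T in E.
  rewrite !CE !RRE /plane_curv /plane_form /plane_area /plane_proj in E.
  rewrite !(form0l, form0r, form_lin, simp) in E.
  apply: (comb N _ _ E); rewrite /s1 /s3 /N /K; field.
  by rewrite N1 N2.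
have F2 : al * (c - nu) * x + N * be * c * (x - nu) = 0.
  have E := dep e2 e4 e4 e3 e2 e3.
  rewrite R232 R233 R234 W232 W233 W234 /T in E.
  rewrite !CE !RRE /plane_curv /plane_form /plane_area /plane_proj in E.
  rewrite !(form0l, form0r, form_lin, simp) in E.
  apply: (comb N _ _ E); rewrite /s2 /s3 /N /K; field.
  by rewrite N1 N2.
have F3 : al * (c + nu) * x * (N - 1) + N * be *
    (- c * nu + x * nu - N * nu ^+ 2 - N * tau ^+ 2 + N * c * x) = 0.
  have E := dep e1 e2 e2 e3 e1 e3.
  rewrite R131 R132 R133 W131 W132 W133 /T in E.
  rewrite !CE !RRE /plane_curv /plane_form /plane_area /plane_proj in E.
  rewrite !(form0l, form0r, form_lin, simp) in E.
  apply: (comb (- N) _ _ E); rewrite /s1 /s12 /s3 /N /K; field.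
  by rewrite N1 N2.
have F4 : al * (c - nu) * x * (N - 1) + N * be *
    (c * nu - x * nu - N * nu ^+ 2 - N * tau ^+ 2 + N * c * x) = 0.
  have E := dep e2 e1 e1 e3 e2 e3.
  rewrite R231 R232 R233 W231 W232 W233 /T in E.
  rewrite !CE !RRE /plane_curv /plane_form /plane_area /plane_proj in E.
  rewrite !(form0l, form0r, form_lin, simp) in E.
  apply: (comb (- N) _ _ E); rewrite /s2 /s12 /s3 /N /K; field.
  by rewrite N1 N2.
have F5 : al * tau * x * (N - 1) + N * be * tau * (x - c) = 0.
  have E := dep e1 e2 e2 e3 e2 e3.
  rewrite R231 R232 R233 W231 W232 W233 /T in E.
  rewrite !CE !RRE /plane_curv /plane_form /plane_area /plane_proj in E.
  rewrite !(form0l, form0r, form_lin, simp) in E.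
  apply: (comb (- N) _ _ E); rewrite /s2 /s12 /s3 /N /K; field.
  by rewrite N1 N2.
have NN : 2 <= N by rewrite /N; lra.
move: NN F1 F2 F3 F4 F5 {R131 R132 R133 R134 R231 R232 R233 R234
  W131 W132 W133 W134 W231 W232 W233 W234 dep s1 s2 s12 s3}; move: N => N' NN F1 F2 F3 F4 F5.
apply/eqP; apply: contraT => xn; have xp : 0 < x by rewrite lt0r xn.
have cn : c != 0 by rewrite gt_eqF.
(* Adding the two relations eliminates [nu]. *)
have alE : al = - N' * be.
  have : c * x * (al + N' * be) = 0.
    by apply: (comb 2^-1 _ ((al * (c + nu) * x + N' * be * c * (x + nu)) +
       (al * (c - nu) * x + N' * be * c * (x - nu)))); [rewrite F1 F2 addr0|field].
  by move/eqP; rewrite !mulf_eq0 (negPf cn) (negPf xn) /= addr_eq0 mulNr => /eqP.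
have be0 : be != 0.
  by apply: contraTneq ab => be0; rewrite alE be0 mulr0 eqxx.
have Nn : N' != 0 by rewrite gt_eqF //; lra.
have Nb : N' * be != 0 by rewrite mulf_neq0.
(* Here [N' >= 2], that is [n >= 4], and [c > 0] keep positive the factor that multiplies both [nu]
   and [tau]. *)
have pos : (N' - 2) * x + c != 0 by rewrite gt_eqF // ltr_wpDl // mulr_ge0 // subr_ge0.
have nu0 : nu = 0.
  have : (N' * be) * (((N' - 2) * x + c) * nu) = 0.
    by apply: (comb (- 2^-1) _ ((al * (c + nu) * x * (N' - 1) + N' * be *
     (- c * nu + x * nu - N' * nu ^+ 2 - N' * tau ^+ 2 + N' * c * x)) -
     (al * (c - nu) * x * (N' - 1) + N' * be *
     (c * nu - x * nu - N' * nu ^+ 2 - N' * tau ^+ 2 + N' * c * x))));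
      [rewrite F3 F4 subr0|rewrite alE; field].
  by move/eqP; rewrite mulf_eq0 (negPf Nb) mulf_eq0 (negPf pos) => /eqP.
have tau0 : tau = 0.
  have : (N' * be) * (((N' - 2) * x + c) * tau) = 0.
    by apply: (comb (-1) _ _ F5); rewrite alE; ring.
  by move/eqP; rewrite mulf_eq0 (negPf Nb) mulf_eq0 (negPf pos) => /eqP.
have : N' * be * (c * x) = 0.
  by apply: (comb 1 _ _ F3); rewrite alE nu0 tau0; ring.
by move/eqP; rewrite mulf_eq0 (negPf Nb) mulf_eq0 (negPf cn) => /eqP xx; rewrite xx eqxx in xn.
Qed.
End PlaneDependent.

(** * Symmetry of second derivatives and matrix calculus *)

Local Open Scope classical_set_scope.
Local Open Scope ring_scope.

Section Schwarz.
Context {R : realType} {V : normedModType R}.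
Implicit Types (f : V -> R) (u v x y : V).

Lemma is_derive_line f y v (s : R) : derivable f (s *: v + y) v ->
  is_derive s (1 : R) (fun r : R => f (r *: v + y)) ('D_v f (s *: v + y)).
Proof.
move=> df.
have E : (fun h : R => h^-1 *:
    (((fun r : R => f (r *: v + y)) \o shift s) (h *: 1) - f (s *: v + y)))
  = (fun h : R => h^-1 *: ((f \o shift (s *: v + y)) (h *: v) - f (s *: v + y))).
  by apply/funext => h; rewrite /= [h *: 1]mulr1 scalerDl addrA.
by apply: DeriveDef; rewrite /derivable /derive E.
Qed.

Lemma MVT_line f y v (t : R) : 0 < t ->
  (forall s, 0 <= s <= t -> derivable f (s *: v + y) v) ->
  exists2 s, 0 <= s <= t & f (t *: v + y) - f y = 'D_v f (s *: v + y) * t.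
Proof.
move=> t0 df.
have D s : 0 <= s <= t -> is_derive s (1 : R) (fun r : R => f (r *: v + y)) ('D_v f (s *: v + y)).
  by move=> st; apply: is_derive_line; exact: df.
have [s||s st E] := @MVT R (fun r : R => f (r *: v + y)) (fun s => 'D_v f (s *: v + y)) 0 t t0.
- by rewrite in_itv /= => /andP[/ltW s0 /ltW st]; apply: D; rewrite s0.
- apply: derivable_within_continuous => s; rewrite in_itv /= => st.
  by apply: ex_derive; exact: D.
exists s; first by move: st; rewrite in_itv /= => /andP[/ltW -> /ltW ->].
by move: E; rewrite subr0 scale0r add0r.
Qed.

Lemma second_difference f x u v (t d : R) : 0 < t -> t * (`|u| + `|v|) < d ->
  (forall y, `|y - x| < d -> derivable f y u) ->
  (forall y, `|y - x| < d -> derivable ('D_u f) y v) ->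
  exists2 p, `|p - x| < d &
    f (t *: u + (t *: v + x)) - f (t *: u + x) - (f (t *: v + x) - f x) =
    'D_v ('D_u f) p * t * t.
Proof.
move=> t0 td fu fuv.
have near s r : 0 <= s <= t -> 0 <= r <= t -> `|s *: u + (r *: v + x) - x| < d.
  move=> /andP[s0 st] /andP[r0 rt]; apply: le_lt_trans td.
  rewrite addrA addrK (le_trans (ler_normD _ _)) // !normrZ mulrDr !ger0_norm //.
  by rewrite lerD // ler_wpM2r.
have t0t : 0 <= t <= t by rewrite lexx ltW.
have zt : 0 <= (0 : R) <= t by rewrite lexx ltW.
pose phi s := f (s *: u + (t *: v + x)) - f (s *: u + x).
pose dphi s := 'D_u f (s *: u + (t *: v + x)) - 'D_u f (s *: u + x).
have D s : 0 <= s <= t -> is_derive s (1 : R) phi (dphi s).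
  move=> st; apply: is_deriveB; apply: is_derive_line; apply: fu; first exact: near.
  by have := near s 0 st zt; rewrite scale0r add0r.
have [s||s st E] := @MVT R phi dphi 0 t t0.
- by rewrite in_itv /= => /andP[/ltW s0 /ltW st]; apply: D; rewrite s0.
- apply: derivable_within_continuous => s; rewrite in_itv /= => st.
  by apply: ex_derive; exact: D.
have {}st : 0 <= s <= t by move: st; rewrite in_itv /= => /andP[/ltW -> /ltW ->].
have [r rt E2] := @MVT_line ('D_u f) (s *: u + x) v t t0 (fun r rt =>
  fuv _ (eq_ind _ (fun w => `|w - x| < d) (near s r st rt) _ (addrCA _ _ _))).
exists (r *: v + (s *: u + x)); first by rewrite addrCA; exact: near.
move: E; rewrite subr0 /phi !scale0r !add0r => ->.
by rewrite -E2 /dphi (addrCA (s *: u)).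
Qed.

(** The second difference along [u] and [v] is symmetric, so by [second_difference] the two mixed
    derivatives agree at some points [p] and [q] close to [x]; continuity transfers this to [x]. *)
Lemma schwarz f x u v :
  (\forall y \near x, derivable f y u /\ derivable f y v) ->
  (\forall y \near x, derivable ('D_u f) y v /\ derivable ('D_v f) y u) ->
  {for x, continuous ('D_v ('D_u f))} -> {for x, continuous ('D_u ('D_v f))} ->
  'D_v ('D_u f) x = 'D_u ('D_v f) x.
Proof.
move=> f1 f2 c1 c2; apply/eqP; rewrite -subr_eq0 -normr_le0; apply/ler_addgt0Pr => e e0.
rewrite add0r.
have e2 : 0 < e / 2 by rewrite divr_gt0.
have /nbhs_ballP [d /= d0 dP] : \forall y \near x,
    [/\ derivable f y u /\ derivable f y v,
        derivable ('D_u f) y v /\ derivable ('D_v f) y u,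
        `|'D_v ('D_u f) x - 'D_v ('D_u f) y| <= e / 2 &
        `|'D_u ('D_v f) x - 'D_u ('D_v f) y| <= e / 2].
  have C1 : \forall y \near x, `|'D_v ('D_u f) x - 'D_v ('D_u f) y| <= e / 2.
    exact: ((cvgrPdist_le _ _).1 c1 _ e2).
  have C2 : \forall y \near x, `|'D_u ('D_v f) x - 'D_u ('D_v f) y| <= e / 2.
    exact: ((cvgrPdist_le _ _).1 c2 _ e2).
  near=> y; split; [exact: (near f1) | exact: (near f2) | exact: (near C1) | exact: (near C2)].
have B y : `|y - x| < d -> ball x d y by rewrite -ball_normE /= distrC.
have dP' y yd := dP y (B y yd).
(* The parallelogram with sides [t u] and [t v] must stay in the ball of radius [d]; the summand 1
   avoids dividing by zero when [u = v = 0]. *)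
pose t := d / (`|u| + `|v| + 1) / 2.
have n0 : 0 < `|u| + `|v| + 1 by rewrite ltr_wpDl // addr_ge0.
have t0 : 0 < t by rewrite !divr_gt0.
have td : t * (`|u| + `|v|) < d.
  have S0 : 0 <= `|u| + `|v| by rewrite addr_ge0.
  move: (`|u| + `|v|) S0 @t n0 t0 => S S0 t n0 t0.
  have -> : t * S = d * (S / (S + 1) / 2) by rewrite /t; field; rewrite gt_eqF.
  by rewrite gtr_pMr // !ltr_pdivrMr //; lra.
have [p pd Ep] := @second_difference f x u v t d t0 td
  (fun y yd => let: And4 (conj a _) _ _ _ := dP' y yd in a)
  (fun y yd => let: And4 _ (conj a _) _ _ := dP' y yd in a).
have td' : t * (`|v| + `|u|) < d by rewrite [`|v| + _]addrC.
have [q qd Eq] := @second_difference f x v u t d t0 td'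
  (fun y yd => let: And4 (conj _ a) _ _ _ := dP' y yd in a)
  (fun y yd => let: And4 _ (conj _ a) _ _ := dP' y yd in a).
have pq : 'D_v ('D_u f) p = 'D_u ('D_v f) q.
  have tn : t != 0 by rewrite gt_eqF.
  apply: (mulIf tn); apply: (mulIf tn); apply: (etrans (esym Ep)); apply: etrans Eq.
  by rewrite (addrCA (t *: u)); ring.
have [_ _ Hp _] := dP' p pd; have [_ _ _ Hq] := dP' q qd.
apply: (le_trans (ler_distD ('D_v ('D_u f) p) _ _)).
rewrite [leRHS]splitr; apply: lerD; first exact: Hp.
by rewrite pq distrC; exact: Hq.
Unshelve. all: by end_near. Qed.
End Schwarz.

(** * Directional derivatives of matrix-valued functions *)

Section MatrixCalculus.
Context {R : realType} {V : normedModType R}.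
Implicit Types (x v : V).

Lemma derivable_sum_fun I (r : seq I) (P : pred I) (f : I -> V -> R) x v :
  (forall i, P i -> derivable (f i) x v) ->
  derivable (fun y => \sum_(i <- r | P i) f i y) x v.
Proof.
move=> df; elim: r => [|i r IH].
  by under eq_fun do rewrite big_nil; exact: derivable_cst.
case Pi : (P i); under eq_fun do rewrite big_cons Pi //; last exact: IH.
exact: derivableD (df i Pi) IH.
Qed.

Lemma derivable_prod_fun I (r : seq I) (f : I -> V -> R) x v :
  (forall i, derivable (f i) x v) -> derivable (fun y => \prod_(i <- r) f i y) x v.
Proof.
move=> df; elim: r => [|i r IH].
  by under eq_fun do rewrite big_nil; exact: derivable_cst.
under eq_fun do rewrite big_cons.
exact: derivableM (df i) IH.
Qed.

Lemma derive_sum_fun I (r : seq I) (f : I -> V -> R) x v :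
  (forall i, derivable (f i) x v) ->
  'D_v (fun y => \sum_(i <- r) f i y) x = \sum_(i <- r) 'D_v (f i) x.
Proof.
move=> df; elim: r => [|i r IH].
  by under eq_fun do rewrite big_nil; rewrite big_nil derive_cst.
under eq_fun do rewrite big_cons.
rewrite big_cons deriveD //; last exact: derivable_sum_fun.
by rewrite IH.
Qed.

Lemma derivable_entry m n (A : V -> 'M[R]_(m, n)) x v i j :
  derivable A x v -> derivable (fun y => A y i j) x v.
Proof. by move=> /derivable_mxP. Qed.

Lemma derive_entry m n (A : V -> 'M[R]_(m, n)) x v i j :
  derivable A x v -> 'D_v (fun y => A y i j) x = ('D_v A x) i j.
Proof. by move=> dA; rewrite derive_mx // mxE. Qed.

Lemma derivable_mulmx m n p (A : V -> 'M[R]_(m, n)) (B : V -> 'M[R]_(n, p)) x v :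
  derivable A x v -> derivable B x v -> derivable (fun y => A y *m B y) x v.
Proof.
move=> dA dB; apply/derivable_mxP => i j; under eq_fun do rewrite mxE.
by apply: derivable_sum_fun => k _; apply: derivableM; exact: derivable_entry.
Qed.

Lemma derive_mulmx m n p (A : V -> 'M[R]_(m, n)) (B : V -> 'M[R]_(n, p)) x v :
  derivable A x v -> derivable B x v ->
  'D_v (fun y => A y *m B y) x = 'D_v A x *m B x + A x *m 'D_v B x.
Proof.
move=> dA dB; apply/matrixP => i j.
rewrite -derive_entry; last exact: derivable_mulmx.
under eq_fun do rewrite mxE.
rewrite derive_sum_fun; last by move=> k; apply: derivableM; exact: derivable_entry.
rewrite !mxE -big_split /=; apply: eq_bigr => k _.
rewrite deriveM; try exact: derivable_entry.
rewrite !derive_entry // addrC; congr (_ + _).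
by rewrite /GRing.scale /= mulrC.
Qed.

Lemma derivable_trmx m n (A : V -> 'M[R]_(m, n)) x v :
  derivable A x v -> derivable (fun y => (A y)^T) x v.
Proof.
move=> dA; apply/derivable_mxP => i j; under eq_fun do rewrite mxE.
exact: derivable_entry.
Qed.

Lemma derive_trmx m n (A : V -> 'M[R]_(m, n)) x v :
  derivable A x v -> 'D_v (fun y => (A y)^T) x = ('D_v A x)^T.
Proof.
move=> dA; apply/matrixP => i j; rewrite -derive_entry; last exact: derivable_trmx.
by under eq_fun do rewrite mxE; rewrite derive_entry // mxE.
Qed.

Lemma derivable_form n (A : V -> 'M[R]_n) (a b : V -> 'rV[R]_n) x v :
  derivable A x v -> derivable a x v -> derivable b x v ->
  derivable (fun y => form (A y) (a y) (b y)) x v.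
Proof.
move=> dA da db; apply: (@derivable_entry _ _ (fun y => a y *m A y *m (b y)^T)).
by apply: derivable_mulmx; [exact: derivable_mulmx | exact: derivable_trmx].
Qed.

Lemma derive_form n (A : V -> 'M[R]_n) (a b : V -> 'rV[R]_n) x v :
  derivable A x v -> derivable a x v -> derivable b x v ->
  'D_v (fun y => form (A y) (a y) (b y)) x =
  form ('D_v A x) (a x) (b x) + form (A x) ('D_v a x) (b x) + form (A x) (a x) ('D_v b x).
Proof.
move=> dA da db.
have dt := derivable_trmx db; have dm := derivable_mulmx da dA.
rewrite (@derive_entry _ _ (fun y => a y *m A y *m (b y)^T)); last exact: derivable_mulmx.
rewrite derive_mulmx // derive_mulmx // derive_trmx // mulmxDl.
by rewrite [LHS]mxE [X in X + _ = _]mxE [X in X + _ = _]addrC.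
Qed.

Lemma derivable_det n (A : V -> 'M[R]_n) x v :
  derivable A x v -> derivable (fun y => \det (A y)) x v.
Proof.
move=> dA; apply: derivable_sum_fun => s _; apply: derivableM; first exact: derivable_cst.
by apply: derivable_prod_fun => i; exact: derivable_entry.
Qed.

(** By Cramer's formula. Invertibility is assumed on a whole neighbourhood because [invmx] returns
    its argument on singular matrices. *)
Lemma derivable_invmx n (A : V -> 'M[R]_n) x v :
  (\forall y \near x, A y \in unitmx) -> derivable A x v ->
  derivable (fun y => invmx (A y)) x v.
Proof.
move=> Au dA.
apply: (@near_eq_derivable _ _ _ (fun y => (\det (A y))^-1 *: \adj (A y))).
  by apply: filterS Au => y yu; rewrite /invmx yu.
have Axu : \det (A x) != 0 by have := nbhs_singleton Au; rewrite unitmxE unitfE.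
apply/derivable_mxP => i j; under eq_fun do rewrite mxE.
apply: derivableM; first by apply: derivableV => //; exact: derivable_det.
under eq_fun do rewrite mxE /cofactor.
apply: derivableM; first exact: derivable_cst.
apply: derivable_det; apply/derivable_mxP => k l; under eq_fun do rewrite !mxE.
exact: derivable_entry.
Qed.

End MatrixCalculus.

Section ChainRule.
Context {R : realType} {U V W : normedModType R}.

Lemma derive_chain (F : U -> V) (phi : V -> W) x v :
  differentiable F x -> differentiable phi (F x) ->
  'D_v (fun y => phi (F y)) x = 'D_('D_v F x) phi (F x).
Proof.
move=> dF dphi; have dc := differentiable_comp dF dphi.
by rewrite (deriveE _ dc) diff_comp // !deriveE.
Qed.

Lemma derivable_chain (F : U -> V) (phi : V -> W) x v :
  differentiable F x -> differentiable phi (F x) ->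
  derivable (fun y => phi (F y)) x v.
Proof. by move=> dF dphi; apply: diff_derivable; exact: differentiable_comp. Qed.

Lemma derive_dirP (F : U -> V) x a u v : differentiable F x ->
  'D_(a *: u + v) F x = a *: 'D_u F x + 'D_v F x.
Proof. by move=> dF; rewrite !deriveE // linearP. Qed.

End ChainRule.

Section Smooth.
Context {R : realType} {n : nat} {W : normedModType R}.
Variables (U : set 'rV[R]_n) (F : 'rV[R]_n -> W).
Hypothesis sF : smooth_on U F.

Lemma smooth_differentiable x : U x -> differentiable F x.
Proof. by have [dF _] := sF 1; exact: dF. Qed.

Lemma smooth_derivable x v : U x -> derivable F x v.
Proof. by move=> /smooth_differentiable; exact: diff_derivable. Qed.

Lemma smooth_derive v : smooth_on U ('D_v F).
Proof. by move=> k; have [_ /(_ v)] := sF k.+1. Qed.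

Lemma smooth_continuous x : U x -> {for x, continuous F}.
Proof. exact: (sF 0). Qed.

End Smooth.

Lemma smooth_schwarz (R : realType) n p q (U : set 'rV[R]_n) (F : 'rV[R]_n -> 'M[R]_(p, q))
  x u v : open U -> smooth_on U F -> U x ->
  'D_v ('D_u F) x = 'D_u ('D_v F) x.
Proof.
move=> oU sF Ux; have nU : \forall y \near x, U y by exact: open_nbhs_nbhs.
have nUU y : U y -> \forall y \near y, U y by move=> Uy; exact: open_nbhs_nbhs.
have dF w y : U y -> derivable F y w by exact: smooth_derivable.
have dDF w w' y : U y -> derivable ('D_w F) y w' by apply: smooth_derivable; exact: smooth_derive.
have E1 i j w y : U y -> 'D_w (fun z => F z i j) y = ('D_w F y) i j.
  by move=> Uy; rewrite derive_entry //; exact: dF.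
have nE1 i j w y : U y -> \forall z \near y, ('D_w F z) i j = 'D_w (fun z => F z i j) z.
  by move=> /nUU; apply: filterS => z Uz; rewrite E1.
have d2 i j w w' y : U y -> derivable ('D_w (fun z => F z i j)) y w'.
  move=> Uy; apply: (near_eq_derivable (nE1 i j w y Uy)).
  by apply: derivable_entry; exact: dDF.
have E2 i j w w' y : U y -> 'D_w' ('D_w (fun z => F z i j)) y = ('D_w' ('D_w F) y) i j.
  move=> Uy; rewrite -(near_eq_derive _ (nE1 i j w y Uy)) derive_entry //.
  exact: dDF.
have c2 i j w w' : {for x, continuous ('D_w' ('D_w (fun z => F z i j)))}.
  have nE2 : \forall y \near x, ('D_w' ('D_w F) y) i j = 'D_w' ('D_w (fun z => F z i j)) y.
    by apply: filterS nU => y Uy; rewrite E2.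
  apply: (cvg_trans (near_eq_cvg nE2)); rewrite /= (E2 i j w w' x Ux).
  apply: (@continuous_comp _ _ _ ('D_w' ('D_w F)) (fun A : 'M[R]_(p, q) => A i j)).
    by apply: (smooth_continuous _ Ux); do 2!apply: smooth_derive.
  exact: coord_continuous.
apply/matrixP => i j; apply: (etrans (esym (E2 i j u v x Ux))).
apply: (etrans _ (E2 i j v u x Ux)).
apply: schwarz.
- apply: filterS nU => y Uy; split; apply: derivable_entry; exact: dF.
- apply: filterS nU => y Uy; split; exact: d2.
- exact: c2.
- exact: c2.
Qed.

(** * Curvature of a metric in coordinates *)

Lemma form_mxD (R : realType) n (A B : 'M[R]_n) u v :
  form (A + B) u v = form A u v + form B u v.
Proof. by rewrite /form mulmxDr mulmxDl mxE. Qed.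

Lemma form_mxZ (R : realType) n a (A : 'M[R]_n) u v : form (a *: A) u v = a * form A u v.
Proof. by rewrite /form -scalemxAr -scalemxAl mxE. Qed.


(* Sealed, because failed unification attempts would unfold [derive]. *)
HB.lock Definition dmetric {R : realType} {n : nat} (g : 'rV[R]_n -> 'M[R]_n)
  (x w u v : 'rV[R]_n) : R := form ('D_w g x) u v.
HB.lock Definition hess {R : realType} {n : nat} (g : 'rV[R]_n -> 'M[R]_n)
  (x u v w z : 'rV[R]_n) : R := form ('D_u ('D_v g) x) w z.
HB.lock Definition gamma {R : realType} {n : nat} (g : 'rV[R]_n -> 'M[R]_n)
  (x u v : 'rV[R]_n) : 'rV[R]_n := christoffel g x u v.
HB.lock Definition riem {R : realType} {n : nat} (g : 'rV[R]_n -> 'M[R]_n)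
  (x u v w z : 'rV[R]_n) : R := form (g x) (curv_at g x u v w) z.

Lemma gammaE (R : realType) n (g : 'rV[R]_n -> 'M[R]_n) x u v :
  christoffel g x u v = gamma g x u v.
Proof. by rewrite gamma.unlock. Qed.

(** * Christoffel symbols and the symmetries of the Riemann tensor *)

Section Metric.
Context {R : realType} {n : nat}.
Local Notation V := 'rV[R]_n.
Variables (U : set V) (g : V -> 'M[R]_n).
Hypotheses (oU : open U) (sg : smooth_on U g).
Hypothesis gsym : forall x, U x -> (g x)^T = g x.
Hypothesis gpos : forall x, U x -> forall u, u != 0 -> 0 < form (g x) u u.
Implicit Types (x u v w z : V).

Local Notation dg := (dmetric g).
Local Notation hs := (hess g).
Local Notation Gam := (gamma g).

Definition first_kind x u v w : R := 2^-1 * (dg x u v w + dg x v u w - dg x w u v).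
Local Notation Lam := first_kind.

Definition derive_first_kind x u v w z : R :=
  2^-1 * (hs x u v w z + hs x u w v z - hs x u z v w).
Local Notation DLam := derive_first_kind.

Lemma near_U x : U x -> \forall y \near x, U y.
Proof. by move=> Ux; exact: open_nbhs_nbhs. Qed.

Lemma dmetricC x w u v : U x -> dg x w u v = dg x w v u.
Proof.
move=> Ux; rewrite dmetric.unlock; apply: formC.
rewrite -derive_trmx; last exact: (smooth_derivable sg).
apply: near_eq_derive; apply: filterS (near_U Ux) => y Uy; exact: gsym.
Qed.

Lemma dmetric_lin1 x a w w' u v : U x ->
  dg x (a *: w + w') u v = a * dg x w u v + dg x w' u v.
Proof.
move=> Ux; have E := derive_dirP a w w' (smooth_differentiable sg Ux).
by rewrite dmetric.unlock E form_mxD form_mxZ.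
Qed.

Lemma dmetric_lin2 x a w u u' v : dg x w (a *: u + u') v = a * dg x w u v + dg x w u' v.
Proof. by rewrite dmetric.unlock formDl formZl. Qed.

Lemma dmetric_lin3 x a w u u' v : dg x w v (a *: u + u') = a * dg x w v u + dg x w v u'.
Proof. by rewrite dmetric.unlock formDr formZr. Qed.

Lemma first_kindC x u v w : U x -> Lam x u v w = Lam x v u w.
Proof. by move=> Ux; rewrite /Lam (dmetricC w u v Ux); ring. Qed.

Lemma dmetricE x u v w : U x -> dg x u v w = Lam x u v w + Lam x u w v.
Proof. by move=> Ux; rewrite /Lam (dmetricC u w v Ux); field. Qed.

Lemma first_kind_lin3 x u v a w w' : U x ->
  Lam x u v (a *: w + w') = a * Lam x u v w + Lam x u v w'.
Proof. by move=> Ux; rewrite /Lam (dmetric_lin1 _ _ _ _ _ Ux) !dmetric_lin3; ring. Qed.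

Lemma first_kind_lin1 x v w a u u' : U x ->
  Lam x (a *: u + u') v w = a * Lam x u v w + Lam x u' v w.
Proof. by move=> Ux; rewrite /Lam (dmetric_lin1 _ _ _ _ _ Ux) !dmetric_lin2; ring. Qed.

Lemma gamma_form x u v w : U x -> form (g x) (Gam x u v) w = Lam x u v w.
Proof.
move=> Ux; have L : (fun w => 2^-1 * (form ('D_u g x) v w + form ('D_v g x) u w
    - form ('D_w g x) u v)) = Lam x u v.
  by apply/funext => y; rewrite /Lam dmetric.unlock.
rewrite gamma.unlock /christoffel L (form_sharp (gpos Ux)) => // a y y'.
exact: first_kind_lin3.
Qed.

Lemma gammaC x u v : U x -> Gam x u v = Gam x v u.
Proof.
move=> Ux; apply: (form_inj (gpos Ux)) => w.
by rewrite !(gamma_form _ _ _ Ux) first_kindC.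
Qed.

Lemma gamma_lin1 x v a u u' : U x ->
  Gam x (a *: u + u') v = a *: Gam x u v + Gam x u' v.
Proof.
move=> Ux; apply: (form_inj (gpos Ux)) => w.
by rewrite formDl formZl !(gamma_form _ _ _ Ux) first_kind_lin1.
Qed.

Lemma gamma0l x v : U x -> Gam x 0 v = 0.
Proof.
move=> Ux; have := gamma_lin1 v (-1) 0 0 Ux.
by rewrite scaler0 addr0 scaleN1r addNr.
Qed.

Lemma derive_form_cst (A : V -> 'M[R]_n) x z u v : derivable A x z ->
  derivable (fun y => form (A y) u v) x z /\
  'D_z (fun y => form (A y) u v) x = form ('D_z A x) u v.
Proof.
move=> dA; have du := derivable_cst u x z; have dv := derivable_cst v x z.
split; first exact: (derivable_form dA du dv).
have := derive_form dA du dv; rewrite !derive_cst form0l form0r !addr0; exact.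
Qed.

Lemma derive_dmetric x z w u v : U x ->
  derivable (fun y => dg y w u v) x z /\ 'D_z (fun y => dg y w u v) x = hs x z w u v.
Proof.
move=> Ux; rewrite dmetric.unlock hess.unlock.
exact: (derive_form_cst u v (smooth_derivable (smooth_derive sg w) Ux)).
Qed.

Lemma derive_Lam x z u v w : U x ->
  derivable (fun y => Lam y u v w) x z /\
  'D_z (fun y => Lam y u v w) x = DLam x z u v w.
Proof.
move=> Ux.
have [d1 e1] := derive_dmetric z u v w Ux; have [d2 e2] := derive_dmetric z v u w Ux.
have [d3 e3] := derive_dmetric z w u v Ux.
have d12 := derivableD d1 d2; have d123 := derivableB d12 d3.
have E : (fun y => Lam y u v w) = 2^-1 \*: ((fun y => dg y u v w) + (fun y => dg y v u w) -
    (fun y => dg y w u v)) by apply/funext.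
rewrite E; split; first exact: derivableZ.
by rewrite (deriveZ _ d123) (deriveB d12 d3) (deriveD d1 d2) e1 e2 e3.
Qed.

Lemma derivable_gamma x z u v : U x -> derivable (fun y => Gam y u v) x z.
Proof.
move=> Ux; rewrite gamma.unlock; apply: derivable_mulmx.
  apply/derivable_mxP => i j; under eq_fun do rewrite mxE.
  have [] := derive_Lam z u v (delta_mx 0 j) Ux.
  by rewrite /Lam dmetric.unlock.
apply: derivable_invmx; last exact: (smooth_derivable sg).
by apply: filterS (near_U Ux) => y Uy; apply: form_unitmx; exact: gpos.
Qed.

Lemma covd_cst u v : covd g (fun=> u) (fun=> v) = fun y => Gam y u v.
Proof. by apply/funext => y; rewrite /covd derive_cst add0r gamma.unlock. Qed.

Lemma curv_atE x u v w : U x -> curv_at g x u v w =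
  'D_u (fun y => Gam y v w) x + Gam x u (Gam x v w) -
  ('D_v (fun y => Gam y u w) x + Gam x v (Gam x u w)).
Proof.
move=> Ux; rewrite /curv_at /curvature !covd_cst /covd /lie_bracket !derive_cst.
by rewrite subrr !gammaE (gamma0l _ Ux) addr0 subr0.
Qed.

(** Differentiating the relation [gamma_form] expresses the metric product of the derivative of
    [Gam] with [z] by first-kind symbols, so the inverse metric is never differentiated explicitly.
    Metric compatibility, [dmetricE], turns the remaining terms into products of two Christoffel
    vectors. *)
Lemma riemE x u v w z : U x -> riem g x u v w z =
  DLam x u v w z - DLam x v u w z
  - form (g x) (Gam x u z) (Gam x v w) + form (g x) (Gam x v z) (Gam x u w).
Proof.
move=> Ux.
have H a b c : form (g x) ('D_a (fun y => Gam y b c) x) z =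
    DLam x a b c z - dg x a (Gam x b c) z.
  have dG : derivable (fun y => Gam y b c) x a := derivable_gamma Ux.
  have dgg : derivable g x a := smooth_derivable sg Ux.
  have [_ <-] := derive_Lam a b c z Ux.
  have E : \forall y \near x, form (g y) (Gam y b c) z = Lam y b c z.
    by apply: filterS (near_U Ux) => y Uy; exact: gamma_form.
  have := derive_form dgg dG (derivable_cst z x a).
  rewrite (near_eq_derive _ E) derive_cst form0r addr0 dmetric.unlock => ->.
  by rewrite addrAC subrr add0r.
rewrite riem.unlock (curv_atE u v w Ux) formBl !formDl !H.
rewrite !(gamma_form _ _ _ Ux) !(dmetricE _ _ _ Ux).
by ring.
Qed.

Lemma hessC x u v w z : U x -> hs x u v w z = hs x v u w z.
Proof. by move=> Ux; have E := smooth_schwarz u v oU sg Ux; rewrite hess.unlock E. Qed.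

Lemma hess_sym x u v w z : U x -> hs x u v w z = hs x u v z w.
Proof.
move=> Ux; have [_ <-] := derive_dmetric u v w z Ux; have [_ <-] := derive_dmetric u v z w Ux.
by apply: near_eq_derive; apply: filterS (near_U Ux) => y Uy; exact: dmetricC.
Qed.

Lemma hess_lin1 x a u u' v w z : U x ->
  hs x (a *: u + u') v w z = a * hs x u v w z + hs x u' v w z.
Proof.
move=> Ux; have E := derive_dirP a u u' (smooth_differentiable (smooth_derive sg v) Ux).
by rewrite hess.unlock E form_mxD form_mxZ.
Qed.

(** The classical expression by second derivatives of the metric, in which the symmetries of the
    Riemann tensor become visible. *)
Lemma riem_hess x u v w z : U x -> riem g x u v w z =
  2^-1 * (hs x u w v z - hs x u z v w - hs x v w u z + hs x v z u w)
  - form (g x) (Gam x u z) (Gam x v w) + form (g x) (Gam x v z) (Gam x u w).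
Proof. by move=> Ux; rewrite (riemE _ _ _ _ Ux) /DLam (hessC v u _ _ Ux); ring. Qed.

Lemma riem_antisym12 x u v w z : U x -> riem g x u v w z = - riem g x v u w z.
Proof. by move=> Ux; rewrite !(riem_hess _ _ _ _ Ux); ring. Qed.

Lemma riem_pair x u v w z : U x -> riem g x u v w z = riem g x w z u v.
Proof.
move=> Ux; have gC := formC (gsym Ux); rewrite !(riem_hess _ _ _ _ Ux).
rewrite (hessC w u _ _ Ux) (hessC w v _ _ Ux) (hessC z u _ _ Ux) (hessC z v _ _ Ux).
rewrite (hess_sym u w v z Ux) (hess_sym u z v w Ux) (hess_sym v w u z Ux) (hess_sym v z u w Ux).
rewrite (gammaC w v Ux) (gammaC z u Ux) (gammaC z v Ux) (gammaC w u Ux).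
by rewrite (gC (Gam x v w)); ring.
Qed.

Lemma riem_bianchi x u v w z : U x ->
  riem g x u v w z + riem g x v w u z + riem g x w u v z = 0.
Proof.
move=> Ux; rewrite !(riem_hess _ _ _ _ Ux).
rewrite (hessC w u _ _ Ux) (hessC w v _ _ Ux) (hessC v u _ _ Ux).
rewrite (gammaC w v Ux) (gammaC w u Ux) (gammaC v u Ux).
rewrite (hess_sym u z w v Ux) (hess_sym v z u w Ux) (hess_sym w z v u Ux).
by ring.
Qed.

Lemma riem_add1 x u u' v w z : U x ->
  riem g x (u + u') v w z = riem g x u v w z + riem g x u' v w z.
Proof.
move=> Ux; have H := hess_lin1 1 u u' _ _ _ Ux; have G := gamma_lin1 _ 1 u u' Ux.
have Hs a b c : hs x a (u + u') b c = hs x u a b c + hs x u' a b c.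
  by rewrite (hessC a _ _ _ Ux) -[u in LHS]scale1r H mul1r.
have Hs3 a b c : hs x a b (u + u') c = hs x a b u c + hs x a b u' c.
  by rewrite hess.unlock formDl.
have Hs4 a b c : hs x a b c (u + u') = hs x a b c u + hs x a b c u'.
  by rewrite hess.unlock formDr.
have Gs a : Gam x (u + u') a = Gam x u a + Gam x u' a.
  by rewrite -[u in LHS]scale1r G scale1r.
rewrite !(riem_hess _ _ _ _ Ux) !(hessC (u + u') _ _ _ Ux) !Hs !Hs3 !Gs !formDl !formDr.
by ring.
Qed.

End Metric.

(** * Sectional curvature determines the curvature tensor *)

Section ConstantCurvature.
Context {R : realType} {n : nat}.
Local Notation V := 'rV[R]_n.
Variables (U : set V) (g : V -> 'M[R]_n).
Hypotheses (oU : open U) (sg : smooth_on U g).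
Hypothesis gsym : forall x, U x -> (g x)^T = g x.
Hypothesis gpos : forall x, U x -> forall u, u != 0 -> 0 < form (g x) u u.

(** The difference [T] of the two sides has the symmetries of a curvature tensor and vanishes on
    [u v v u]. Polarising makes it antisymmetric in its outer arguments as well, hence invariant
    under cyclic permutations of the first three, and the Bianchi identity becomes [3 T = 0]. *)
Lemma constant_curvature_riem x k : U x ->
  (forall u v, riem g x u v v u =
     k * (form (g x) u u * form (g x) v v - form (g x) u v ^+ 2)) ->
  forall u v w z, riem g x u v w z =
    k * (form (g x) v w * form (g x) u z - form (g x) u w * form (g x) v z).
Proof.
move=> Ux K.
have gC := formC (gsym Ux).
pose T u v w z := riem g x u v w z -
   k * (form (g x) v w * form (g x) u z - form (g x) u w * form (g x) v z).
have T12 u v w z : T u v w z = - T v u w z.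
  by rewrite /T (riem_antisym12 oU sg gsym gpos u v w z Ux); ring.
have Tpair u v w z : T u v w z = T w z u v.
  rewrite /T (riem_pair oU sg gsym gpos u v w z Ux).
  by rewrite (gC w v) (gC w u) (gC z u) (gC z v); ring.
have T34 u v w z : T u v w z = - T u v z w by rewrite Tpair T12 Tpair.
have Tb u v w z : T u v w z + T v w u z + T w u v z = 0.
  have := riem_bianchi oU sg gsym gpos u v w z Ux.
  rewrite /T (gC w u) (gC w v) (gC u v) => B.
  by rewrite -[RHS]B; ring.
have Tl1 u u' v w z : T (u + u') v w z = T u v w z + T u' v w z.
  by rewrite /T (riem_add1 oU sg gsym gpos u u' v w z Ux) !formDl; ring.
have Tl2 u u' v w z : T v (u + u') w z = T v u w z + T v u' w z.
  by rewrite T12 Tl1 T12 (T12 u') opprD !opprK.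
have Tl3 u u' v w z : T v w (u + u') z = T v w u z + T v w u' z.
  by rewrite Tpair Tl1 (Tpair u) (Tpair u').
have T0 u v : T u v v u = 0.
  by rewrite /T K (gC v u) expr2 mulrC; ring.
have T14 u v w : T u v w u = 0.
  have := T0 u (v + w); rewrite Tl2 !Tl3 !T0 add0r addr0.
  have -> : T u w v u = T u v w u by rewrite Tpair T12 T34 opprK.
  by move/eqP; rewrite -mulr2n mulrn_eq0 /= => /eqP.
have Tl4 u u' v w z : T v w z (u + u') = T v w z u + T v w z u'.
  by rewrite T34 Tl3 opprD -!T34.
have T14s u v w z : T u v w z = - T z v w u.
  have := T14 (u + z) v w; rewrite Tl1 !Tl4 !T14 add0r addr0 => /eqP.
  by rewrite addr_eq0 => /eqP.
move=> u v w z.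
have cyc a b c d : T b c a d = T a b c d.
  by rewrite [RHS]T14s [X in - X]T12 [X in - - X]T34 [X in - - - X]T14s
    [X in - - - - X]T12 [X in - - - - - X]T14s !opprK.
have /eqP := Tb u v w z; rewrite (cyc v w u z) !(cyc u v w z) -mulr2n -mulrSr mulrn_eq0 /=.
by rewrite /T subr_eq0 => /eqP.
Qed.

End ConstantCurvature.

(** * The Gauss equation *)

HB.lock Definition dvec {R : realType} {n p : nat} (F : 'rV[R]_n -> 'rV[R]_p)
  (x u : 'rV[R]_n) : 'rV[R]_p := 'D_u F x.
HB.lock Definition ddvec {R : realType} {n p : nat} (F : 'rV[R]_n -> 'rV[R]_p)
  (x u v : 'rV[R]_n) : 'rV[R]_p := 'D_u ('D_v F) x.
HB.lock Definition dddvec {R : realType} {n p : nat} (F : 'rV[R]_n -> 'rV[R]_p)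
  (x u v w : 'rV[R]_n) : 'rV[R]_p := 'D_u ('D_v ('D_w F)) x.

Section Gauss.
Context {R : realType} {n p : nat}.
Local Notation V := 'rV[R]_n.
Local Notation W := 'rV[R]_p.
Variables (U : set V) (T : set W) (F : V -> W) (g : V -> 'M[R]_n) (gt : W -> 'M[R]_p).
Hypotheses (oU : open U) (oT : open T).
Hypotheses (sF : smooth_on U F) (sg : smooth_on U g) (sgt : smooth_on T gt).
Hypothesis FT : forall x, U x -> T (F x).
Hypothesis gsym : forall x, U x -> (g x)^T = g x.
Hypothesis gpos : forall x, U x -> forall u, u != 0 -> 0 < form (g x) u u.
Hypothesis gtsym : forall x, T x -> (gt x)^T = gt x.
Hypothesis gtpos : forall x, T x -> forall u, u != 0 -> 0 < form (gt x) u u.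
Local Notation dF := (dvec F).
Local Notation ddF := (ddvec F).
Local Notation dddF := (dddvec F).
Hypothesis iso : forall x, U x -> forall u v,
  form (g x) u v = form (gt (F x)) (dF x u) (dF x v).

Lemma dvec_lin x a u u' : U x -> dF x (a *: u + u') = a *: dF x u + dF x u'.
Proof.
move=> Ux; rewrite dvec.unlock.
exact: (derive_dirP a u u' (smooth_differentiable sF Ux)).
Qed.

Lemma ddvec_lin1 x a u u' v : U x -> ddF x (a *: u + u') v = a *: ddF x u v + ddF x u' v.
Proof.
move=> Ux; rewrite ddvec.unlock.
exact: (derive_dirP a u u' (smooth_differentiable (smooth_derive sF v) Ux)).
Qed.

Lemma ddvecC x u v : U x -> ddF x u v = ddF x v u.
Proof. by move=> Ux; rewrite ddvec.unlock; exact: (smooth_schwarz v u oU sF Ux). Qed.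

Lemma dddvecC x u v w : U x -> dddF x u v w = dddF x v u w.
Proof.
by move=> Ux; rewrite dddvec.unlock; exact: (smooth_schwarz v u oU (smooth_derive sF w) Ux).
Qed.

Lemma derive_dvec x u v : U x ->
  derivable (fun y => dF y v) x u /\ 'D_u (fun y => dF y v) x = ddF x u v.
Proof.
move=> Ux; rewrite dvec.unlock ddvec.unlock; split=> //.
exact: (smooth_derivable (smooth_derive sF v) Ux).
Qed.

Lemma derive_ddvec x u v w : U x ->
  derivable (fun y => ddF y v w) x u /\ 'D_u (fun y => ddF y v w) x = dddF x u v w.
Proof.
move=> Ux; rewrite dddvec.unlock ddvec.unlock; split=> //.
exact: (smooth_derivable (smooth_derive (smooth_derive sF w) v) Ux).
Qed.

Lemma derive_pull (q : nat) (phi : W -> 'M[R]_q) x u : smooth_on T phi -> U x ->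
  derivable (fun y => phi (F y)) x u /\
  'D_u (fun y => phi (F y)) x = 'D_(dF x u) phi (F x).
Proof.
move=> sphi Ux; have dFx := smooth_differentiable sF Ux.
have dphi := smooth_differentiable sphi (FT Ux).
split; first exact: derivable_chain.
by rewrite (derive_chain u dFx dphi) dvec.unlock.
Qed.

Lemma dmetric_pull x u v w : U x -> dmetric g x u v w =
  dmetric gt (F x) (dF x u) (dF x v) (dF x w) +
  form (gt (F x)) (ddF x u v) (dF x w) + form (gt (F x)) (dF x v) (ddF x u w).
Proof.
move=> Ux; have dg : derivable g x u := smooth_derivable sg Ux.
have [_ E] := derive_form_cst v w dg.
rewrite dmetric.unlock -E.
have nE : \forall y \near x, form (g y) v w = form (gt (F y)) (dF y v) (dF y w).
  by apply: filterS (near_U oU Ux) => y Uy; exact: iso.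
rewrite (near_eq_derive _ nE).
have [d1 e1] := derive_pull u sgt Ux.
have [d2 e2] := derive_dvec u v Ux; have [d3 e3] := derive_dvec u w Ux.
by rewrite (derive_form d1 d2 d3) e1 e2 e3.
Qed.

(** In the Koszul combination of the derivatives of the metric, the symmetry of the second
    derivatives of [F] cancels all of them but the one along [u] and [v]. *)
Lemma first_kind_pull x u v w : U x -> first_kind g x u v w =
  form (gt (F x)) (ddF x u v) (dF x w) + first_kind gt (F x) (dF x u) (dF x v) (dF x w).
Proof.
move=> Ux; have C := formC (gtsym (FT Ux)).
rewrite /first_kind !(dmetric_pull _ _ _ Ux).
rewrite (ddvecC w u Ux) (ddvecC w v Ux) (ddvecC v u Ux).
rewrite (C (dF x v) (ddF x u w)) (C (dF x u)).
by field.
Qed.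

(** Both the base point and the direction in which [gt] is differentiated depend on [y]. Expanding
    the direction in the standard basis leaves products of a coordinate with a derivative in a fixed
    direction. *)
Lemma derive_dmetric_pull x u a b c : U x ->
  derivable (fun y => dmetric gt (F y) (dF y a) (dF y b) (dF y c)) x u /\
  'D_u (fun y => dmetric gt (F y) (dF y a) (dF y b) (dF y c)) x =
  hess gt (F x) (dF x u) (dF x a) (dF x b) (dF x c)
  + dmetric gt (F x) (ddF x u a) (dF x b) (dF x c)
  + dmetric gt (F x) (dF x a) (ddF x u b) (dF x c)
  + dmetric gt (F x) (dF x a) (dF x b) (ddF x u c).
Proof.
move=> Ux.
have [da ea] := derive_dvec u a Ux.
have [db eb] := derive_dvec u b Ux; have [dc ec] := derive_dvec u c Ux.
pose e i : W := delta_mx 0 i.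
pose f i y := dF y a 0 i * form ('D_(e i) gt (F y)) (dF y b) (dF y c).
have sumE (L : W -> R) (q : W) : (forall a u v, L (a *: u + v) = a * L u + L v) ->
    \sum_i q 0 i * L (e i) = L q.
  move=> lin; have L0 : L 0 = 0 by have := lin (-1) 0 0; rewrite scaler0 addr0; lra.
  have LD v w : L (v + w) = L v + L w by have := lin 1 v w; rewrite scale1r mul1r.
  rewrite [in RHS](row_sum_delta q) (big_morph L LD L0); apply: eq_bigr => i _.
  by have := lin (q 0 i) (e i) 0; rewrite !addr0 L0 addr0 => ->.
have fE y : U y -> \sum_i f i y = dmetric gt (F y) (dF y a) (dF y b) (dF y c).
  move=> Uy; rewrite -(sumE (fun d => dmetric gt (F y) d (dF y b) (dF y c))).
    by apply: eq_bigr => i _; rewrite /f dmetric.unlock.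
  by move=> k d d'; rewrite (dmetric_lin1 sgt _ _ _ _ _ (FT Uy)).
have df i : derivable (f i) x u /\ 'D_u (f i) x =
    ddF x u a 0 i * dmetric gt (F x) (e i) (dF x b) (dF x c) +
    dF x a 0 i * (hess gt (F x) (dF x u) (e i) (dF x b) (dF x c)
      + dmetric gt (F x) (e i) (ddF x u b) (dF x c)
      + dmetric gt (F x) (e i) (dF x b) (ddF x u c)).
  have [d1 e1] := derive_pull u (smooth_derive sgt (e i)) Ux.
  have d2 := derivable_form d1 db dc; have e2 := derive_form d1 db dc.
  have d3 : derivable (fun y => dF y a 0 i) x u := derivable_entry da.
  have e3 := derive_entry 0 i da; rewrite ea in e3.
  split; first exact: (derivableM d3 d2).
  rewrite /f (deriveM d3 d2) e2 e3 e1 eb ec dmetric.unlock hess.unlock.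
  by rewrite /GRing.scale /= addrC [in X in X + _]mulrC.
have nE : \forall y \near x, \sum_i f i y = dmetric gt (F y) (dF y a) (dF y b) (dF y c).
  by apply: filterS (near_U oU Ux) => y Uy; exact: fE.
have dS : derivable (fun y => \sum_i f i y) x u.
  by apply: derivable_sum_fun => i _; have [] := df i.
split; first exact: (near_eq_derivable nE dS).
rewrite -(near_eq_derive _ nE) derive_sum_fun; last by move=> i; have [] := df i.
rewrite (eq_bigr _ (fun i _ => (df i).2)) big_split /=.
rewrite (sumE (fun d => dmetric gt (F x) d (dF x b) (dF x c))); last first.
  by move=> k d d'; rewrite (dmetric_lin1 sgt _ _ _ _ _ (FT Ux)).
rewrite (sumE (fun d => hess gt (F x) (dF x u) d (dF x b) (dF x c)
      + dmetric gt (F x) d (ddF x u b) (dF x c)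
      + dmetric gt (F x) d (dF x b) (ddF x u c))); last first.
  move=> k d d'; rewrite !(dmetric_lin1 sgt _ _ _ _ _ (FT Ux)).
  rewrite !(hessC oT sgt (dF x u) _ _ _ (FT Ux)) (hess_lin1 sgt _ _ _ _ _ _ (FT Ux)).
  by ring.
by ring.
Qed.

Lemma derive_first_kind_pull x u v w z : U x ->
  derive_first_kind g x u v w z =
  dmetric gt (F x) (dF x u) (ddF x v w) (dF x z) + form (gt (F x)) (dddF x u v w) (dF x z)
  + form (gt (F x)) (ddF x v w) (ddF x u z)
  + derive_first_kind gt (F x) (dF x u) (dF x v) (dF x w) (dF x z)
  + first_kind gt (F x) (ddF x u v) (dF x w) (dF x z)
  + first_kind gt (F x) (dF x v) (ddF x u w) (dF x z)
  + first_kind gt (F x) (dF x v) (dF x w) (ddF x u z).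
Proof.
move=> Ux; have [_ <-] := derive_Lam sg u v w z Ux.
have nE : \forall y \near x, first_kind g y v w z =
    form (gt (F y)) (ddF y v w) (dF y z) + 2^-1 *
    (dmetric gt (F y) (dF y v) (dF y w) (dF y z) + dmetric gt (F y) (dF y w) (dF y v) (dF y z)
     - dmetric gt (F y) (dF y z) (dF y v) (dF y w)).
  by apply: filterS (near_U oU Ux) => y Uy; exact: first_kind_pull.
rewrite (near_eq_derive _ nE).
have [d1 e1] := derive_dmetric_pull u v w z Ux.
have [d2 e2] := derive_dmetric_pull u w v z Ux.
have [d3 e3] := derive_dmetric_pull u z v w Ux.
have [dg eg] := derive_pull u sgt Ux.
have [dd ed] := derive_ddvec u v w Ux.
have [dz ez] := derive_dvec u z Ux.
have d4 := derivable_form dg dd dz; have e4 := derive_form dg dd dz.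
have d12 := derivableD d1 d2; have d123 := derivableB d12 d3.
have d5 := derivableZ (k := 2^-1) d123.
rewrite (deriveD d4 d5) e4 (deriveZ _ d123) (deriveB d12 d3) (deriveD d1 d2) e1 e2 e3.
rewrite eg ed ez -[form ('D_ _ _ _) _ _]/(_) /GRing.scale /= /derive_first_kind /first_kind.
have -> : form ('D_(dF x u) gt (F x)) (ddF x v w) (dF x z) =
  dmetric gt (F x) (dF x u) (ddF x v w) (dF x z) by rewrite dmetric.unlock.
by ring.
Qed.

Definition second x u v : W :=
  ddF x u v + gamma gt (F x) (dF x u) (dF x v) - dF x (gamma g x u v).

Lemma cov_form x u v w : U x ->
  form (gt (F x)) (ddF x u v + gamma gt (F x) (dF x u) (dF x v)) (dF x w)
  = first_kind g x u v w.
Proof.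
move=> Ux; rewrite formDl (gamma_form sgt gtpos _ _ _ (FT Ux)).
by rewrite first_kind_pull.
Qed.

(** The ambient derivative along [F] and the image of the intrinsic one have the same products with
    tangent vectors, namely the first-kind symbol of [g]. *)
Lemma second_normal x u v w : U x -> form (gt (F x)) (second x u v) (dF x w) = 0.
Proof.
by move=> Ux; rewrite /second formBl cov_form // -iso // (gamma_form sg gpos _ _ _ Ux) subrr.
Qed.

Lemma secondC x u v : U x -> second x u v = second x v u.
Proof.
move=> Ux; rewrite /second (ddvecC u v Ux) (gammaC oU sg gsym gpos u v Ux).
by rewrite (gammaC oT sgt gtsym gtpos _ _ (FT Ux)).
Qed.

Lemma second_lin1 x a u u' v : U x ->
  second x (a *: u + u') v = a *: second x u v + second x u' v.
Proof.
move=> Ux; rewrite /second (ddvec_lin1 _ _ _ _ Ux) !(dvec_lin _ _ _ Ux).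
rewrite (gamma_lin1 sg gpos _ _ _ _ Ux) (gamma_lin1 sgt gtpos _ _ _ _ (FT Ux)).
rewrite (dvec_lin _ _ _ Ux) scalerBr scalerDr opprD.
by apply/rowP => i; rewrite !mxE; ring.
Qed.

(** Both curvatures are written by first-kind symbols, those of [g] being pulled back along [F]. The
    third derivatives of [F] cancel by symmetry, and what remains matches the products of second
    fundamental forms expanded in [S], where normality removes the tangential part of one factor. *)
Lemma gauss x u v w z : U x ->
  riem g x u v w z = riem gt (F x) (dF x u) (dF x v) (dF x w) (dF x z)
  + form (gt (F x)) (second x v w) (second x u z)
  - form (gt (F x)) (second x u w) (second x v z).
Proof.
move=> Ux; have C := formC (gtsym (FT Ux)).
have S a b c d : form (gt (F x)) (second x a b) (second x c d) =
    form (gt (F x)) (ddF x a b) (ddF x c d)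
    + first_kind gt (F x) (dF x c) (dF x d) (ddF x a b)
    + first_kind gt (F x) (dF x a) (dF x b) (ddF x c d)
    + form (gt (F x)) (gamma gt (F x) (dF x a) (dF x b)) (gamma gt (F x) (dF x c) (dF x d))
    - form (g x) (gamma g x a b) (gamma g x c d).
  rewrite {2}/second formBr second_normal // subr0 formDr /second !formBl !formDl.
  rewrite (C (dF x _) (ddF x c d)) (C (dF x _) (gamma _ _ _ _)).
  have := cov_form c d (gamma g x a b) Ux; rewrite formDl => H.
  rewrite (C (ddF x a b) (gamma _ _ _ _)) !(gamma_form sgt gtpos _ _ _ (FT Ux)).
  rewrite (gamma_form sgt gtpos _ _ _ (FT Ux)) in H.
  rewrite -(gamma_form sg gpos c d _ Ux) (formC (gsym Ux)) in H.
  rewrite -H; ring.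
rewrite !S (riemE oU sg gsym gpos _ _ _ _ Ux) (riemE oT sgt gtsym gtpos _ _ _ _ (FT Ux)).
rewrite !(derive_first_kind_pull _ _ _ _ Ux) (dddvecC v u w Ux) (ddvecC v u Ux).
rewrite !(dmetricE oT sgt gtsym _ _ _ (FT Ux)).
have Cg := formC (gsym Ux).
rewrite (Cg (gamma g x v w)) (Cg (gamma g x u w)).
rewrite (C (gamma gt _ (dF x v) (dF x w))) (C (gamma gt _ (dF x u) (dF x w))).
by ring.
Qed.

End Gauss.

(** * Submanifolds of space forms at a point *)

Lemma smooth_on_sub (R : realType) n (W : normedModType R) (A B : set 'rV[R]_n)
    (F : 'rV[R]_n -> W) : A `<=` B -> smooth_on B F -> smooth_on A F.
Proof.
move=> AB sF k; have {sF} := sF k; elim: k F => [|k IH] F /=.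
  by move=> H x /AB; exact: H.
by move=> [H1 H2]; split=> [x /AB|v]; [exact: H1|apply: IH; exact: H2].
Qed.

(** * Access to the anonymous fields of the manifold record *)

Section ManifoldAxioms.
Context {R : realType} {n : nat} (M : riemannian_manifold R n).
Implicit Types (i : chart_index M) (p : M).

Lemma manifold_covered p : exists i, dom i p.
Proof. by case: M p. Qed.
Lemma dom_open i : open (dom i).
Proof. by case: M i. Qed.
Lemma chart_image_open i : open (chart i @` dom i).
Proof. by case: M i. Qed.
Lemma chart_inv_continuous i : {within chart i @` dom i, continuous (chart_inv i)}.
Proof. by case: M i. Qed.
Lemma chart_invK i p : dom i p -> chart_inv i (chart i p) = p.
Proof. by case: M i p => ? ? ? ? ? ? ? ? ? ? ? ? ? ? H /= *; apply: H. Qed.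
Lemma metric_smooth i : smooth_on (chart i @` dom i) (metric i).
Proof. by case: M i. Qed.
Lemma metric_sym i x : (chart i @` dom i) x -> (metric i x)^T = metric i x.
Proof. by case: M i x => ? ? ? ? ? ? ? ? ? ? ? ? ? ? ? ? ? H /= *; apply: H. Qed.
Lemma metric_pos i x : (chart i @` dom i) x -> forall u, u != 0 -> 0 < form (metric i x) u u.
Proof. by case: M i x => ? ? ? ? ? ? ? ? ? ? ? ? ? ? ? ? ? ? H /= *; apply: H. Qed.

Lemma metric_at_sym i p : dom i p -> (metric_at i p)^T = metric_at i p.
Proof. by move=> ip; apply: metric_sym; exists p. Qed.
Lemma metric_at_pos i p : dom i p -> forall u, u != 0 -> 0 < form (metric_at i p) u u.
Proof. by move=> ip; apply: metric_pos; exists p. Qed.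

End ManifoldAxioms.

(** * Second fundamental form and Gauss equation in a pair of charts *)

Section PointData.
Context {R : realType} {n m : nat}.
Variables (M : riemannian_manifold R n) (N : riemannian_manifold R (n + m)).
Variables (f : M -> N) (k : R).
Hypotheses (hN : constant_curvature N k) (hf : isometric_immersion f).
Variables (i : chart_index M) (a : chart_index N) (p : M).
Hypotheses (ip : dom i p) (ap : dom a (f p)).

Local Notation x := (chart i p).
Local Notation F := (local_rep f i a).
Local Notation G := (metric_at i p).
Local Notation Gt := (metric_at a (f p)).
Local Notation U := (chart i @` (dom i `&` f @^-1` dom a)).

Lemma overlap_open : open U.
Proof.
have [fc _] := hf; rewrite openE => _ [q [iq aq] <-].
have oA : open (chart i @` dom i) by exact: chart_image_open.
have Aq : (chart i @` dom i) (chart i q) by exists q.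
have cinv : {for chart i q, continuous (chart_inv i)}.
  have := chart_inv_continuous (i := i).
  by rewrite (continuous_open_subspace _ oA) => /(_ (chart i q)); apply; rewrite inE.
have nA : nbhs (chart i q) (chart i @` dom i) by exact: open_nbhs_nbhs.
have nB : nbhs (chart i q) ((f \o chart_inv i) @^-1` dom a).
  apply: (@continuous_comp _ _ _ (chart_inv i) f) => //=; first exact: fc.
  by apply: open_nbhs_nbhs; split; [exact: dom_open|rewrite /= chart_invK].
apply: filterS (filterI nA nB) => y [[r ir <-]] /=; rewrite chart_invK // => ar.
by exists r.
Qed.

Lemma overlap_sub : U `<=` chart i @` dom i.
Proof. by move=> _ [q [iq _] <-]; exists q. Qed.

Lemma overlap_local_rep y : U y -> (chart a @` dom a) (F y).
Proof.
by move=> [q [iq aq] <-]; rewrite /local_rep /= chart_invK //; exists (f q).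
Qed.

Lemma local_rep_point : F x = chart a (f p).
Proof. by rewrite /local_rep /= chart_invK. Qed.

Lemma overlap_point : U x.
Proof. by exists p. Qed.

Let sF : smooth_on U F. Proof. by have [_ /(_ i a) []] := hf. Qed.
Let sg : smooth_on U (metric i).
Proof. exact: smooth_on_sub overlap_sub (metric_smooth i). Qed.
Let gsym y : U y -> (metric i y)^T = metric i y.
Proof. by move=> /overlap_sub; exact: metric_sym. Qed.
Let gpos y : U y -> forall u, u != 0 -> 0 < form (metric i y) u u.
Proof. by move=> /overlap_sub; exact: metric_pos. Qed.
Let iso y : U y -> forall u v, form (metric i y) u v =
  form (metric a (F y)) (dvec F y u) (dvec F y v).
Proof. by move=> Uy u v; have [_ /(_ i a) [_ H]] := hf; rewrite dvec.unlock; exact: H. Qed.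
Let oT : open (chart a @` dom a). Proof. exact: chart_image_open. Qed.
Let sgt : smooth_on (chart a @` dom a) (metric a). Proof. exact: metric_smooth. Qed.
Let gtsym y : (chart a @` dom a) y -> (metric a y)^T = metric a y.
Proof. exact: metric_sym. Qed.
Let gtpos y : (chart a @` dom a) y -> forall u, u != 0 -> 0 < form (metric a y) u u.
Proof. exact: metric_pos. Qed.

Lemma differential_linear b u v : 'D_(b *: u + v) F x = b *: 'D_u F x + 'D_v F x.
Proof. by have := dvec_lin sF b u v overlap_point; rewrite dvec.unlock. Qed.

Lemma differential_isometric u v : form G u v = form Gt ('D_u F x) ('D_v F x).
Proof. by have := iso overlap_point u v; rewrite local_rep_point dvec.unlock. Qed.

Lemma second_formE u v : second_form f i a p u v = second F (metric i) (metric a) x u v.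
Proof.
rewrite /second_form /second gamma.unlock ddvec.unlock dvec.unlock.
by rewrite covd_cst gamma.unlock.
Qed.

Lemma second_form_normal u v w : form Gt (second_form f i a p u v) ('D_w F x) = 0.
Proof.
have := second_normal overlap_open sF sg sgt overlap_local_rep gpos gtsym gtpos iso
  u v w overlap_point.
by rewrite -second_formE local_rep_point dvec.unlock.
Qed.

Lemma second_formC u v : second_form f i a p u v = second_form f i a p v u.
Proof.
rewrite !second_formE.
exact: (secondC overlap_open oT sF sg sgt overlap_local_rep gsym gpos gtsym gtpos
  u v overlap_point).
Qed.

Lemma second_form_linear b u u' v : second_form f i a p (b *: u + u') v =
  b *: second_form f i a p u v + second_form f i a p u' v.
Proof.
rewrite !second_formE.
exact: (second_lin1 sF sg sgt overlap_local_rep gpos gtpos b u u' v overlap_point).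
Qed.

Lemma gauss_equation X Y Z W : lower G (curv_op i p) X Y Z W =
  k * (form G Y Z * form G X W - form G X Z * form G Y W)
  + form Gt (second_form f i a p Y Z) (second_form f i a p X W)
  - form Gt (second_form f i a p X Z) (second_form f i a p Y W).
Proof.
have := gauss overlap_open oT sF sg sgt overlap_local_rep gsym gpos gtsym gtpos iso
  X Y Z W overlap_point.
rewrite -!second_formE => E.
have K : forall u v, riem (metric a) (F x) u v v u =
    k * (form (metric a (F x)) u u * form (metric a (F x)) v v - form (metric a (F x)) u v ^+ 2).
  by move=> u v; rewrite riem.unlock local_rep_point; exact: hN.
have := constant_curvature_riem oT sgt gtsym gtpos (overlap_local_rep overlap_point) K.
move=> KK; rewrite KK -!(iso overlap_point) local_rep_point riem.unlock in E.
exact: E.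
Qed.

End PointData.

(** * Orthonormal tangent and normal frames at a point *)

Section TangentFrame.
Context {R : realType} {n : nat}.
Variable G : 'M[R]_n.
Hypotheses (Gsym : G^T = G) (Gpos : forall u, u != 0 -> 0 < form G u u).

Lemma spd_frame : exists W : 'M[R]_n, W *m G *m W^T = 1%:M.
Proof. exact: (spd_factor Gsym Gpos). Qed.

Lemma orthonormal_mx (W : 'M[R]_n) : W *m G *m W^T = 1%:M ->
  orthonormal G (fun i => row i W).
Proof. by move=> WG i j; rewrite -mulmx_tr_form WG mxE. Qed.

Lemma frame_expand (E : 'I_n -> 'rV[R]_n) X : orthonormal G E ->
  X = \sum_i form G X (E i) *: E i.
Proof.
move=> oE; pose W := \matrix_i E i.
have WG : W *m (G *m W^T) = 1%:M.
  by apply/matrixP => i j; rewrite mulmxA mulmx_tr_form !rowK oE mxE.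
have GW := mulmx1C WG.
rewrite -[LHS]mulmx1 -GW mulmxA mulmx_sum_row; apply: eq_bigr => i _.
by rewrite rowK mulmxA mxE /form mxE; congr (_ *: _); apply: eq_bigr => j _; rewrite !mxE.
Qed.

Lemma parseval (E : 'I_n -> 'rV[R]_n) X Y : orthonormal G E ->
  form G X Y = \sum_i form G X (E i) * form G Y (E i).
Proof.
move=> oE; rewrite {1}(frame_expand X oE) form_suml; apply: eq_bigr => i _.
by rewrite formZl (formC Gsym (E i)).
Qed.

End TangentFrame.

Section NormalFrame.
Context {R : realType} {n m : nat}.
Variables (G : 'M[R]_n) (Gt : 'M[R]_(n + m)) (D : 'rV[R]_n -> 'rV[R]_(n + m)).
Hypotheses (Gsym : G^T = G) (Gpos : forall u, u != 0 -> 0 < form G u u).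
Hypotheses (Gtsym : Gt^T = Gt) (Gtpos : forall u, u != 0 -> 0 < form Gt u u).
Hypothesis Dlin : forall b u v, D (b *: u + v) = b *: D u + D v.
Hypothesis iso : forall u v, form G u v = form Gt (D u) (D v).

(** In an orthonormal ambient frame [P], the image of a tangent frame is a matrix [K] with
    orthonormal rows, and its completion [L] gives the normal vectors. The last clause lets the
    second fundamental form be recovered from its shape components. *)
Lemma normal_frame_exists : exists xi : 'I_m -> 'rV[R]_(n + m),
  [/\ orthonormal Gt xi, forall al u, form Gt (xi al) (D u) = 0 &
      forall eta, (forall u, form Gt eta (D u) = 0) ->
        eta = \sum_al form Gt eta (xi al) *: xi al].
Proof.
have [W WG] := spd_frame Gsym Gpos; have [P PG] := spd_frame Gtsym Gtpos.
have oW := orthonormal_mx WG; have oP := orthonormal_mx PG.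
pose K : 'M[R]_(n, n + m) := \matrix_(i, j) form Gt (D (row i W)) (row j P).
have KD i : row i K *m P = D (row i W).
  rewrite mulmx_sum_row [RHS](frame_expand _ oP); apply: eq_bigr => j _.
  by rewrite !mxE.
have KK : K *m K^T = 1%:M.
  apply/matrixP => i j; rewrite !mxE -(oW i j) iso (parseval Gtsym _ _ oP).
  by apply: eq_bigr => l _; rewrite !mxE.
have [L [LL LK]] := orthonormal_completion KK.
have fP (x y : 'rV[R]_(n + m)) : form Gt (x *m P) (y *m P) = (x *m y^T) 0 0.
  by rewrite /form trmx_mul !mulmxA -(mulmxA x P) -(mulmxA x) PG mulmx1.
have Dspan u : D u = \sum_i form G u (row i W) *: D (row i W).
  have D0 : D 0 = 0 by have := Dlin (-1) 0 0; rewrite scaler0 addr0 scaleN1r addNr.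
  rewrite {1}(frame_expand u oW) (big_morph D (id1 := 0) (op1 := +%R)) //.
    apply: eq_bigr => i _.
    by have := Dlin (form G u (row i W)) (row i W) 0; rewrite !addr0 D0 addr0.
  by move=> v w; have := Dlin 1 v w; rewrite !scale1r.
exists (fun al => row al L *m P); split.
- move=> al be; rewrite fP; have /matrixP /(_ al be) := LL; rewrite [RHS]mxE => <-.
  by rewrite tr_row -row_mul !mxE; apply: eq_bigr => j _; rewrite !mxE.
- move=> al u; rewrite Dspan form_sumr big1 // => i _; rewrite formZr -KD fP.
  have -> : (row al L *m (row i K)^T) 0 0 = (L *m K^T) al i.
    by rewrite !mxE; apply: eq_bigr => j _; rewrite !mxE.
  by rewrite LK mxE mulr0.
move=> eta eta0.
pose y := \row_j form Gt eta (row j P).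
have yP : y *m P = eta.
  rewrite mulmx_sum_row [RHS](frame_expand _ oP); apply: eq_bigr => j _.
  by rewrite !mxE.
have yK : y *m K^T = 0.
  apply/rowP => i; have := eta0 (row i W); rewrite -KD -yP fP => E.
  by rewrite [RHS]mxE -E !mxE; apply: eq_bigr => j _; rewrite !mxE.
(* [B] is square with orthonormal rows, so its columns are orthonormal too, and a row annihilated by
   [K^T] equals its projection onto the rows of [L]. *)
pose B := col_mx K L.
have BB : B *m B^T = 1%:M.
  rewrite tr_col_mx mul_col_row KK LL LK -[K *m L^T]trmxK trmx_mul trmxK LK trmx0.
  by rewrite -scalar_mx_block.
have yB : y = y *m L^T *m L.
  rewrite -[LHS]mulmx1 -(mulmx1C BB) tr_col_mx mul_row_col mulmxDr !mulmxA.
  by rewrite yK mul0mx add0r.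
rewrite -[LHS]yP [in LHS]yB -mulmxA mulmx_sum_row; apply: eq_bigr => al _.
rewrite row_mul; congr (_ *: _).
by rewrite -yP fP !mxE; apply: eq_bigr => j _; rewrite !mxE.
Qed.
End NormalFrame.

Lemma sum_lt_sym (R : realType) n (s : 'I_n -> 'I_n -> R) :
  (forall j l, s j l = s l j) -> (forall j, s j j = 0) ->
  2 * (\sum_(j < n) \sum_(l < n | (j < l)%N) s j l) = \sum_j \sum_l s j l.
Proof.
move=> sC s0.
have E : \sum_(j < n) \sum_(l < n | (l < j)%N) s j l = \sum_(j < n) \sum_(l < n | (j < l)%N) s j l.
  rewrite (exchange_big_dep xpredT) //=; apply: eq_bigr => j _.
  by apply: eq_bigr => l _; rewrite sC.
transitivity (\sum_(j < n) (\sum_(l < n | (j < l)%N) s j l + \sum_(l < n | (l < j)%N) s j l)).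
  by rewrite big_split /= E; ring.
apply: eq_bigr => j _; rewrite [RHS](bigID (fun l : 'I_n => (j < l)%N)) /=; congr (_ + _).
rewrite [RHS](bigD1 j) ?ltnn //= s0 add0r; apply: eq_bigl => l.
by rewrite -leqNgt andbC -val_eqE /= ltn_neqAle.
Qed.

HB.lock Definition shape {R : realType} {n m : nat} {M : riemannian_manifold R n}
    {N : riemannian_manifold R (n + m)} (f : M -> N) (i : chart_index M) (a : chart_index N)
    (p : M) (eta : 'rV[R]_(n + m)) (X Y : 'rV[R]_n) : R :=
  form (metric_at a (f p)) eta (second_form f i a p X Y).

Lemma frob_sub_scalar (R : realFieldType) n (A : 'M[R]_n) c :
  frob (A - c%:M) (A - c%:M) = frob A A - 2 * c * \tr A + n%:R * c ^+ 2.
Proof.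
have As B : frob B c%:M = c * \tr B by rewrite /frob tr_scalar_mx mul_mx_scalar mxtraceZ.
rewrite -scaleN1r frobDl frobZl !(frobC _ (_ + _)) !frobDl !frobZl !(frobC c%:M) !As.
by rewrite mxtrace_scalar -[c *+ n]mulr_natl; ring.
Qed.

Lemma comm_sub_scalar (R : realFieldType) n (A B : 'M[R]_n) c d :
  comm (A - c%:M) (B - d%:M) = comm A B.
Proof.
rewrite /comm !mulmxBl !mulmxBr !mul_scalar_mx !mul_mx_scalar.
move: (A *m B) (B *m A) => P Q.
by apply/matrixP => y z; rewrite !mxE; case: (y == z); rewrite ?mulr1n ?mulr0n; ring.
Qed.

(** * The Wintgen equality as an equality between matrix norms *)

Section Wintgen.
Context {R : realType} {n m : nat}.
Variables (M : riemannian_manifold R n) (N : riemannian_manifold R (n + m)).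
Variables (f : M -> N) (k : R).
Hypotheses (hN : constant_curvature N k) (hf : isometric_immersion f).
Variables (i : chart_index M) (a : chart_index N) (p : M).
Hypotheses (ip : dom i p) (ap : dom a (f p)).
Hypothesis n4 : (4 <= n)%N.
Variables (E : 'I_n -> 'rV[R]_n) (xi : 'I_m -> 'rV[R]_(n + m)).
Local Notation G := (metric_at i p).
Local Notation Gt := (metric_at a (f p)).
Local Notation h := (second_form f i a p).
Local Notation Df u := ('D_u (local_rep f i a) (chart i p)).
Hypotheses (oE : orthonormal G E) (oxi : orthonormal Gt xi).
Hypothesis xi_span : forall eta, (forall u, form Gt eta (Df u) = 0) ->
  eta = \sum_al form Gt eta (xi al) *: xi al.

Let Gsym : G^T = G := metric_at_sym ip.
Let Gpos : forall u, u != 0 -> 0 < form G u u := metric_at_pos ip.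
Let Gtsym : Gt^T = Gt := metric_at_sym ap.

Let hC X Y : h X Y = h Y X := second_formC hf ip ap X Y.
Let hlin b X X' Y : h (b *: X + X') Y = b *: h X Y + h X' Y :=
  second_form_linear hf ip ap b X X' Y.

Local Notation shape al := (shape f i a p (xi al)).
Definition shape_mx al : 'M[R]_n := \matrix_(j, l) shape al (E j) (E l).

Lemma shapeE al X Y : form Gt (xi al) (h X Y) = shape al X Y.
Proof. by rewrite shape.unlock. Qed.

Lemma shapeC al X Y : shape al X Y = shape al Y X.
Proof. by rewrite shape.unlock hC. Qed.

Lemma shape_lin1 al b X X' Y : shape al (b *: X + X') Y = b * shape al X Y + shape al X' Y.
Proof. by rewrite shape.unlock hlin formDr formZr. Qed.

Lemma shape_mx_sym al : (shape_mx al)^T = shape_mx al.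
Proof. by apply/matrixP => j l; rewrite !mxE shapeC. Qed.

Lemma second_form_span X Y : h X Y = \sum_al shape al X Y *: xi al.
Proof.
rewrite [LHS]xi_span => [|u]; last exact: (second_form_normal hf ip ap).
by apply: eq_bigr => al _; rewrite (formC Gtsym) shape.unlock.
Qed.

Lemma second_form_inner X Y Z W : form Gt (h X Y) (h Z W) = \sum_al shape al X Y * shape al Z W.
Proof.
by rewrite {1}second_form_span form_suml; apply: eq_bigr => al _;
  rewrite formZl; congr (_ * _); exact: shapeE.
Qed.

Lemma shape_expand al X Y : shape al X Y = \sum_j form G X (E j) * shape al (E j) Y.
Proof.
have s0 : shape al 0 Y = 0.
  by have := shape_lin1 al (-1) 0 0 Y; rewrite scaler0 addr0; lra.
have sD v w : shape al (v + w) Y = shape al v Y + shape al w Y.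
  by have := shape_lin1 al 1 v w Y; rewrite scale1r mul1r.
rewrite {1}(frame_expand X oE) (big_morph (fun X => shape al X Y) sD s0); apply: eq_bigr => j _.
by have := shape_lin1 al (form G X (E j)) (E j) 0 Y; rewrite !addr0 s0 addr0.
Qed.

Lemma shape_op_form al X Y : form G (shape_op f i a p (xi al) X) Y = shape al X Y.
Proof.
rewrite /shape_op (form_sharp Gpos) => [|b u v]; first by rewrite shape.unlock.
apply: (etrans (shapeE _ _ _)); rewrite shapeC shape_lin1 !(shapeC al _ X).
by congr (_ * _ + _); apply: esym; exact: shapeE.
Qed.

(** Composition of shape operators reverses the order of the matrices, whose row index is the
    argument; this explains the sign, which disappears on squaring. *)
Lemma normal_curvE j l al be :
  normal_curv f i a p (E j) (E l) (xi al) (xi be) = - comm (shape_mx al) (shape_mx be) j l.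
Proof.
have T al' be' : form G (shape_op f i a p (xi al') (shape_op f i a p (xi be') (E j))) (E l) =
    \sum_q shape_mx be' j q * shape_mx al' q l.
  apply: (etrans (shape_op_form al' _ _)); apply: (etrans (shape_expand _ _ _)).
  apply: eq_bigr => q _; rewrite !mxE; congr (_ * _); exact: shape_op_form.
apply: (etrans (formBl _ _ _ _)).
apply: (etrans (congr2 (fun b c : R => b - c) (T al be) (T be al))).
by rewrite /comm [in RHS]mxE [X in - (X + _)]mxE [X in - (_ + X)]mxE [X in - (_ - X)]mxE opprB.
Qed.

Let nn : n%:R * (n%:R - 1) != 0 :> R.
Proof.
have : 4 <= n%:R :> R by rewrite (ler_nat R 4 n).
by move=> H; rewrite mulf_neq0 //; apply/eqP; lra.
Qed.

(** Sums over all ordered pairs, of tangent and of normal indices, count each term four times; the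
    factor 4 under the root is the 2 of the definition. *)
Lemma norm_normal_curvE : norm_normal_curv f i a p E xi =
  (n%:R * (n%:R - 1))^-1 *
  Num.sqrt (\sum_al \sum_be
    frob (comm (shape_mx al) (shape_mx be)) (comm (shape_mx al) (shape_mx be))).
Proof.
pose c al be j l := comm (shape_mx al) (shape_mx be) j l ^+ 2.
have cT al be : (comm (shape_mx al) (shape_mx be))^T = - comm (shape_mx al) (shape_mx be).
  by rewrite /comm linearB /= !trmx_mul !shape_mx_sym opprB.
have cjl al be j l : c al be j l = c al be l j.
  have /matrixP /(_ l j) := cT al be; rewrite mxE [RHS]mxE => H.
  by rewrite /c H sqrrN.
have cab al be j l : c al be j l = c be al j l.
  have cO : comm (shape_mx al) (shape_mx be) = - comm (shape_mx be) (shape_mx al).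
    by rewrite /comm opprB.
  by rewrite /c cO mxE sqrrN.
have cjj al be j : c al be j j = 0.
  have /matrixP /(_ j j) := cT al be; rewrite mxE [RHS]mxE => H.
  have -> : c al be j j = comm (shape_mx al) (shape_mx be) j j ^+ 2 by [].
  by apply/eqP; rewrite sqrf_eq0; apply/eqP; lra.
have caa al j l : c al al j l = 0 by rewrite /c /comm subrr mxE expr0n.
have Q : 4 * (\sum_(j < n) \sum_(l < n | (j < l)%N)
            \sum_(al < m) \sum_(be < m | (al < be)%N)
              normal_curv f i a p (E j) (E l) (xi al) (xi be) ^+ 2) =
   \sum_al \sum_be frob (comm (shape_mx al) (shape_mx be)) (comm (shape_mx al) (shape_mx be)).
  have E1 j l : 2 * (\sum_(al < m) \sum_(be < m | (al < be)%N)
              normal_curv f i a p (E j) (E l) (xi al) (xi be) ^+ 2) =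
         \sum_al \sum_be c al be j l.
    rewrite -sum_lt_sym //; congr (_ * _); apply: eq_bigr => al _; apply: eq_bigr => be _.
    by rewrite normal_curvE sqrrN.
  transitivity (2 * (\sum_(j < n) \sum_(l < n | (j < l)%N) \sum_al \sum_be c al be j l)).
    have -> : 4 = 2 * 2 :> R by ring.
    rewrite -mulrA; congr (_ * _); rewrite mulr_sumr; apply: eq_bigr => j _.
    by rewrite mulr_sumr; apply: eq_bigr => l _; rewrite -E1.
  rewrite (sum_lt_sym (s := fun j l => \sum_al \sum_be c al be j l)); first last.
  - by move=> j; apply: big1 => al _; apply: big1 => be _.
  - by move=> j l; apply: eq_bigr => al _; apply: eq_bigr => be _.
  transitivity (\sum_j \sum_al \sum_be \sum_l c al be j l).
    apply: eq_bigr => j _; rewrite exchange_big /=; apply: eq_bigr => al _.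
    by rewrite exchange_big.
  rewrite exchange_big /=; apply: eq_bigr => al _; rewrite exchange_big /=; apply: eq_bigr => be _.
  by rewrite frobE; do 2!(apply: eq_bigr => ? _); rewrite /c expr2.
rewrite /norm_normal_curv -Q sqrtrM; last by rewrite ler0n.
have -> : Num.sqrt 4 = 2 :> R.
  have -> : 4 = 2 ^+ 2 :> R by ring.
  by rewrite sqrtr_sqr ger0_norm.
by rewrite mulrA [_^-1 * 2]mulrC.
Qed.

Lemma mean_curv_vecE : mean_curv_vec f i a p E =
  \sum_al (n%:R^-1 * \tr (shape_mx al)) *: xi al.
Proof.
rewrite /mean_curv_vec (eq_bigr _ (fun j _ => second_form_span (E j) (E j))) exchange_big /=.
rewrite scaler_sumr; apply: eq_bigr => al _; rewrite -scaler_suml scalerA; congr (_ * _ *: _).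
by apply: eq_bigr => j _; rewrite mxE.
Qed.

Lemma mean_curvE : mean_curv f i a p E ^+ 2 = \sum_al (n%:R^-1 * \tr (shape_mx al)) ^+ 2.
Proof.
rewrite /mean_curv; have -> : form Gt (mean_curv_vec f i a p E) (mean_curv_vec f i a p E) =
    \sum_al (n%:R^-1 * \tr (shape_mx al)) ^+ 2.
  rewrite mean_curv_vecE form_suml; apply: eq_bigr => al _.
  rewrite formZl form_sumr (bigD1 al) //= big1 ?addr0 => [|be bea]; rewrite formZr oxi.
    by rewrite eqxx mulr1 expr2.
  by rewrite eq_sym (negPf bea) mulr0.
by rewrite sqr_sqrtr //; apply: sumr_ge0 => al _; exact: sqr_ge0.
Qed.

Lemma gauss_shape X Y Z W : lower G (curv_op i p) X Y Z W =
  k * (form G Y Z * form G X W - form G X Z * form G Y W)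
  + \sum_al (shape al Y Z * shape al X W - shape al X Z * shape al Y W).
Proof.
rewrite (gauss_equation hN hf ip ap X Y Z W) -addrA sumrB; congr (_ + _).
exact: (congr2 (fun b c : R => b - c) (second_form_inner Y Z X W) (second_form_inner X Z Y W)).
Qed.

Lemma norm_scal_curvE : norm_scal_curv G (curv_op i p) E =
  k + (n%:R * (n%:R - 1))^-1 *
    (\sum_al (\tr (shape_mx al) ^+ 2 - frob (shape_mx al) (shape_mx al))).
Proof.
pose s j l := lower G (curv_op i p) (E j) (E l) (E l) (E j).
have sE j l : s j l = k * (1 - (j == l)%:R) +
   \sum_al (shape_mx al j j * shape_mx al l l - shape_mx al j l ^+ 2).
  rewrite /s gauss_shape !oE !eqxx; congr (_ + _).
    by rewrite [l == j]eq_sym; case: (j == l); rewrite /=; ring.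
  by apply: eq_bigr => al _; rewrite !mxE (shapeC al (E l) (E j)) expr2 mulrC.
have sC j l : s j l = s l j.
  rewrite !sE eq_sym; congr (_ + _); apply: eq_bigr => al _.
  by rewrite -[in shape_mx al j l]shape_mx_sym [_^T j l]mxE; ring.
have s0 j : s j j = 0.
  by rewrite sE eqxx subrr mulr0 add0r big1 // => al _; ring.
rewrite /norm_scal_curv mulrAC [2 * _]sum_lt_sym //.
have -> : \sum_j \sum_l s j l = k * (n%:R * (n%:R - 1)) +
   \sum_al (\tr (shape_mx al) ^+ 2 - frob (shape_mx al) (shape_mx al)).
  rewrite (eq_bigr _ (fun j _ => eq_bigr _ (fun l _ => sE j l))).
  under eq_bigr do rewrite big_split /=.
  rewrite big_split /=; congr (_ + _).
    under eq_bigr => j _.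
      rewrite -mulr_sumr sumrB sumr_const card_ord (bigD1 j) //= eqxx big1 ?addr0; last first.
        by move=> l lj; rewrite eq_sym (negPf lj).
      over.
    by rewrite sumr_const card_ord -[LHS]mulr_natl /=; ring.
  under eq_bigr do rewrite exchange_big /=.
  rewrite exchange_big /=; apply: eq_bigr => al _.
  under eq_bigr do rewrite sumrB.
  rewrite sumrB frobE; congr (_ - _).
    by rewrite expr2 /mxtrace mulr_suml; apply: eq_bigr => j _; rewrite mulr_sumr.
by move: nn; rewrite mulf_eq0 negb_or => /andP[n0 n1]; field; rewrite n0 n1.
Qed.

(** Splitting each shape matrix into [H al] times the identity and a traceless [B al], the terms in
    [k] and [H al ^+ 2] cancel. The hypothesis then says that the root of the sum of squared
    commutator norms is the sum of the squared norms of the [B al]. *)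
Lemma wintgen_ddvv :
  norm_scal_curv G (curv_op i p) E =
    mean_curv f i a p E ^+ 2 - norm_normal_curv f i a p E xi + k ->
  exists (e1 e2 : 'rV[R]_n) (H s t : 'I_m -> R),
  [/\ form G e1 e1 = 1, form G e2 e2 = 1, form G e1 e2 = 0,
     forall al X Y, shape al X Y = H al * form G X Y
       + s al * (form G X e1 * form G Y e1 - form G X e2 * form G Y e2)
       + t al * (form G X e1 * form G Y e2 + form G X e2 * form G Y e1) &
     \sum_al s al ^+ 2 = \sum_al t al ^+ 2 /\ \sum_al s al * t al = 0].
Proof.
rewrite norm_scal_curvE mean_curvE norm_normal_curvE.
pose H al := n%:R^-1 * \tr (shape_mx al); pose B al := shape_mx al - (H al)%:M.
have n0 : (n%:R : R) != 0 by move: nn; rewrite mulf_eq0 negb_or => /andP[].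
have BB al : frob (shape_mx al) (shape_mx al) = frob (B al) (B al) + n%:R * H al ^+ 2.
  have trA : \tr (shape_mx al) = n%:R * H al by rewrite mulrA divff // mul1r.
  by rewrite frob_sub_scalar trA; ring.
have CC al be : comm (shape_mx al) (shape_mx be) = comm (B al) (B be).
  by rewrite comm_sub_scalar.
set T := \sum_al \sum_be _ => W.
have T0 : 0 <= T by apply: sumr_ge0 => al _; apply: sumr_ge0 => be _; exact: frob_ge0.
have SB : Num.sqrt T = \sum_al frob (B al) (B al).
  move: W; rewrite -/(H _) addrC => /addIr.
  have -> : \sum_al (\tr (shape_mx al) ^+ 2 - frob (shape_mx al) (shape_mx al)) =
    n%:R * (n%:R - 1) * \sum_al H al ^+ 2 - \sum_al frob (B al) (B al).
    rewrite mulr_sumr -sumrB; apply: eq_bigr => al _; rewrite BB.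
    have -> : \tr (shape_mx al) = n%:R * H al by rewrite mulrA divff // mul1r.
    by ring.
  rewrite mulrBr mulrA mulVf // mul1r => /eqP; rewrite (inj_eq (addrI _)) eqr_opp => /eqP.
  by move/(mulfI (invr_neq0 nn)).
have BE : \sum_al \sum_be frob (comm (B al) (B be)) (comm (B al) (B be)) =
    (\sum_al frob (B al) (B al)) ^+ 2.
  rewrite -SB sqr_sqrtr // /T; apply: eq_bigr => al _; apply: eq_bigr => be _.
  by rewrite CC.
have Bsym al : (B al)^T = B al by rewrite /B linearB /= tr_scalar_mx shape_mx_sym.
have [u [v [s [t [uu vv uv Bst st]]]]] := ddvv_equality (ltnW (ltnW n4)) Bsym BE.
pose e (w : 'rV[R]_n) : 'rV[R]_n := \sum_j w 0 j *: E j.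
have ge w X : form G X (e w) = \sum_j w 0 j * form G X (E j).
  by rewrite form_sumr; apply: eq_bigr => j _; rewrite formZr.
have gee w w' : form G (e w) (e w') = (w *m w'^T) 0 0.
  rewrite ge mul_rowV_tr; apply: eq_bigr => j _; rewrite mulrC; congr (_ * _).
  rewrite form_suml (bigD1 j) //= big1 ?addr0 => [|l lj]; rewrite formZl oE.
    by rewrite eqxx mulr1.
  by rewrite (negPf lj) mulr0.
exists (e u), (e v), H, s, t; split=> //.
- by rewrite gee uu mxE eqxx.
- by rewrite gee vv mxE eqxx.
- by rewrite gee uv mxE.
move=> al X Y.
have BX c (w w' : 'rV[R]_n) :
    \sum_j \sum_l form G X (E j) * form G Y (E l) * (c * (w 0 j * w' 0 l)) =
    c * (form G X (e w) * form G Y (e w')).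
  rewrite !ge mulr_suml mulr_sumr; apply: eq_bigr => j _.
  by rewrite mulr_sumr mulr_sumr; apply: eq_bigr => l _; ring.
have entry j l : shape_mx al j l = (H al) *+ (j == l) +
  (s al * (u 0 j * u 0 l) + - s al * (v 0 j * v 0 l)
   + t al * (u 0 j * v 0 l) + t al * (v 0 j * u 0 l)).
  have -> : shape_mx al = (H al)%:M + B al by rewrite addrC subrK.
  by rewrite Bst !mxE !big_ord1 !mxE; ring.
have -> : shape al X Y = \sum_j \sum_l form G X (E j) * form G Y (E l) * shape_mx al j l.
  rewrite shape_expand; apply: eq_bigr => j _; rewrite shapeC shape_expand mulr_sumr.
  by apply: eq_bigr => l _; rewrite !mxE (shapeC al (E l)); ring.
transitivity (\sum_j \sum_l (form G X (E j) * form G Y (E l) * (H al *+ (j == l)) +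
    (form G X (E j) * form G Y (E l) * (s al * (u 0 j * u 0 l)) +
    (form G X (E j) * form G Y (E l) * (- s al * (v 0 j * v 0 l)) +
    (form G X (E j) * form G Y (E l) * (t al * (u 0 j * v 0 l)) +
    (form G X (E j) * form G Y (E l) * (t al * (v 0 j * u 0 l)))))))).
  by apply: eq_bigr => j _; apply: eq_bigr => l _; rewrite entry; ring.
under eq_bigr do rewrite !big_split /=.
rewrite !big_split /=.
rewrite !BX (parseval Gsym X Y oE) mulr_sumr.
rewrite (eq_bigr (fun j => H al * (form G X (E j) * form G Y (E j)))); first by ring.
move=> j _; rewrite (bigD1 j) //= eqxx big1 ?addr0; first by rewrite mulr1n; ring.
by move=> l lj; rewrite eq_sym (negPf lj) mulr0n mulr0.
Qed.

End Wintgen.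

(** * Conclusion *)

Lemma orthogonal_unit_vector (R : realType) n q (G : 'M[R]_n) (e : 'I_q -> 'rV[R]_n) :
  (forall u, u != 0 -> 0 < form G u u) -> (q < n)%N ->
  exists2 w, form G w w = 1 & forall j, form G w (e j) = 0.
Proof.
move=> Gpos qn; pose A := G *m (\matrix_j e j)^T.
have /rowV0Pn [w /sub_kermxP wA w0] : kermx A != 0.
  rewrite kermx_eq0 /row_free ltn_eqF //.
  exact: leq_ltn_trans (rank_leq_col A) qn.
have gw := Gpos w w0; pose r := Num.sqrt (form G w w).
have r0 : r != 0 by rewrite sqrtr_eq0 -ltNge.
exists (r^-1 *: w) => [|j].
  rewrite formZl formZr -{1}[form G w w]sqr_sqrtr ?ltW // -/r.
  by field.
rewrite formZl; apply/eqP; rewrite mulf_eq0; apply/orP; right; apply/eqP.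
have /rowP /(_ j) := wA; rewrite [RHS]mxE => <-.
rewrite /A mulmxA /form [RHS]mxE mxE; apply: eq_bigr => l _.
by rewrite !mxE.
Qed.

Lemma two_orthogonal_unit_vectors (R : realType) n (G : 'M[R]_n) (e1 e2 : 'rV[R]_n) :
  G^T = G -> (forall u, u != 0 -> 0 < form G u u) -> (4 <= n)%N ->
  exists e3 e4, [/\ form G e3 e3 = 1, form G e4 e4 = 1, form G e3 e4 = 0,
    form G e1 e3 = 0 /\ form G e1 e4 = 0 & form G e2 e3 = 0 /\ form G e2 e4 = 0].
Proof.
move=> Gsym Gpos n4; have C := formC Gsym.
have [e3 e33 e3o] := orthogonal_unit_vector (fun j : 'I_2 => nth 0 [:: e1; e2] j) Gpos (ltnW n4).
have [e4 e44 e4o] := orthogonal_unit_vector (fun j : 'I_3 => nth 0 [:: e1; e2; e3] j) Gpos n4.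
exists e3, e4; split=> //.
- by rewrite C; exact: (e4o (@Ordinal 3 2 isT)).
- split; rewrite C; [exact: (e3o (@Ordinal 2 0 isT)) | exact: (e4o (@Ordinal 3 0 isT))].
- split; rewrite C; [exact: (e3o (@Ordinal 2 1 isT)) | exact: (e4o (@Ordinal 3 1 isT))].
Qed.

Section Final.
Context {R : realType} {n m : nat}.
Variables (M : riemannian_manifold R n) (N : riemannian_manifold R (n + m)).
Variables (f : M -> N) (k : R).
Hypotheses (hN : constant_curvature N k) (hf : isometric_immersion f).
Hypothesis n4 : (4 <= n)%N.

Lemma umbilical_weyl0 : totally_umbilical f -> conformally_flat M.
Proof.
move=> umb i p ip X Y Z W.
have [a ap] := manifold_covered (f p).
have Gsym := metric_at_sym ip; have Gpos := metric_at_pos ip.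
have [Q QG] := spd_frame Gsym Gpos; have oE := orthonormal_mx QG.
pose E j := row j Q; pose j0 : 'I_n := Ordinal (leq_trans (isT : 0 < 4)%N n4).
pose j1 : 'I_n := Ordinal (leq_trans (isT : 1 < 4)%N n4).
have U := umb i a p ip ap E oE.
set Hv := mean_curv_vec f i a p E in U.
(* The curvature is that of a space form, a plane-adapted tensor with [nu = tau = x = 0]; any two
   frame vectors may span the plane. *)
have RRE X' Y' Z' W' : lower (metric_at i p) (curv_op i p) X' Y' Z' W' =
    plane_curv (metric_at i p) (E j0) (E j1)
      (k + form (metric_at a (f p)) Hv Hv) 0 0 0 X' Y' Z' W'.
  rewrite (gauss_equation hN hf ip ap) (U Y' Z') (U X' W') (U X' Z') (U Y' W').
  by rewrite !formZl !formZr /plane_curv /plane_form; ring.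
rewrite (weyl_planeE Gsym Gpos _ _ _ n4 RRE); first by ring.
- by rewrite oE eqxx.
- by rewrite oE eqxx.
- by rewrite oE.
Qed.

Lemma umbilical_dependent : totally_umbilical f -> RC_QRicR_dependent M.
Proof.
move=> /umbilical_weyl0 cf i p ip; exists 1, 0; split; first by rewrite oner_eq0.
move=> X1 X2 X3 X4 X Y; rewrite mul1r mul0r addr0 /tensor_RC /act.
by rewrite !(cf i p ip) !addr0 oppr0.
Qed.

Lemma dependent_umbilical : wintgen_ideal f k -> 0 < k ->
  RC_QRicR_dependent M -> totally_umbilical f.
Proof.
move=> hW k0 dep i a p ip ap E oE u v.
have Gsym := metric_at_sym ip; have Gpos := metric_at_pos ip.
have [xi [oxi xn xs]] := normal_frame_exists Gsym Gpos (metric_at_sym ap) (metric_at_pos ap)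
  (differential_linear hf ip ap) (differential_isometric hf ip ap).
have [e1 [e2 [H [s [t [e11 e22 e12 shE [st st0]]]]]]] :=
  wintgen_ddvv hN hf ip ap n4 oE oxi xs (hW i a p ip ap E xi oE (conj oxi xn)).
have [e3 [e4 [e33 e44 e34 [e13 e14] [e23 e24]]]] := two_orthogonal_unit_vectors e1 e2 Gsym Gpos n4.
(* The place where the positivity of [k] is used. *)
have c0 : 0 < k + \sum_al H al ^+ 2.
  by rewrite ltr_pwDl // sumr_ge0 // => al _; exact: sqr_ge0.
have x0 : 0 <= 2 * \sum_al s al ^+ 2.
  by rewrite mulr_ge0 // sumr_ge0 // => al _; exact: sqr_ge0.
have RRE X Y Z W : lower (metric_at i p) (curv_op i p) X Y Z W =
    plane_curv (metric_at i p) e1 e2 (k + \sum_al H al ^+ 2) (\sum_al H al * s al)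
      (\sum_al H al * t al) (2 * \sum_al s al ^+ 2) X Y Z W.
  rewrite (gauss_shape hN hf ip ap xs).
  pose g := form (metric_at i p).
  pose D A B := g A e1 * g B e1 - g A e2 * g B e2.
  pose S A B := g A e1 * g B e2 + g A e2 * g B e1.
  (* Sorting by monomials in [H], [s], [t]: the first three kinds give [c], [nu] and [tau]. The
     [s ^ 2] and [t ^ 2] terms are both minus the curvature of the plane and, having equal sums,
     give [x = 2 |s| ^ 2]; the mixed sum is zero by [st0]. *)
  rewrite (eq_bigr (fun al => H al ^+ 2 * (g Y Z * g X W - g X Z * g Y W)
    + H al * s al * (g Y Z * D X W + D Y Z * g X W - g X Z * D Y W - D X Z * g Y W)
    + H al * t al * (g Y Z * S X W + S Y Z * g X W - g X Z * S Y W - S X Z * g Y W)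
    + s al ^+ 2 * (D Y Z * D X W - D X Z * D Y W)
    + t al ^+ 2 * (S Y Z * S X W - S X Z * S Y W)
    + s al * t al * (D Y Z * S X W + S Y Z * D X W - D X Z * S Y W - S X Z * D Y W))).
    rewrite !big_split /= -!mulr_suml st0 -st /D /S /plane_curv /plane_form /plane_area -/g.
    by ring.
  by move=> al _; rewrite !shE /D /S /g; ring.
have := plane_dependent_flat Gsym Gpos e11 e22 e12 e33 e44 e34 e13 e14 e23 e24
  n4 RRE c0 x0 (dep i p ip).
move/eqP; rewrite mulf_eq0 pnatr_eq0 /= => /eqP S0.
have s0 al : s al = 0.
  apply/eqP; rewrite -sqrf_eq0; apply/eqP.
  by apply: (psumr_eq0P (P := xpredT) _ S0) => // ? _; exact: sqr_ge0.
have t0 al : t al = 0.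
  apply/eqP; rewrite -sqrf_eq0; apply/eqP; rewrite st in S0.
  by apply: (psumr_eq0P (P := xpredT) _ S0) => // ? _; exact: sqr_ge0.
have hE X Y : second_form f i a p X Y = form (metric_at i p) X Y *: \sum_al H al *: xi al.
  rewrite (second_form_span hf ip ap xs) scaler_sumr; apply: eq_bigr => al _.
  by rewrite shE s0 t0 !mul0r !addr0 scalerA mulrC.
rewrite hE /mean_curv_vec; congr (_ *: _).
have -> : \sum_(j < n) second_form f i a p (E j) (E j) = n%:R *: \sum_al H al *: xi al.
  transitivity (\sum_(j < n) \sum_al H al *: xi al); last by rewrite sumr_const card_ord scaler_nat.
  by apply: eq_bigr => j _; rewrite hE oE eqxx scale1r.
rewrite scalerA mulVf ?scale1r // pnatr_eq0 -lt0n.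
exact: leq_trans n4.
Qed.

End Final.

Theorem theorem17 (R : realType) (n m : nat) (hn : (4 <= n)%N) (hm : (1 <= m)%N)
    (k : R) (N : riemannian_manifold R (n + m)) (hN : constant_curvature N k)
    (M : riemannian_manifold R n) (f : M -> N) (hf : isometric_immersion f)
    (hW : wintgen_ideal f k) (hk : 0 < k) :
  (RC_QRicR_dependent M <-> totally_umbilical f) /\
  (totally_umbilical f -> conformally_flat M).
Proof.
split; last exact: umbilical_weyl0 hN hf hn.
split; first exact: dependent_umbilical hN hf hn hW hk.
exact: umbilical_dependent hN hf hn.
Qed.
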